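(* Let $n\ge 2$ and $0\le d\le n-1$ be integers, and let $\omega_d\in\left[\frac{d+1}{n-d},+\infty\right]$. Then \[\dim_H\left(\mathbf{W}_n^d(\omega_d)^*\right)=\dim_H\left(\mathbf{W}_n^d(\omega_d)\right)=d+\frac{n+1}{1+\omega_d},\] (with $\frac{n+1}{1+\omega_d}=0$ if $\omega_d=+\infty$). In particular, this Hausdorff dimension equals $n$ if and only if $\omega_d=\frac{d+1}{n-d}$.
   Context: $\dim_H$ denotes Hausdorff dimension. For $\boldsymbol\theta\in\mathbb{R}^n$ and $0\le d\le n-1$, the ordinary exponent $\omega_d(\boldsymbol\theta)$ is the supremum of real numbers $\omega$ such that for arbitrarily large real $H$ there exists a rational affine subspace $L\subset\mathbb{R}^n$ with $\dim L=d$, $H(L)\le H$ and $H(L)\,d(\boldsymbol\theta,L)\le H^{-\omega}$; here $H(L)$ is the (Schmidt) height of the rational affine subspace $L$ and $d(\boldsymbol\theta,L)=\min_{P\in L}d(\boldsymbol\theta,P)$ is the Euclidean distance from $\boldsymbol\theta$ to $L$. (These exponents are considered for $\boldsymbol\theta$ with $1,\theta_1,\dots,\theta_n$ linearly independent over $\mathbb{Q}$.) The Diophantine sets are $\mathbf{W}_n^d(\omega_d)=\{\boldsymbol\theta\in\mathbb{R}^n:\omega_d(\boldsymbol\theta)\ge\omega_d\}$ and $\mathbf{W}_n^d(\omega_d)^*=\{\boldsymbol\theta\in\mathbb{R}^n:\omega_d(\boldsymbol\theta)=\omega_d\}$. *)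

(* Defs.v *)
From Stdlib Require Import Reals ZArith QArith Qreals Lra.
Open Scope R_scope.

(* Points of R^n are represented as functions nat -> R whose coordinates
   of index >= n vanish. Coordinates are theta 0, ..., theta (n-1). *)
Definition VecN (n : nat) (x : nat -> R) : Prop := forall i, (n <= i)%nat -> x i = 0.

Fixpoint sumR (k : nat) (f : nat -> R) : R :=
  match k with O => 0 | S k' => sumR k' f + f k' end.

Definition euclid (n : nat) (x y : nat -> R) : R :=
  sqrt (sumR n (fun i => (x i - y i) ^ 2)).

Fixpoint det (k : nat) (M : nat -> nat -> R) : R :=
  match k with
  | O => 1
  | S k' => sumR (S k') (fun j =>
      (-1) ^ j * M 0%nat j *
      det k' (fun r c => M (S r) (if Nat.ltb c j then c else S c)))
  end.

(* ---------- Rational affine subspaces and their (Schmidt) height ----------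
   A rational affine subspace L of R^n of dimension d corresponds to the
   (d+1)-dimensional rational subspace V = span{(1,P) : P in L} of R^{n+1}.
   We describe it by a Z-basis x_0,...,x_d (x i l, i <= d, l <= n, column 0
   being the homogenising coordinate) of the lattice V cap Z^{n+1}.
   H(L) = covolume of that lattice = sqrt(det Gram(x_0,...,x_d)). *)

Definition combR (d : nat) (c : nat -> R) (x : nat -> nat -> Z) (l : nat) : R :=
  sumR (S d) (fun i => c i * IZR (x i l)).

Definition RLinIndep (n d : nat) (x : nat -> nat -> Z) : Prop :=
  forall c : nat -> R, (forall l, (l <= n)%nat -> combR d c x l = 0) ->
    forall i, (i <= d)%nat -> c i = 0.

Definition LatticeBasis (n d : nat) (x : nat -> nat -> Z) : Prop :=
  forall (v : nat -> Z) (c : nat -> R),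
    (forall l, (l <= n)%nat -> combR d c x l = IZR (v l)) ->
    exists a : nat -> Z, forall l, (l <= n)%nat ->
      IZR (v l) = combR d (fun i => IZR (a i)) x l.

Definition RatAffData (n d : nat) (x : nat -> nat -> Z) : Prop :=
  RLinIndep n d x /\ LatticeBasis n d x /\
  exists i, (i <= d)%nat /\ x i 0%nat <> 0%Z.

Definition AffOf (n d : nat) (x : nat -> nat -> Z) (P : nat -> R) : Prop :=
  VecN n P /\ exists c : nat -> R, combR d c x 0%nat = 1 /\
    forall l, (l < n)%nat -> combR d c x (S l) = P l.

Definition gram (n d : nat) (x : nat -> nat -> Z) : nat -> nat -> R :=
  fun i j => sumR (S n) (fun l => IZR (x i l) * IZR (x j l)).

Definition height (n d : nat) (x : nat -> nat -> Z) : R := sqrt (det (S d) (gram n d x)).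

Definition is_glb (A : R -> Prop) (m : R) : Prop :=
  (forall a, A a -> m <= a) /\ (forall m', (forall a, A a -> m' <= a) -> m' <= m).

Definition distAff (n d : nat) (theta : nat -> R) (x : nat -> nat -> Z) (delta : R) : Prop :=
  is_glb (fun r => exists P, AffOf n d x P /\ r = euclid n theta P) delta.

Definition ExpSet (n d : nat) (theta : nat -> R) (omega : R) : Prop :=
  forall H0 : R, exists H : R, H0 <= H /\
    exists x, RatAffData n d x /\ height n d x <= H /\
      exists delta, distAff n d theta x delta /\
        height n d x * delta <= Rpower H (- omega).

Inductive ER := Fin (r : R) | PInf | MInf.

Definition ER_le (a b : ER) : Prop :=
  match a, b with
  | MInf, _ => True
  | _, PInf => True
  | Fin x, Fin y => x <= y
  | _, _ => False
  end.

Definition IsSupE (A : R -> Prop) (e : ER) : Prop :=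
  (forall a, A a -> ER_le (Fin a) e) /\
  (forall e', (forall a, A a -> ER_le (Fin a) e') -> ER_le e e').

Definition omega_d (n d : nat) (theta : nat -> R) (e : ER) : Prop :=
  IsSupE (ExpSet n d theta) e.

Definition QIndep (n : nat) (theta : nat -> R) : Prop :=
  forall q : nat -> Q,
    Q2R (q n) + sumR n (fun i => Q2R (q i) * theta i) = 0 ->
    forall i, (i <= n)%nat -> Q2R (q i) = 0.

Definition W (n d : nat) (w : ER) (theta : nat -> R) : Prop :=
  VecN n theta /\ QIndep n theta /\
  exists e, omega_d n d theta e /\ ER_le w e.

Definition Wstar (n d : nat) (w : ER) (theta : nat -> R) : Prop :=
  VecN n theta /\ QIndep n theta /\ omega_d n d theta w.

(* H^s(E) = 0 : for every delta, eps > 0 there is a countable cover of E by sets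
   U_k of diameter <= r_k <= delta with sum_k r_k^s < eps.  (Radii r_k > 0 are
   upper bounds for diam U_k; this is needed since Rpower 0 s = 1 in Stdlib.) *)
Definition HNull (n : nat) (s : R) (E : (nat -> R) -> Prop) : Prop :=
  forall delta eps, 0 < delta -> 0 < eps ->
    exists (U : nat -> (nat -> R) -> Prop) (r : nat -> R),
      (forall k, 0 < r k <= delta) /\
      (forall k x y, U k x -> U k y -> euclid n x y <= r k) /\
      (forall x, E x -> exists k, U k x) /\
      exists B, B < eps /\ forall N, sumR N (fun k => Rpower (r k) s) <= B.

Definition HausDim (n : nat) (E : (nat -> R) -> Prop) (D : R) : Prop :=
  is_glb (fun s => 0 < s /\ HNull n s E) D.

Definition frac (n : nat) (w : ER) : R :=
  match w with
  | Fin x => INR (S n) / (1 + x)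
  | _ => 0
  end.

(* Main.v *)
(** Upper bound.  By Hermite reduction a rational subspace of height [H] is spanned by integer
    vectors [x_0, ..., x_d] with [prod |x_i| <= C H].  The neighbourhoods of radius
    [2^(- k w) / H(L)] of the [d]-planes [L] of height at most [2^k] are cut into [r^(- d)]
    pieces of diameter [r]; Rankin's trick turns the sum over planes into a product of convergent
    one-dimensional zeta sums, and the total [s]-cost is geometric in [k] as soon as
    [(s - d) (1 + w) > n + 1].

    Lower bound.  Reducing the form [(v_0 / b^n)^2 + sum_j b^2 (v_j - theta_j v_0)^2] on
    [Z^(n+1)] gives, for every [theta] and every large [Q], a rational [d]-plane of height
    [<< Q] with [H(L) d(theta, L) << Q^(- (d+1)/(n-d))].  The estimate used for the upper bound
    shows that for most points of a fine grid in a given cube this plane has height at least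
    [Q^(1-e)], so that it passes very near the grid point.  Small cubes of side [Q^(-1-w)]
    centred on these planes are the children of the given cube.  Instead of building a measure
    on the resulting Cantor set, one follows a single branch which avoids a prescribed countable
    cover: the potential [sum_j (r_j / M)^t], over the sets [U_j] of diameter at most [r_j < M]
    meeting the current cube of side [M], can be kept small by averaging over the children.
    Avoiding at once a cheap cover of the exact-exponent set, covers of the sets of exponent
    [>= w + 1/k] (null at dimensions below the critical one by the upper bound), and all
    rational hyperplanes yields a contradiction. *)

Require Import Defs.
From Stdlib Require Import Reals ZArith QArith Qreals.
From Stdlib Require Lra Lia Psatz.
From mathcomp Require all_boot all_order all_algebra all_fingroup.
From mathcomp Require boolp Rstruct.
From mathcomp Require ring lra ssrZ zify.
Open Scope R_scope.

(** * Reduction of quadratic forms *)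

Module QuadraticForm.
Import all_boot all_order all_algebra all_fingroup boolp ring lra.
Set Implicit Arguments. Unset Strict Implicit. Unset Printing Implicit Defensive.
Import Order.TTheory GRing.Theory Num.Theory.

Section QuadraticForms.
Local Open Scope ring_scope.
Variable R : archiRealFieldType.

(** The critical dimension comes from a count. Put $w_c = (d+1)/(n-d)$. A cube of side $M$ has about
    $(M/\sigma)^n$ grid points, where $\sigma \approx Q^{-(1+w_c)}$ is the distance from a grid
    point to its plane of height about $Q$, and near each grid point the plane carries
    $(\sigma/\rho)^d$ children of side $\rho \approx Q^{-(1+w)}$. As $(n-d)(1+w_c) = n+1$, this
    makes about $Q^{n+1+d(1+w)}$ children, while dimension $t$ demands $(M/\rho)^t \approx
    Q^{t(1+w)}$; there are enough exactly when $t < d + (n+1)/(1+w)$. The obstacle is that the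
    Dirichlet argument controls only the product of height and distance: a plane of low height may
    be far from its grid point, and discarding such planes costs a factor $Q^e$ with $e$ small. The
    potential does the work of a mass distribution: a covering set is avoided at the stage where the
    cube becomes no larger than the set. Each stage brings the bound $\kappa_0$ down to
    $\kappa_0/2$, which leaves room for one more cover; so a single point can avoid countably many
    null sets, each null at its own exponent. *)

Definition qform m (G : 'M[R]_m) (v : 'rV[R]_m) : R := (v *m G *m v^T) 0 0.

Definition posdef m (G : 'M[R]_m) := G^T = G /\ forall v, v != 0 -> 0 < qform G v.

Definition schur m (G : 'M[R]_(1 + m)) : 'M[R]_m :=
  drsubmx G - (G 0 0)^-1 *: ((ursubmx G)^T *m ursubmx G).

Lemma posdef_block m (G : 'M[R]_(1 + m)) : posdef G ->
  G = block_mx (G 0 0)%:M (ursubmx G) (ursubmx G)^T (drsubmx G).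
Proof.
move=> [symG _]; rewrite -{1}[G]submxK; congr block_mx.
- by apply/matrixP=> i j; rewrite !ord1 !mxE eqxx mulr1n; congr (G _ _); apply: val_inj.
- by rewrite -{1}symG; apply/matrixP=> i j; rewrite !mxE.
Qed.

Lemma posdef_diag m (G : 'M[R]_m) i : posdef G -> 0 < G i i.
Proof.
move=> [_ /(_ (delta_mx 0 i))].
rewrite /qform -rowE trmx_delta -colE !mxE; apply.
by apply/eqP=> /matrixP /(_ 0 i); rewrite !mxE !eqxx => /eqP; rewrite oner_eq0.
Qed.

(** Completing the square in the first coordinate; the Schur complement is the form that remains
    once the square is split off. *)
Lemma qform_schur m (G : 'M[R]_(1 + m)) (x : R) (v : 'rV_m) : posdef G ->
  qform G (row_mx x%:M v) =
  G 0 0 * (x + (G 0 0)^-1 * (v *m (ursubmx G)^T) 0 0) ^+ 2 + qform (schur G) v.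
Proof.
move=> pG; have a0 := posdef_diag 0 pG.
have addE (A B : 'M[R]_1) : (A + B) 0 0 = A 0 0 + B 0 0 by rewrite mxE.
have oppE (A : 'M[R]_1) : (- A) 0 0 = - A 0 0 by rewrite mxE.
have sclE a (A : 'M[R]_1) : (a *: A) 0 0 = a * A 0 0 by rewrite mxE.
rewrite /qform {1}(posdef_block pG) mul_row_block tr_row_mx mul_row_col.
rewrite !mulmxDl /schur mulmxBr mulmxBl.
rewrite -!scalemxAr -!scalemxAl !addE oppE sclE.
set w := (v *m (ursubmx G)^T) 0 0.
have -> : (v *m ((ursubmx G)^T *m ursubmx G) *m v^T) 0 0 = w ^+ 2.
  have -> : v *m ((ursubmx G)^T *m ursubmx G) *m v^T =
     (v *m (ursubmx G)^T) *m (v *m (ursubmx G)^T)^T.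
    by rewrite trmx_mul trmxK !mulmxA.
  by rewrite [LHS]mxE big_ord1 [_^T _ _]mxE expr2.
have -> : (x%:M *m ursubmx G *m v^T) 0 0 = x * w.
  have -> : x%:M *m ursubmx G *m v^T = x *: (v *m (ursubmx G)^T)^T.
    by rewrite trmx_mul trmxK mul_scalar_mx scalemxAl.
  by rewrite sclE mxE.
have -> : (x%:M *m (G 0 0)%:M *m (x%:M)^T : 'M_1) 0 0 = x * G 0 0 * x.
  by rewrite tr_scalar_mx -!scalar_mxM !mxE eqxx mulr1n.
have -> : (v *m (ursubmx G)^T *m (x%:M)^T) 0 0 = w * x.
  by rewrite tr_scalar_mx mul_mx_scalar sclE mulrC.
set q := (_ *m _ *m _) 0 0.
have a1 : G 0 0 != 0 by rewrite gt_eqF.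
by field.
Qed.

Lemma qform_congr m k (G : 'M[R]_m) (U : 'M[R]_(k, m)) v :
  qform (U *m G *m U^T) v = qform G (v *m U).
Proof. by rewrite /qform trmx_mul !mulmxA. Qed.

Lemma posdef_congr m k (G : 'M[R]_m) (U : 'M[R]_(k, m)) :
  row_free U -> posdef G -> posdef (U *m G *m U^T).
Proof.
move=> fU [sG pG]; split; first by rewrite !trmx_mul trmxK sG mulmxA.
move=> v v0; rewrite qform_congr; apply: pG.
by apply: contra v0; rewrite -(mul0mx _ U) => /eqP /(row_free_inj fU) ->.
Qed.

(** The first coordinate [x] can be chosen to annihilate the square in [qform_schur], so every value
    of the Schur complement is a value of [G]. *)
Lemma posdef_schur m (G : 'M[R]_(1 + m)) : posdef G -> posdef (schur G).
Proof.
move=> pG; have a0 := posdef_diag 0 pG; split.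
  rewrite /schur linearB linearZ /= trmx_mul trmxK; congr (_ - _).
  by apply/matrixP=> i j; rewrite !mxE -{1}(proj1 pG) mxE.
move=> v v0.
set x := - ((G 0 0)^-1 * (v *m (ursubmx G)^T) 0 0).
have := qform_schur x v pG; rewrite /x addNr expr0n mulr0 add0r => <-.
apply: (proj2 pG); apply: contra v0 => /eqP.
by rewrite -row_mx0 => /eq_row_mx [_ ->].
Qed.

Lemma det_schur m (G : 'M[R]_(1 + m)) : posdef G -> \det G = G 0 0 * \det (schur G).
Proof.
move=> pG; have a0 := posdef_diag 0 pG.
have a1 : G 0 0 != 0 by rewrite gt_eqF.
have {1}-> : G = block_mx 1%:M 0 ((G 0 0)^-1 *: (ursubmx G)^T) 1%:M *m
              block_mx (G 0 0)%:M (ursubmx G) 0 (schur G).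
  rewrite mulmx_block !mul1mx !mul0mx ?mulmx0 !addr0 mul_mx_scalar.
  rewrite scalerA divff // scale1r /schur -scalemxAl addrC subrK.
  exact: posdef_block.
by rewrite [LHS]det_mulmx det_lblock det_ublock !det1 !mul1r det_scalar1.
Qed.

Lemma det_posdef_gt0 m (G : 'M[R]_m) : posdef G -> 0 < \det G.
Proof.
elim: m G => [|m IH] G pG; first by rewrite det_mx00.
by rewrite (@det_schur m G pG) mulr_gt0 ?(posdef_diag 0 pG) // IH //; apply: (@posdef_schur m G pG).
Qed.

(** Induction through the Schur complement: what is subtracted from a diagonal entry is a square
    divided by [G 0 0], so these entries only decrease. *)
Lemma hadamard m (G : 'M[R]_m) : posdef G -> \det G <= \prod_i G i i.
Proof.
elim: m G => [|m IH] G pG; first by rewrite det_mx00 big_ord0.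
have pS := @posdef_schur m G pG; have a0 := posdef_diag 0 pG.
rewrite (@det_schur m G pG) big_ord_recl; apply: ler_wpM2l; first exact: ltW.
apply: (le_trans (IH _ pS)); apply: ler_prod => i _.
rewrite ltW ?(posdef_diag i pS) //=.
rewrite !mxE big_ord1 !mxE.
have -> : rshift 1 i = lift ord0 i by apply: val_inj.
rewrite gerBl; apply: mulr_ge0; first by rewrite invr_ge0 ltW.
by rewrite -expr2 sqr_ge0.
Qed.

(* Replaces an actual minimum, so that no discreteness of the set of values is needed. *)
Lemma almost_minimum (T : Type) (f : T -> R) (lam : R) (x0 : T) :
  0 < lam -> (forall x, lam <= f x) -> exists x, forall y, f x <= 2 * f y.
Proof.
move=> lam0 hf.
have [k] : exists k, f x0 <= 2 ^+ k * lam.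
  exists (Num.bound (f x0 / lam)).
  rewrite -ler_pdivrMr //; apply: le_trans (ltW (archi_boundP _)) _.
    by rewrite divr_ge0 ?ltW // (lt_le_trans lam0).
  by rewrite -natrX ler_nat ltnW // ltn_expl.
elim: k x0 => [|k IH] x0 hx0.
  exists x0 => y; apply: (le_trans hx0); rewrite expr0 mul1r.
  by apply: (le_trans (hf y)); rewrite ler_peMl ?ler1n // (le_trans (ltW lam0)).
have [h|] := pselect (forall y, f x0 <= 2 * f y); first by exists x0.
move/existsNP => [y /negP]; rewrite -ltNge => hy.
apply: (IH y); rewrite -(ler_pM2l (ltr0Sn R 1)) (le_trans (ltW hy)) //.
by rewrite mulrA -exprS.
Qed.

Local Notation iR := (map_mx (intr : int -> R)).

(** Either the tail of [v] is nonzero and the Schur complement supplies the bound, or only the first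
    coordinate survives and, being a nonzero integer, gives at least [G 0 0]. This feeds
    [almost_minimum]. *)
Lemma posdef_int_lower m (G : 'M[R]_m) : posdef G ->
  exists2 lam : R, 0 < lam & forall v : 'rV[int]_m, v != 0 -> lam <= qform G (iR v).
Proof.
elim: m G => [|m IH] G pG.
  by exists 1 => // v; rewrite [v]thinmx0 eqxx.
have pS := @posdef_schur m G pG; have a0 := posdef_diag 0 pG.
have [lam l0 hlam] := IH _ pS.
exists (Num.min (G 0 0) lam); first by rewrite lt_min a0.
move=> v v0; pose v1 : 'rV[int]_(1 + m) := v.
have Ev : iR v = row_mx (v1 0 0)%:~R%:M (iR (rsubmx v1)).
  transitivity (iR (row_mx (lsubmx v1) (rsubmx v1))); first by rewrite hsubmxK.
  have e : iR (lsubmx v1) = (v1 0 0)%:~R%:M.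
    by apply/matrixP=> i j; rewrite !ord1 !mxE eqxx mulr1n; congr (_%:~R); congr (v1 _ _);
      apply: val_inj.
  by rewrite [LHS]map_row_mx e.
rewrite Ev (@qform_schur m G _ _ pG) ge_min.
have [r0|r0] := eqVneq (rsubmx v1) 0; last first.
  apply/orP; right; apply: le_trans (hlam _ r0) _.
  by rewrite lerDr; apply: mulr_ge0; [exact: ltW | exact: sqr_ge0].
apply/orP; left; rewrite r0 map_mx0 mul0mx mxE mulr0 addr0 /qform !mul0mx mxE addr0.
rewrite ler_peMr //; first exact: ltW.
rewrite -rmorphXn /= ler1z.
suff : v1 0 0 != 0 by move: (v1 0 0) => z zn; rewrite -gtz0_ge1 exprn_even_gt0.
apply: contra v0 => /eqP h; apply/eqP.
transitivity (row_mx (lsubmx v1) (rsubmx v1)); first by rewrite hsubmxK.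
suff -> : lsubmx v1 = 0
  by rewrite r0; apply/matrixP=> i j; rewrite !mxE; case: splitP => k _; rewrite mxE.
by apply/matrixP=> i j; rewrite !ord1 !mxE -[RHS]h; congr (v1 _ _); apply: val_inj.
Qed.

Lemma int_unitmx_sqr m (U : 'M[int]_m) : U \in unitmx -> (\det (iR U)) ^+ 2 = 1.
Proof.
by rewrite unitmxE det_map_mx qualifE /= => /orP [] /eqP ->; rewrite ?mulrN1z ?sqrrN expr1n.
Qed.

Lemma nearest_int (x : R) : exists z : int, (z%:~R + x) ^+ 2 <= 4^-1.
Proof.
exists (Num.floor (2^-1 - x)).
have := floor_itv (2^-1 - x); set z := (Num.floor _)%:~R; move=> /andP[].
rewrite rmorphD /= -/z => h1 h2.
have h3 : z + x <= 2^-1 by lra.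
have h4 : - 2^-1 <= z + x by lra.
by rewrite expr2; nra.
Qed.

(* Hermite induction: take a unimodular basis whose first vector is 2-minimal among the first
   vectors of all such bases, and pass to the Schur complement.  Permuting a basis shows that this
   vector is 2-minimal among all basis vectors, so no completion of a primitive vector is needed. *)
Lemma reduction m (G : 'M[R]_m) : posdef G ->
  exists2 U : 'M[int]_m, U \in unitmx &
    \prod_i qform G (row i (iR U)) <= 2 ^+ (m * m) * \det G.
Proof.
elim: m G => [|m IH] G pG.
  by exists 1%:M; rewrite ?unitmx1 // big_ord0 det_mx00 mulr1 expr0.
have [lam l0 hlam] := posdef_int_lower pG.
have rowU (U : 'M[int]_m.+1) i : U \in unitmx -> row i U != 0.
  move=> uU; apply/negP=> /eqP r0.
  have : row i (1%:M : 'M[int]_m.+1) = 0 by rewrite -(mulmxV uU) row_mul r0 mul0mx.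
  by move/matrixP/(_ 0 i); rewrite !mxE eqxx.
pose f (U : {U : 'M[int]_m.+1 | U \in unitmx}) := qform G (row 0 (iR (val U))).
have [|[U uU] hU] := @almost_minimum _ f lam (exist _ 1%:M (unitmx1 _ _)) l0.
  by move=> [U uU]; rewrite /f /= -map_row; apply: hlam; apply: rowU.
have hU2 (V : 'M[int]_m.+1) i : V \in unitmx -> f (exist _ U uU) <= 2 * qform G (row i (iR V)).
  move=> uV; have uV' : xrow 0 i V \in unitmx.
    by rewrite xrowE unitmx_mul uV unitmx_perm.
  apply: (le_trans (hU (exist (fun U : 'M[int]_m.+1 => U \in unitmx) _ uV')));
    rewrite /f /= -map_row -map_row.
  rewrite ler_pM2l ?ltr0n //.
  suff -> : row 0 (xrow 0 i V) = row i V by [].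
  by apply/matrixP=> a b; rewrite !mxE tpermL.
pose G1 := iR U *m G *m (iR U)^T.
have iU : iR U \in unitmx by rewrite unitmxE unitfE -sqrf_eq0 int_unitmx_sqr ?oner_eq0.
have pG1 : posdef G1 by apply: posdef_congr => //; rewrite row_free_unit.
have pS := @posdef_schur m G1 pG1.
have a0 := posdef_diag 0 pG1.
have [V uV hV] := IH _ pS.
have /choice [z hz] : forall i, exists z : int,
   (z%:~R + (G1 0 0)^-1 * (row i (iR V) *m (ursubmx (G1 : 'M_(1+m)))^T) 0 0) ^+ 2 <= 4^-1.
  by move=> i; apply: nearest_int.
(* Size reduction: a reduced basis of the Schur complement is lifted, and the integers [z] bring the
   completed square of each lifted row down to at most 1/4. *)
pose W : 'M[int]_(1 + m) := block_mx 1%:M 0 (\col_i z i) V.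
have uW : W \in unitmx by rewrite unitmxE det_lblock det1 mul1r -unitmxE.
have uWU : (W : 'M_m.+1) *m U \in unitmx by rewrite unitmx_mul uU andbT.
exists ((W : 'M_m.+1) *m U) => //.
have E i : qform G (row i (iR ((W : 'M_m.+1) *m U))) = qform G1 (row i (iR W)).
  by rewrite /G1 qform_congr -row_mul -map_mxM.
have EG0 : G1 0 0 = f (exist _ U uU).
  rewrite /f /= /qform -row_mul [RHS]mxE [LHS]mxE.
  by apply: eq_bigr => k _; rewrite [row _ _ _ _]mxE [(row _ _)^T _ _]mxE [row _ _ _ _]mxE [_^T _
    _]mxE.
have rowS k : row (lift ord0 k) (iR W) = row_mx (z k)%:~R%:M (row k (iR V)).
  apply/matrixP=> i' j; rewrite ord1 !mxE /=.
  have -> : lift ord0 k = rshift 1 k by apply: val_inj.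
  rewrite [split _](unsplitK (inr _ : 'I_1 + 'I_m)) !mxE.
  by case: splitP => l _; rewrite !mxE // ord1 eqxx mulr1n.
have row0 : row 0 (iR W) = row_mx 1%:M 0.
  apply/matrixP=> i' j; rewrite ord1 !mxE /=.
  have -> : 0 = lshift m 0 :> 'I_(1 + m) by apply: val_inj.
  rewrite [split _](unsplitK (inl _ : 'I_1 + 'I_m)) !mxE.
  by case: splitP => l _; rewrite !mxE // ?ord1 ?eqxx ?mulr1n ?mulr0n.
have q0 : qform G1 (row 0 (iR W)) = G1 0 0.
  rewrite row0 (@qform_schur m G1 _ _ pG1) /qform !mul0mx !mxE !mulr0 !addr0.
  by rewrite expr1n mulr1.
(* With $a$ the value at the first vector, $q$ at a lifted one and $s$ that of the Schur complement,
   $q \le a/4 + s$ and $a \le 2q$ give $q \le q/2 + s$, hence $q \le 2s$. *)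
have qS k : qform G1 (row (lift ord0 k) (iR W)) <= 2 * qform (schur G1) (row k (iR V)).
  have h1 : G1 0 0 <= 2 * qform G1 (row (lift ord0 k) (iR W)).
    by rewrite EG0 -E; apply: hU2.
  have h2 : qform G1 (row (lift ord0 k) (iR W)) <=
     G1 0 0 * 4^-1 + qform (schur G1) (row k (iR V)).
    by rewrite rowS (@qform_schur m G1 _ _ pG1) lerD2r ler_pM2l.
  by move: h1 h2; set a := G1 0 0; set q := qform G1 _; set s := qform (schur _) _ => h1 h2; lra.
under eq_bigr => i _ do rewrite E.
rewrite big_ord_recl q0.
apply: le_trans (_ : G1 0 0 * \prod_k (2 * qform (schur G1) (row k (iR V))) <= _).
  apply: ler_wpM2l; first exact: ltW.
  apply: ler_prod => k _; rewrite qS andbT.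
  have [_ p1] := pG1; have [->|n0] := eqVneq (row (lift ord0 k) (iR W)) 0.
    by rewrite /qform !mul0mx mxE.
  exact: ltW (p1 _ n0).
rewrite big_split /= prodr_const card_ord.
have -> : \det G = G1 0 0 * \det (schur G1).
  rewrite -(@det_schur m G1 pG1) /G1 !det_mulmx det_tr mulrAC -expr2.
  by rewrite int_unitmx_sqr // mul1r.
rewrite [leRHS]mulrCA; apply: ler_wpM2l; first exact: ltW.
(* The exponent $m^2$ is propagated because $m + m^2 \le (m+1)^2$. *)
apply: le_trans (_ : 2 ^+ m * (2 ^+ (m * m) * \det (schur G1)) <= _).
  by rewrite ler_wpM2l ?exprn_ge0 ?ler0n.
rewrite mulrA -exprD ler_wpM2r ?(ltW (det_posdef_gt0 pS)) //.
by rewrite ler_weXn2l ?ler1n // mulSn mulnS leq_add // leq_addl.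
Qed.

End QuadraticForms.

End QuadraticForm.

Module Proofs.
Import Lra Lia Psatz.
Import all_boot all_order all_algebra all_fingroup boolp Rstruct ssrZ zify.
Import QuadraticForm.
Set Implicit Arguments. Unset Strict Implicit. Unset Printing Implicit Defensive.
Import Order.TTheory GRing.Theory Num.Theory.
Local Open Scope ring_scope.
Local Open Scope R_scope.

(** * Heights and Gram determinants *)

Notation "\Sum_ ( i < n ) F" := (\big[Rplus/0]_(i < n) F)
  (at level 36, F at level 36, i, n at level 50).
Notation "\Prod_ ( i < n ) F" := (\big[Rmult/1]_(i < n) F)
  (at level 36, F at level 36, i, n at level 50).
Notation iR := (map_mx (intr : int -> R)).

Lemma sumR_big k f : sumR k f = \Sum_(i < k) f i.
Proof. by elim: k => [|k IH] /=; rewrite ?big_ord0 // big_ord_recr IH. Qed.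

Lemma det_first_row k M : det k.+1 M = sumR k.+1 (fun j => (-1) ^ j * M 0%N j *
  det k (fun r c => M (S r) (if Nat.ltb c j then c else S c))).
Proof. by []. Qed.

Lemma detE k M : det k M = \det (\matrix_(i < k, j < k) M i j).
Proof.
elim: k M => [|k IH] M; first by rewrite det_mx00.
rewrite (expand_det_row _ ord0) det_first_row sumR_big.
apply: eq_bigr => j _; rewrite mxE /cofactor IH add0n.
rewrite -RmultE RpowE (Rmult_comm (_ ^+ j)%R) Rmult_assoc.
congr (_ * (_ * _)); congr (\det _); apply/matrixP => r c; rewrite !mxE.
congr M; rewrite /= /bump; case: ltnP => h; case: Nat.ltb_spec => h'; lia.
Qed.

Lemma IZR_Z_of_int (z : int) : IZR (Z_of_int z) = (z%:~R)%R.
Proof.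
case: z => k; first by rewrite /= -INR_IZR_INZ INRE.
have -> : Z_of_int (Negz k) = Z.opp (Z.of_nat k.+1) by lia.
by rewrite NegzE mulrNz -pmulrn -INRE opp_IZR -INR_IZR_INZ RoppE.
Qed.

(** Lattice bases are functions on [nat] of which only rows up to [d] and columns up to [n] count;
    these maps pass to matrices and back. Outside that range [ofI] takes whatever [inord] yields. *)
Definition toI n d (x : nat -> nat -> Z) : 'M[int]_(d.+1, n.+1) :=
  \matrix_(i, l) int_of_Z (x i l).
Definition toM n d (x : nat -> nat -> Z) : 'M[R]_(d.+1, n.+1) := \matrix_(i, l) IZR (x i l).
Definition ofI n d (A : 'M[int]_(d.+1, n.+1)) : nat -> nat -> Z :=
  fun i l => Z_of_int (A (inord i) (inord l)).

Lemma toM_toI n d x : toM n d x = iR (toI n d x).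
Proof. by apply/matrixP=> i j; rewrite !mxE -IZR_Z_of_int int_of_ZK. Qed.

Lemma toM_ofI n d (A : 'M[int]_(d.+1, n.+1)) : toM n d (ofI A) = iR A.
Proof. by apply/matrixP=> i j; rewrite !mxE IZR_Z_of_int !inord_val. Qed.

Lemma combRE n d c x (l : 'I_n.+1) :
  combR d c x l = (\row_(i < d.+1) c i *m toM n d x)%R ord0 l.
Proof. by rewrite /combR sumR_big mxE; apply: eq_bigr => i _; rewrite !mxE. Qed.

Lemma gramE n d x : (\matrix_(i < d.+1, j < d.+1) gram n d x i j)%R = toM n d x *m (toM n d x)^T.
Proof.
apply/matrixP=> i j; rewrite !mxE /gram sumR_big.
by apply: eq_bigr => l _; rewrite !mxE.
Qed.

Lemma heightE n d x : height n d x = sqrt (\det (toM n d x *m (toM n d x)^T)).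
Proof. by rewrite /height detE gramE. Qed.

Lemma RLinIndepE n d x : RLinIndep n d x <-> row_free (toM n d x).
Proof.
split=> h.
  rewrite -kermx_eq0; apply/eqP/row_matrixP => i; rewrite row0.
  set v := row i _.
  have kv : v *m toM n d x = 0%R by rewrite /v -row_mul mulmx_ker row0.
  have E : v = (\row_(k < d.+1) (fun k => v ord0 (inord k)) k)%R.
    by apply/matrixP=> a b; rewrite [RHS]mxE (ord1 a) inord_val.
  have H : forall i, (i <= d)%coq_nat -> v ord0 (inord i) = 0.
    apply: (h (fun k => v ord0 (inord k))) => l /ssrnat.leP hl.
    by rewrite -[l](@inordK n) // combRE -E kv mxE.
  apply/matrixP=> a b; rewrite (ord1 a) [RHS]mxE -[b]inord_val; apply: H.
  by apply/ssrnat.leP; rewrite -ltnS.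
move=> c hc i /ssrnat.leP hi.
have H : (\row_(i < d.+1) c i *m toM n d x)%R = 0%R.
  apply/matrixP=> a b; rewrite (ord1 a) -combRE mxE hc //; apply/ssrnat.leP; rewrite -ltnS //.
have /matrixP/(_ ord0 (inord i)) : (\row_(i < d.+1) c i)%R = 0%R :> 'rV[R]_d.+1.
  by apply: (row_free_inj h); rewrite H mul0mx.
by rewrite !mxE inordK.
Qed.

Lemma posdef_1 k : posdef (1%:M : 'M[R]_k)%R.
Proof.
split; first by rewrite tr_scalar_mx.
move=> v v0; rewrite /qform mulmx1 mxE.
have [i vi] : exists i, v ord0 i != 0%R.
  apply/existsP; apply: contra_neqT v0; rewrite negb_exists => /forallP h.
  by apply/matrixP=> a b; rewrite (ord1 a) mxE; apply/eqP; have := h b; rewrite negbK.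
rewrite (bigD1 i) //= ltr_wpDr //; last by rewrite !mxE -expr2 exprn_even_gt0.
by apply: sumr_ge0 => j _; rewrite !mxE -expr2 sqr_ge0.
Qed.

Lemma posdef_gram k m (X : 'M[R]_(k, m)) : row_free X -> posdef (X *m X^T).
Proof. by move=> fX; rewrite -[X in X *m _]mulmx1; apply: posdef_congr => //; apply: posdef_1. Qed.

(* The maximum starts at 1: for a nonzero integer row it is the sup norm. *)
Definition rmax n (x : nat -> nat -> Z) (i : nat) : R :=
  \big[Rmax/1]_(l < n.+1) Rabs (IZR (x i l)).
(** Replaces the height in every counting argument: unlike the Gram determinant it factors over the
    rows, and [reduced_rep] bounds it by a constant times the height for a suitable basis. *)
Definition rowprod n d x : R := \Prod_(i < d.+1) rmax n x i.

Lemma big_Rmax_ge k (f : 'I_k -> R) :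
  1 <= \big[Rmax/1]_(l < k) f l /\ forall l, f l <= \big[Rmax/1]_(l < k) f l.
Proof.
elim: k f => [|k IH] f; first by rewrite big_ord0; split; [lra | case].
rewrite big_ord_recl; have [h1 h2] := IH (fun l => f (lift ord0 l)).
split; first exact: Rle_trans h1 (Rmax_r _ _).
move=> l; case: (unliftP ord0 l) => [j ->|->]; last exact: Rmax_l.
exact: Rle_trans (h2 j) (Rmax_r _ _).
Qed.

Lemma big_Rmax_le k (f : 'I_k -> R) B : 1 <= B -> (forall l, f l <= B) ->
  \big[Rmax/1]_(l < k) f l <= B.
Proof. by move=> h1 hf; elim/big_ind: _ => // u v; apply: Rmax_lub. Qed.

Lemma rmax_ge1 n x i : 1 <= rmax n x i.
Proof. exact: (proj1 (big_Rmax_ge _)). Qed.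

Lemma rmax_ge n x i l : (l <= n)%N -> Rabs (IZR (x i l)) <= rmax n x i.
Proof.
move=> hl; have := proj2 (big_Rmax_ge (fun l : 'I_n.+1 => Rabs (IZR (x i l)))) (inord l).
by rewrite inordK.
Qed.

Lemma prod_ge1 k (f : 'I_k -> R) : (forall i, 1 <= f i) -> 1 <= \Prod_(i < k) f i.
Proof.
move=> hf; elim/big_ind: _ => [|u v hu hv|i _]; [lra | nra | exact: hf].
Qed.

Lemma prod_gt0 k (f : 'I_k -> R) : (forall i, 0 < f i) -> 0 < \Prod_(i < k) f i.
Proof.
move=> hf; elim/big_ind: _ => [|u v hu hv|i _]; [lra | nra | exact: hf].
Qed.

Lemma prod_le k (f g : 'I_k -> R) : (forall i, 0 <= f i <= g i) ->
  \Prod_(i < k) f i <= \Prod_(i < k) g i.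
Proof.
move=> h; suff: 0 <= \Prod_(i < k) f i <= \Prod_(i < k) g i by case.
elim/big_ind2: _ => [|a b a' b' [h1 h2] [h3 h4]|i _]; [lra | nra | exact: h].
Qed.

Lemma rowprod_ge1 n d x : 1 <= rowprod n d x.
Proof. by apply: prod_ge1 => i; apply: rmax_ge1. Qed.

Lemma rmax_le_rowprod n d x i : (i <= d)%N -> rmax n x i <= rowprod n d x.
Proof.
move=> hi; rewrite /rowprod (bigD1 (Ordinal (hi : (i < d.+1)%N))) //=.
rewrite -[X in X <= _]Rmult_1_r; apply: Rmult_le_compat_l.
  by have := rmax_ge1 n x i; lra.
by elim/big_ind: _ => [|u v hu hv|j _]; [lra | nra | exact: rmax_ge1].
Qed.

Lemma qform1_iR k (v : 'rV[int]_k) :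
  qform 1%:M%R (iR v) = (\sum_(l < k) (v ord0 l) ^+ 2)%:~R%R.
Proof.
rewrite /qform mulmx1 mxE rmorph_sum /=; apply: eq_bigr => l _.
by rewrite !mxE rmorphXn /= expr2.
Qed.

Lemma qform1_ge1 k (v : 'rV[int]_k) : v != 0%R -> 1 <= qform 1%:M%R (iR v).
Proof.
move=> v0; rewrite qform1_iR; apply/RleP; rewrite R1E ler1z -gtz0_ge1.
have [i vi] : exists i, v ord0 i != 0%R.
  apply/existsP; apply: contra_neqT v0; rewrite negb_exists => /forallP h.
  by apply/matrixP=> a b; rewrite (ord1 a) mxE; apply/eqP; have := h b; rewrite negbK.
rewrite (bigD1 i) //= ltr_wpDr //; last by rewrite exprn_even_gt0.
by apply: sumr_ge0 => j _; rewrite sqr_ge0.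
Qed.

Lemma qform1_entry k (v : 'rV[R]_k) l : Rabs (v ord0 l) ^ 2 <= qform 1%:M%R v.
Proof.
rewrite /qform mulmx1 mxE pow2_abs RpowE.
apply/RleP; rewrite (bigD1 l) //= [_^T _ _]mxE -expr2 ler_wpDr //.
by apply: sumr_ge0 => j _; rewrite !mxE -expr2 sqr_ge0.
Qed.

Lemma row_free_row_neq0 k m (X : 'M[R]_(k, m)) i : row_free X -> row i X != 0%R.
Proof.
move=> fX; apply/negP => /eqP; rewrite rowE -(mul0mx _ X) => /(row_free_inj fX).
by move/matrixP/(_ ord0 i); rewrite !mxE !eqxx => /eqP; rewrite oner_eq0.
Qed.

(** The sup norm is at most the Euclidean norm. The row has to be nonzero because [rmax] is never
    below 1. *)
Lemma rmax_ofI n d (A : 'M[int]_(d.+1, n.+1)) (i : 'I_d.+1) : row i A != 0%R ->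
  (rmax n (ofI A) i) ^ 2 <= qform 1%:M%R (row i (iR A)).
Proof.
move=> r0; have h1 := qform1_ge1 r0; rewrite map_row in h1.
set q := qform _ _ in h1 *.
have hq : rmax n (ofI A) i <= sqrt q.
  apply: big_Rmax_le => [|l].
    by rewrite -sqrt_1; apply: sqrt_le_1; lra.
  have := qform1_entry (row i (iR A)) l; rewrite -/q /ofI !inord_val IZR_Z_of_int !mxE => h.
  rewrite -(sqrt_pow2 (Rabs _)); last exact: Rabs_pos.
  by apply: sqrt_le_1 => //; [apply: pow2_ge_0 | lra].
rewrite -(pow2_sqrt q); last by lra.
by apply: pow_incr; split=> //; have := rmax_ge1 n (ofI A) i; lra.
Qed.

Lemma row_free_iR_unit k (U : 'M[int]_k) : U \in unitmx -> iR U \in unitmx.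
Proof.
by move=> uU; rewrite unitmxE unitfE -sqrf_eq0 int_unitmx_sqr ?oner_eq0.
Qed.

Lemma prod_qform_sq n d (A : 'M[int]_(d.+1, n.+1)) : row_free (iR A) ->
  (rowprod n d (ofI A)) ^ 2 <= \Prod_(i < d.+1) qform 1%:M%R (row i (iR A)).
Proof.
move=> fA; rewrite /rowprod -[_ ^ 2]/(_ * (_ * 1)) Rmult_1_r -big_split /=.
apply: prod_le => i; split.
  by have := rmax_ge1 n (ofI A) i; nra.
have := @rmax_ofI n d A i; rewrite /= Rmult_1_r; apply.
have := row_free_row_neq0 i fA; apply: contraNN; rewrite -map_row => /eqP ->.
by apply/eqP/matrixP=> a b; rewrite !mxE.
Qed.

Lemma AffOfE n d x P : AffOf n d x P <-> VecN n P /\ exists v : 'rV[R]_d.+1,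
  (v *m toM n d x)%R ord0 ord0 = 1 /\
  forall l : 'I_n, (v *m toM n d x)%R ord0 (lift ord0 l) = P l.
Proof.
split=> -[vP [c [c0 cP]]]; split=> //.
  exists (\row_(i < d.+1) c i)%R; split=> [|l]; first by rewrite -combRE.
  by rewrite -combRE -cP //; apply/ssrnat.leP.
have E : c = (\row_(i < d.+1) (fun i => c ord0 (inord i)) i)%R.
  by apply/matrixP=> a b; rewrite [RHS]mxE (ord1 a) inord_val.
exists (fun i => c ord0 (inord i)); split.
  by rewrite -[0%N]/(nat_of_ord (@ord0 n)) combRE -E.
move=> l /ssrnat.leP hl; rewrite -[S l]/(nat_of_ord (lift ord0 (Ordinal hl))) combRE -E.
by rewrite cP.
Qed.

Lemma AffOf_mul n d x x' (V : 'M[R]_d.+1) : toM n d x = (V *m toM n d x')%R ->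
  forall P, AffOf n d x P -> AffOf n d x' P.
Proof.
move=> E P /AffOfE [vP [v [v0 vl]]]; apply/AffOfE; split=> //.
by exists (v *m V)%R; rewrite -mulmxA -E.
Qed.

Lemma col0_toM n d x : (exists i, (i <= d)%coq_nat /\ x i 0%N <> Z0) <->
  col ord0 (toM n d x) != 0%R.
Proof.
split.
  move=> [i [/ssrnat.leP hi xi]]; apply/eqP => /matrixP/(_ (inord i) ord0).
  by rewrite !mxE inordK //= => /eq_IZR.
move=> h; have [i xi] : exists i : 'I_d.+1, x i 0%N <> Z0.
  apply: contrapT => hx; move/eqP: h; apply.
  apply/matrixP=> a b; rewrite !mxE /=; apply: contrapT => ne; apply: hx.
  by exists a => x0; apply: ne; rewrite x0.
by exists i; split=> //; apply/ssrnat.leP; rewrite -ltnS.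
Qed.

(** The Gram determinant of independent integer vectors is a positive integer. *)
Lemma height_ge1 n d x : RLinIndep n d x -> 1 <= height n d x.
Proof.
move=> /RLinIndepE fX; rewrite heightE -sqrt_1.
have p := det_posdef_gt0 (posdef_gram fX).
apply: sqrt_le_1; [lra | by apply/Rlt_le/RltP |].
move: p; rewrite toM_toI map_trmx -map_mxM det_map_mx ltr0z => p.
by apply/RleP; rewrite R1E ler1z.
Qed.

(** [reduction] is applied to the Gram matrix of the given basis: the values of the form on the rows
    of [U] are the squared lengths of the rows of [U x], and its determinant is the squared height.
    A unimodular change of basis leaves the affine subspace unchanged. *)
Lemma reduced_rep n d x : RatAffData n d x -> exists x', RLinIndep n d x' /\
  (forall P, AffOf n d x P <-> AffOf n d x' P) /\
  (exists i, (i <= d)%coq_nat /\ x' i 0%N <> Z0) /\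
  rowprod n d x' <= sqrt (2 ^ (d.+1 * d.+1)) * height n d x.
Proof.
move=> [/RLinIndepE fX [_ /(col0_toM n) x0]].
have [U uU hU] := reduction (posdef_gram fX).
have iU := row_free_iR_unit uU.
pose A := (U *m toI n d x)%R.
have EA : toM n d (ofI A) = (iR U *m toM n d x)%R.
  by rewrite toM_ofI map_mxM toM_toI.
have EA' : toM n d x = (invmx (iR U) *m toM n d (ofI A))%R by rewrite EA mulKmx.
have fA : row_free (toM n d (ofI A)).
  by rewrite /row_free EA mxrankMfree // -/(row_free _) row_free_unit.
exists (ofI A); split; first exact/RLinIndepE.
split; first by move=> P; split; [apply: AffOf_mul EA' _ | apply: AffOf_mul EA _].
split.
  apply/(col0_toM n); apply: contra x0 => /eqP h.
  by rewrite EA' colE -mulmxA -colE h mulmx0.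
rewrite heightE -sqrt_mult_alt; last by apply: pow_le; lra.
have p := det_posdef_gt0 (posdef_gram fX).
rewrite -(sqrt_pow2 (rowprod _ _ _)); last by have := rowprod_ge1 n d (ofI A); lra.
apply: sqrt_le_1_alt.
apply: Rle_trans (prod_qform_sq _) _; first by rewrite -toM_ofI.
move/RleP: hU; rewrite -RmultE -RpowE; apply: Rle_trans; apply: Req_le.
apply: eq_bigr => i _.
have -> : (toM n d x *m (toM n d x)^T = toM n d x *m 1%:M *m (toM n d x)^T)%R.
  by rewrite mulmx1.
by rewrite qform_congr -row_mul -EA toM_ofI.
Qed.

(** An integer vector has integer coordinates with respect to the rows of [U], since the inverse of
    [U] is integral. If it lies in the span of the chosen rows, these coordinates are its
    coefficients there; so the chosen rows generate a primitive lattice. *)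
Lemma unimodular_rows n d (U : 'M[int]_n.+1) (f : 'I_d.+1 -> 'I_n.+1) :
  injective f -> U \in unitmx ->
  let x := ofI (\matrix_(i < d.+1, l < n.+1) U (f i) l)%R in
  RLinIndep n d x /\ LatticeBasis n d x.
Proof.
move=> injf uU x; have iU := row_free_iR_unit uU.
pose J : 'M[R]_(d.+1, n.+1) := (\matrix_(i, l) (l == f i)%:R)%R.
have EJ : toM n d x = (J *m iR U)%R.
  rewrite toM_ofI; apply/matrixP=> i l; rewrite !mxE (bigD1 (f i)) //=.
  rewrite !mxE eqxx mul1r big1 ?addr0 // => j /negbTE hj.
  by rewrite !mxE hj mul0r.
have fJ : row_free J.
  apply/row_freeP; exists J^T%R; apply/matrixP=> i k; rewrite !mxE.
  rewrite (bigD1 (f i)) //= !mxE eqxx mul1r big1 ?addr0 => [|j /negbTE hj].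
    by rewrite (inj_eq injf).
  by rewrite !mxE hj mul0r.
split.
  by apply/RLinIndepE; rewrite /row_free EJ mxrankMfree // row_free_unit.
move=> v c hv.
pose w : 'rV[int]_n.+1 := (\row_l int_of_Z (v l))%R.
pose cv : 'rV[R]_d.+1 := (\row_i c i)%R.
have Ew : iR w = (cv *m J *m iR U)%R.
  rewrite -mulmxA -EJ; apply/matrixP=> a l; rewrite (ord1 a) -combRE hv.
    by rewrite !mxE -IZR_Z_of_int int_of_ZK.
  by apply/ssrnat.leP; rewrite -ltnS.
have Ec : (cv *m J = iR (w *m invmx U))%R.
  rewrite map_mxM Ew -mulmxA -map_mxM mulmxV // map_mx1 mulmx1 //.
pose u := (w *m invmx U)%R.
exists (fun i => Z_of_int (u ord0 (f (inord i)))) => l /ssrnat.leP hl.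
rewrite -hv; last exact/ssrnat.leP.
rewrite -[l](@inordK n) // !combRE; congr ((_ *m _)%R _ _).
apply/matrixP=> a i; rewrite [LHS]mxE [RHS]mxE inord_val IZR_Z_of_int.
have h : (u ord0 (f i))%:~R%R = (cv *m J)%R ord0 (f i).
  by rewrite Ec [RHS]mxE.
rewrite h mxE (bigD1 i) //= !mxE eqxx mulr1 big1 ?addr0 // => j hj.
by rewrite !mxE (inj_eq injf) eq_sym (negbTE hj) mulr0.
Qed.

(** * A Dirichlet-type theorem *)

(** The form is the Gram matrix of an upper triangular [T] with diagonal $a, b, \dots, b$, whose
    determinant is read off. It will be used with $a = b^{-n}$, which makes it unimodular. *)
Lemma twisted_form n (theta : 'I_n -> R) a b : 0 < a -> 0 < b ->
  exists G : 'M[R]_n.+1, posdef G /\ \det G = (a * b ^ n) ^ 2 /\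
   forall v : 'rV[R]_n.+1, qform G v = (a * v ord0 ord0) ^ 2 +
     \Sum_(j < n) ((b * (v ord0 (lift ord0 j) - theta j * v ord0 ord0)) ^ 2).
Proof.
move=> a0 b0.
pose T : 'M[R]_(1 + n) := block_mx a%:M (\row_j (- (b * theta j))) 0%R b%:M.
have dT : \det T = a * b ^ n by rewrite det_ublock !det_scalar expr1 -RpowE.
have dT0 : \det T != 0%R.
  rewrite dT; apply/eqP; apply: Rgt_not_eq; apply: Rmult_gt_0_compat => //.
  exact: pow_lt.
have fT : row_free T by rewrite row_free_unit unitmxE unitfE.
exists (T *m T^T)%R; split; first exact: posdef_gram.
split; first by rewrite det_mulmx det_tr dT -RmultE /= Rmult_1_r.
move=> v; have -> : (T *m T^T = T *m 1%:M *m T^T)%R by rewrite mulmx1.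
rewrite qform_congr /qform mulmx1 mxE big_ord_recl.
have h0 : (v *m T)%R ord0 ord0 = a * v ord0 ord0.
  rewrite mxE big_ord_recl big1 => [|j _].
    rewrite !mxE /=; have -> : (ord0 : 'I_(1 + n)) = lshift n (ord0 : 'I_1) by apply: val_inj.
    by rewrite [split _](unsplitK (inl _ : 'I_1 + 'I_n))
      mxE [split _](unsplitK (inl _ : 'I_1 + 'I_n)) !mxE eqxx mulr1n addr0 mulrC.
  rewrite !mxE; have -> : lift ord0 j = rshift 1 j by apply: val_inj.
  rewrite [split _](unsplitK (inr _ : 'I_1 + 'I_n)) mxE.
  by case: splitP => k //= _; rewrite !mxE mulr0.
have hS k : (v *m T)%R ord0 (lift ord0 k) = b * (v ord0 (lift ord0 k) - theta k * v ord0 ord0).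
  rewrite mxE big_ord_recl (bigD1 k) //= big1 => [|j hj].
    rewrite !mxE; have -> : lift ord0 k = rshift 1 k by apply: val_inj.
    have -> : (ord0 : 'I_(1 + n)) = lshift n (ord0 : 'I_1) by apply: val_inj.
    rewrite [split (lshift _ _)](unsplitK (inl _ : 'I_1 + 'I_n))
      [split (rshift _ _)](unsplitK (inr _ : 'I_1 + 'I_n)).
    rewrite !mxE [split (rshift _ _)](unsplitK (inr _ : 'I_1 + 'I_n)) !mxE eqxx mulr1n addr0.
    rewrite -!RmultE -RplusE. ring.
  rewrite !mxE; have -> : lift ord0 k = rshift 1 k by apply: val_inj.
  have -> : lift ord0 j = rshift 1 j by apply: val_inj.
  rewrite [split (rshift _ j)](unsplitK (inr _ : 'I_1 + 'I_n)) mxE.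
  by rewrite [split (rshift _ k)](unsplitK (inr _ : 'I_1 + 'I_n)) !mxE (negbTE hj) mulr0n mulr0.
rewrite [_^T _ _]mxE -RplusE; congr (Rplus _ _).
  by rewrite -RmultE h0; ring.
by apply: eq_bigr => j _; rewrite [_^T _ _]mxE hS -RmultE; ring.
Qed.

(* For a minimal choice of [d+1] indices, if some chosen [lam] exceeds 1 then all the omitted ones
   do, which bounds the partial product without extracting roots. *)
Lemma best_injection n d (lam : 'I_n.+1 -> R) (C : R) : (d <= n)%N -> 1 <= C ->
  (forall i, 0 < lam i) -> \Prod_(i < n.+1) lam i <= C ->
  exists f : 'I_d.+1 -> 'I_n.+1, injective f /\ \Prod_(i < d.+1) lam (f i) <= C.
Proof.
move=> hd C1 lp hC.
pose F (f : {ffun 'I_d.+1 -> 'I_n.+1}) : R := \Prod_(i < d.+1) lam (f i).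
have hd' : (d.+1 <= n.+1)%N by [].
pose f0 : {ffun 'I_d.+1 -> 'I_n.+1} := [ffun i => widen_ord hd' i].
have i0 : injectiveb f0.
  apply/injectiveP => i j; rewrite !ffunE => /(congr1 val) /= h; exact: val_inj.
case: (@Order.TotalTheory.arg_minP _ R _ f0 (fun f : {ffun 'I_d.+1 -> 'I_n.+1} => injectiveb f)
  F i0) => f /injectiveP injf hmin.
exists f; split=> //.
have [//|hbad] := Rle_lt_dec (F f) C; exfalso.
have [i hi] : exists i, 1 < lam (f i).
  apply: contrapT => hn; suff : F f <= 1 by lra.
  suff: 0 <= F f <= 1 by case.
  rewrite /F; elim/big_ind: _ => [|u v hu hv|i _]; [lra | nra |].
  split; first exact: Rlt_le.
  by apply: Rnot_lt_le => h; apply: hn; exists i.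
have hj j : j \notin codom f -> 1 <= lam j.
  move=> jf.
  pose g : {ffun 'I_d.+1 -> 'I_n.+1} := [ffun k => if k == i then j else f k].
  have ig : injectiveb g.
    apply/injectiveP => k l; rewrite !ffunE; case: eqP => [->|nk]; case: eqP => [->|nl] //.
    - by move=> h; case/negP: jf; rewrite h codom_f.
    - by move=> h; case/negP: jf; rewrite -h codom_f.
    - exact: injf.
  have /RleP := hmin g ig; rewrite /F (bigD1 i) //= [X in _ <= X](bigD1 i) //= ffunE eqxx.
  have -> : \big[Rmult/1]_(k < d.+1 | k != i) lam (g k) = \big[Rmult/1]_(k < d.+1 | k != i)
    lam (f k).
    by apply: eq_bigr => k /negbTE hk; rewrite ffunE hk.
  have: 0 < \big[Rmult/1]_(k < d.+1 | k != i) lam (f k).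
    by elim/big_ind: _ => [|u v hu hv|k _]; [lra | nra | exact: lp].
  move=> X0 hX; have aux (x y X : R) : 0 < X -> x * X <= y * X -> 1 < x -> 1 <= y by nra.
  exact: (aux _ _ _ X0 hX hi).
have : F f <= \Prod_(i < n.+1) lam i.
  rewrite (bigID (fun j => j \in codom f)) /=.
  have -> : \big[Rmult/1]_(j < n.+1 | j \in codom f) lam j = F f.
    have -> : F f = \big[Rmult/1]_(j <- codom f) lam j by rewrite big_map big_enum.
    rewrite big_uniq //; exact/injectiveP.
  have : 1 <= \big[Rmult/1]_(j < n.+1 | j \notin codom f) lam j.
    by elim/big_ind: _ => [|u v hu hv|k hk]; [lra | nra | exact: hj].
  have aux (x y : R) : 0 < x -> 1 <= y -> x <= x * y by nra.
  by apply: aux; lra.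
lra.
Qed.

Lemma prod_ge0 k (f : 'I_k -> R) : (forall i, 0 <= f i) -> 0 <= \Prod_(i < k) f i.
Proof. by move=> hf; elim/big_ind: _ => [|u v hu hv|i _]; [lra | nra | exact: hf]. Qed.

Lemma sum_le k (f g : 'I_k -> R) : (forall i, f i <= g i) ->
  \Sum_(i < k) f i <= \Sum_(i < k) g i.
Proof. by move=> h; elim/big_ind2: _ => [|a b a' b' h1 h2|i _]; [lra | lra | exact: h]. Qed.

Lemma sum_const k (c : R) : \Sum_(i < k) c = INR k * c.
Proof.
elim: k => [|k IH]; first by rewrite big_ord0 /=; lra.
by rewrite big_ord_recr IH S_INR /=; lra.
Qed.

Lemma sum_scal k (c : R) (f : 'I_k -> R) : \Sum_(i < k) (c * f i) = c * \Sum_(i < k) f i.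
Proof. by rewrite big_distrr. Qed.

Lemma sum_ge0 k (f : 'I_k -> R) : (forall i, 0 <= f i) -> 0 <= \Sum_(i < k) f i.
Proof. by move=> h; elim/big_ind: _ => [|a b h1 h2|i _]; [lra | lra | exact: h]. Qed.

Lemma prod_scal_sqr k (c : R) (f : 'I_k -> R) :
  \Prod_(i < k) (c * f i ^ 2) = c ^ k * (\Prod_(i < k) f i) ^ 2.
Proof.
elim: k f => [|k IH] f; first by rewrite !big_ord0 /=; ring.
by rewrite !big_ord_recr IH /=; ring.
Qed.

(* Subtracting multiples of row 0 from the other rows kills their column 0; then Hadamard. *)
Lemma gram_det_bound n d (X : 'M[R]_(d.+1, n.+1)) (theta : 'I_n -> R) M b (lam : 'I_d.+1 -> R) :
  row_free X -> 0 < b -> (forall j, Rabs (theta j) <= M) -> (forall i, 0 < lam i) ->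
  (forall i, \Sum_(j < n) ((X i (lift ord0 j) - theta j * X i ord0) ^ 2) <= (lam i / b) ^ 2) ->
  (forall i, Rabs (X i ord0) / lam i <= Rabs (X ord0 ord0) / lam ord0) ->
  \det (X *m X^T) <= ((1 + 2 * INR n * M ^ 2) * (Rabs (X ord0 ord0) / lam ord0) ^ 2 + 2 / b ^ 2) *
    (4 / b ^ 2) ^ d * (\Prod_(i < d.+1) lam i) ^ 2.
Proof.
move=> fX b0 hM lp he hmax.
pose r (j : 'I_d) : R := X (lift ord0 j) ord0 / X ord0 ord0.
(* If the pivot entry is 0, maximality of its ratio forces all of column 0 to vanish, and the
   conventional value 0 of the quotient is the right multiplier. *)
have hr j : r j * X ord0 ord0 = X (lift ord0 j) ord0.
  rewrite /r; have [x0|x0] := Req_dec (X ord0 ord0) 0; last by field.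
  have := hmax (lift ord0 j); rewrite x0 Rabs_R0 Rmult_0_r.
  have [->//|/Rabs_pos_lt h1 h2] := Req_dec (X (lift ord0 j) ord0) 0.
  have := Rdiv_lt_0_compat _ _ h1 (lp (lift ord0 j)).
  by move: h2; rewrite /Rdiv Rmult_0_l => h2 h3; lra.
(* Maximality of the first ratio keeps the multiplier below the ratio of the [lam], so subtracting
   row 0 enlarges row [j] by no more than its own size. *)
have hr2 j : Rabs (r j) <= lam (lift ord0 j) / lam ord0.
  have l0 := lp ord0; have lj := lp (lift ord0 j).
  have [x0|x0] := Req_dec (X ord0 ord0) 0.
    by rewrite /r x0 /Rdiv Rinv_0 Rmult_0_r Rabs_R0; apply: Rlt_le; apply: Rdiv_lt_0_compat.
  have := hmax (lift ord0 j); rewrite -hr Rabs_mult.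
  move/Rabs_pos_lt: x0; set q := Rabs (X _ _); set s := Rabs (r j) => q0 h.
  apply: (Rmult_le_reg_r (q / lam (lift ord0 j))); first exact: Rdiv_lt_0_compat.
  have -> : lam (lift ord0 j) / lam ord0 * (q / lam (lift ord0 j)) = q / lam ord0 by field; lra.
  by apply: Rle_trans h; apply: Req_le; field; lra.
pose X1 : 'M[R]_(1 + d, n.+1) := X.
pose T : 'M[R]_(1 + d) := block_mx 1%:M 0%R (- \col_j r j)%R 1%:M.
pose F : 'M[R]_(1 + d, n.+1) := T *m X1.
have dT : \det T = 1%R by rewrite det_lblock !det1 mulr1.
have fF : row_free F.
  by rewrite /row_free mxrankMfree // -/(row_free _) row_free_unit unitmxE dT unitr1.
have EF : F = col_mx (usubmx X1) (dsubmx X1 - (\col_j r j) *m usubmx X1).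
  by rewrite /F -{1}[X1]vsubmxK mul_block_col !mul1mx mul0mx addr0 mulNmx addrC.
have F0 l : F ord0 l = X ord0 l.
  rewrite EF; have -> : (ord0 : 'I_(1 + d)) = lshift d (ord0 : 'I_1) by apply: val_inj.
  by rewrite col_mxEu mxE; congr (X _ _); apply: val_inj.
have FS j l : F (lift ord0 j) l = X (lift ord0 j) l - r j * X ord0 l.
  rewrite EF; have -> : lift ord0 j = rshift 1 j by apply: val_inj.
  rewrite col_mxEd !mxE big_ord1 !mxE -RmultE; congr (_ - _ * _).
  by congr (X _ _); apply: val_inj.
have dF : \det (X *m X^T) = \det (F *m F^T).
  by rewrite /F trmx_mul mulmxA -[T *m X1 *m X1^T]mulmxA !det_mulmx det_tr dT mul1r mulr1.
rewrite dF.
have /RleP h := hadamard (posdef_gram fF); apply: (Rle_trans _ _ _ h) => {h}.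
have diag i : (F *m F^T)%R i i = F i ord0 ^ 2 + \Sum_(j < n) (F i (lift ord0 j) ^ 2).
  rewrite mxE big_ord_recl; congr (Rplus _ _);
    first by rewrite [X in (_ * X)%R]mxE -RmultE /= Rmult_1_r.
  by apply: eq_bigr => j _; rewrite [X in (_ * X)%R]mxE -RmultE /= Rmult_1_r.
have h0 : (F *m F^T)%R ord0 ord0 <=
   ((1 + 2 * INR n * M ^ 2) * (Rabs (X ord0 ord0) / lam ord0) ^ 2 + 2 / b ^ 2) * lam ord0 ^ 2.
  rewrite diag F0; set q := X ord0 ord0.
  have h1 : \Sum_(j < n) (F ord0 (lift ord0 j) ^ 2) <=
    2 * \Sum_(j < n) ((X ord0 (lift ord0 j) - theta j * X ord0 ord0) ^ 2)
      + INR n * (2 * M ^ 2 * q ^ 2).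
    rewrite -(sum_const n) -sum_scal -big_split /=; apply: sum_le => j; rewrite F0 -/q.
    have t2 : theta j ^ 2 <= M ^ 2.
      by rewrite -(pow2_abs (theta j)); apply: pow_incr; split; [apply: Rabs_pos | apply: hM].
    have q2 := pow2_ge_0 q.
    have h3 : (theta j * q) ^ 2 <= M ^ 2 * q ^ 2 by rewrite Rpow_mult_distr;
      apply: Rmult_le_compat_r.
    have := pow2_ge_0 (X ord0 (lift ord0 j) - 2 * (theta j * q)).
    by move: h3; move: (X ord0 (lift ord0 j)) (theta j * q) => y t; rewrite /= => h3 h4; nra.
  have h2 := he ord0.
  have l0 := lp ord0.
  have -> : ((1 + 2 * INR n * M ^ 2) * (Rabs q / lam ord0) ^ 2 + 2 / b ^ 2) * lam ord0 ^ 2 =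
    (1 + 2 * INR n * M ^ 2) * Rabs q ^ 2 + 2 * (lam ord0 / b) ^ 2 by field; lra.
  by rewrite pow2_abs; lra.
(* With column 0 cleared, the row equals $e_j - r_j e_0$ for the error vectors $e_i = X_i - \theta
   X_{i0}$. Both terms have norm at most [lam (lift ord0 j) / b], and $(u-v)^2 \le 2u^2 + 2v^2$
   produces the 4. *)
have hS j : (F *m F^T)%R (lift ord0 j) (lift ord0 j) <= 4 / b ^ 2 * lam (lift ord0 j) ^ 2.
  rewrite diag FS hr; set lj := lam _; set l0 := lam ord0.
  have -> : (X (lift ord0 j) ord0 - X (lift ord0 j) ord0) ^ 2 = 0 by ring.
  rewrite Rplus_0_l.
  pose e i k := X i (lift ord0 k) - theta k * X i ord0.
  have h1 : \Sum_(k < n) (F (lift ord0 j) (lift ord0 k) ^ 2) <=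
      2 * \Sum_(k < n) (e (lift ord0 j) k ^ 2) + 2 * r j ^ 2 * \Sum_(k < n) (e ord0 k ^ 2).
    rewrite -!sum_scal -big_split /=; apply: sum_le => k; rewrite FS.
    have -> : X (lift ord0 j) (lift ord0 k) - r j * X ord0 (lift ord0 k) =
      e (lift ord0 j) k - r j * e ord0 k by rewrite /e -(hr j); ring.
    by have := pow2_ge_0 (e (lift ord0 j) k + r j * e ord0 k); rewrite /=; lra.
  have h2 := he ord0; have h3 := he (lift ord0 j).
  have p0 := lp ord0; have pj := lp (lift ord0 j); rewrite -/lj -/l0 in h2 h3 p0 pj.
  have r2 : r j ^ 2 <= (lj / l0) ^ 2.
    by rewrite -(pow2_abs (r j)); apply: pow_incr; split; [apply: Rabs_pos | apply: hr2].
  have h4 : r j ^ 2 * \Sum_(k < n) (e ord0 k ^ 2) <= (lj / l0) ^ 2 * (l0 / b) ^ 2.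
    by apply: Rmult_le_compat => //; [apply: pow2_ge_0 | apply: sum_ge0 => k; apply: pow2_ge_0].
  have -> : 4 / b ^ 2 * lj ^ 2 = 2 * (lj / b) ^ 2 + 2 * ((lj / l0) ^ 2 * (l0 / b) ^ 2) by field;
    lra.
  apply: Rle_trans h1 _.
  have h5 : \Sum_(k < n) (e (lift ord0 j) k ^ 2) <= (lj / b) ^ 2 by [].
  by move: h4 h5; set S0 := (\Sum_(k < n) (e ord0 k ^ 2)); set S1 := \Sum_(k < n) _; lra.
have d0 i : 0 <= (F *m F^T)%R i i.
  rewrite diag; have := pow2_ge_0 (F i ord0).
  have : 0 <= \Sum_(j < n) (F i (lift ord0 j) ^ 2) by apply: sum_ge0 => j; apply: pow2_ge_0.
  lra.
rewrite !big_ord_recl.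
set Y := (_ * _ + _) in h0 *.
have hP : \Prod_(j < d) (F *m F^T)%R (lift ord0 j) (lift ord0 j) <=
  (4 / b ^ 2) ^ d * (\Prod_(j < d) lam (lift ord0 j)) ^ 2.
  apply: Rle_trans (_ : \Prod_(j < d) (4 / b ^ 2 * lam (lift ord0 j) ^ 2) <= _).
    by apply: prod_le => j; split; [apply: d0 | apply: hS].
  by rewrite prod_scal_sqr; apply: Req_le.
rewrite Rpow_mult_distr.
apply: Rle_trans (_ : (Y * lam ord0 ^ 2) * ((4 / b ^ 2) ^ d * (\Prod_(j < d) lam (lift ord0 j))
  ^ 2) <= _); last by apply: Req_le; ring.
rewrite -RmultE; apply: Rmult_le_compat => //.
by apply: prod_ge0 => j; apply: d0.
Qed.

Lemma prod_sqr k (f : 'I_k -> R) : \Prod_(i < k) (f i ^ 2) = (\Prod_(i < k) f i) ^ 2.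
Proof.
rewrite -[RHS]Rmult_1_l -[X in X * _](pow1 k) -(prod_scal_sqr 1 f).
by apply: eq_bigr => i _; rewrite Rmult_1_l.
Qed.

Lemma sum_ge_term k (f : 'I_k -> R) i : (forall i, 0 <= f i) -> f i <= \Sum_(i < k) f i.
Proof.
move=> h; rewrite (bigD1 i) //= -[X in X <= _]Rplus_0_r; apply: Rplus_le_compat_l.
by elim/big_ind: _ => [|a b h1 h2|j _]; [lra | lra | exact: h].
Qed.

Lemma pow_bound_sqr x y : 0 <= x -> 0 <= y -> x ^ 2 <= y ^ 2 -> x <= y.
Proof. by rewrite /= => h1 h2 h3; nra. Qed.

(** Reduction of the form with $a = b^{-n}$ gives $d+1$ vectors of a unimodular basis whose lengths
    $\lambda_i$ have bounded product. Let $\kappa$ be the largest $|x_{i0}|/\lambda_i$. Then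
    [gram_det_bound] yields $H \ll \kappa b^{-d}$, and $\kappa \le b^n$ gives the height bound. The
    row attaining $\kappa$, divided by its column 0, is a rational point of the plane at distance at
    most $1/(b\kappa)$ from $\theta$ in each coordinate; in the product with $H$ the unknown
    $\kappa$ cancels. *)
Lemma dirichlet n d M : (d < n)%N -> 0 <= M -> exists C b0 : R, 0 < C /\ 1 <= b0 /\
  forall theta b, (forall i, (i < n)%N -> Rabs (theta i) <= M) -> b0 <= b ->
  exists x, RatAffData n d x /\ height n d x <= C * b ^ (n - d) /\
  exists P, AffOf n d x P /\
    forall i, (i < n)%N -> height n d x * Rabs (theta i - P i) <= C / b ^ d.+1.
Proof.
move=> hd M0.
pose C1 : R := 2 ^ (n.+1 * n.+1).
have C11 : 1 <= C1 by apply: pow_R1_Rle; lra.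
pose A := 4 ^ d * C1 ^ 2.
have A0 : 0 < A by apply: Rmult_lt_0_compat; apply: pow_lt; lra.
pose K := 1 + 2 * INR n * M ^ 2.
have K1 : 1 <= K.
  have := pos_INR n; have := pow2_ge_0 M; rewrite /K; move: (INR n) (M ^ 2) => u v *; nra.
have KA : 0 < K * A by nra.
exists (1 + 2 * (K * A)), (1 + 4 * A); split; first lra.
split; first lra.
move=> theta b hM hb.
have b1 : 1 < b by lra.
have b0 : 0 < b by lra.
have bn : 0 < b ^ n by apply: pow_lt.
have [G [pG [dG hG]]] := twisted_form (fun j : 'I_n => theta j) (Rinv_0_lt_compat _ bn) b0.
have dG1 : \det G = 1 by rewrite dG Rinv_l ?pow1; lra.
have [U uU /RleP hU] := reduction pG.
pose q i := qform G (row i (iR U)).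
have q0 i : 0 < q i.
  apply/RltP; apply: (proj2 pG); apply: row_free_row_neq0.
  by rewrite row_free_unit; apply: row_free_iR_unit.
have [f [injf hf]] : exists f : 'I_d.+1 -> 'I_n.+1, injective f /\
    \Prod_(i < d.+1) sqrt (q (f i)) <= C1.
  apply: (best_injection (lam := fun i => sqrt (q i))) => //; first exact: ltnW.
    by move=> i; apply: sqrt_lt_R0.
  apply: pow_bound_sqr; [by apply: prod_ge0 => i; apply: sqrt_pos | lra |].
  rewrite -prod_sqr.
  have -> : \Prod_(i < n.+1) (sqrt (q i) ^ 2) = \Prod_(i < n.+1) q i.
    by apply: eq_bigr => i _; rewrite pow2_sqrt //; apply: Rlt_le.
  move: hU; rewrite -RmultE -RpowE [\det G]dG1 Rmult_1_r -/C1 => hU.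
  by apply: Rle_trans hU _; rewrite /=; nra.
pose lam0 i := sqrt (q (f i)).
have lam00 i : 0 < lam0 i by apply: sqrt_lt_R0.
pose kap i : R := Rabs (iR U (f i) ord0) / lam0 i.
have [i0 hi0] : exists i0, forall i, kap i <= kap i0.
  case: (@Order.TotalTheory.arg_maxP _ R _ (@ord0 d) xpredT kap isT) => i0 _ h.
  by exists i0 => i; apply/RleP; apply: h.
(* The transposition moves the row with the largest ratio [kap] to index 0, where [gram_det_bound]
   expects it. *)
pose g i := f (tperm ord0 i0 i).
have injg : injective g by move=> i j /injf /perm_inj.
pose lam i := sqrt (q (g i)).
have lamp i : 0 < lam i by apply: sqrt_lt_R0.
have hlam : \Prod_(i < d.+1) lam i <= C1.
  by rewrite /lam /g -(reindex_inj (perm_inj (s := tperm ord0 i0)) (P := xpredT) (F := fun i =>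
    sqrt (q (f i)))).
have [li lb] := unimodular_rows injg uU.
set x := ofI _ in li lb.
have EX i l : toM n d x i l = iR U (g i) l by rewrite toM_ofI !mxE.
have hq i : q (g i) = (/ b ^ n * toM n d x i ord0) ^ 2 +
   \Sum_(j < n) ((b * (toM n d x i (lift ord0 j) - theta j * toM n d x i ord0)) ^ 2).
  rewrite /q hG; congr (Rplus _ _); first by rewrite EX !mxE.
  by apply: eq_bigr => j _; rewrite !EX !mxE.
have he i : \Sum_(j < n) ((toM n d x i (lift ord0 j) - theta j * toM n d x i ord0) ^ 2)
  <= (lam i / b) ^ 2.
  have -> : (lam i / b) ^ 2 = / b ^ 2 * q (g i).
    by rewrite -(pow2_sqrt (q (g i))) -/(lam i); [field; lra | apply: Rlt_le].
  rewrite hq; set S := \Sum_(j < n) (_ ^ 2) in hq *.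
  have -> : \Sum_(j < n) ((b * (toM n d x i (lift ord0 j) - theta j * toM n d x i ord0)) ^ 2)
    = b ^ 2 * S.
    by rewrite -sum_scal; apply: eq_bigr => j _; rewrite Rpow_mult_distr.
  have -> : / b ^ 2 * ((/ b ^ n * toM n d x i ord0) ^ 2 + b ^ 2 * S) =
     (/ b * (/ b ^ n * toM n d x i ord0)) ^ 2 + S by field; lra.
  by have := pow2_ge_0 (/ b * (/ b ^ n * toM n d x i ord0)); lra.
pose kappa := Rabs (toM n d x ord0 ord0) / lam ord0.
have hmax i : Rabs (toM n d x i ord0) / lam i <= kappa.
  rewrite /kappa !EX /lam /g tpermL; exact: hi0.
have fX : row_free (toM n d x) by apply/RLinIndepE.
have hv := gram_det_bound fX b0 (fun j => hM j (ltn_ord j)) lamp he hmax.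
have H1 := height_ge1 li.
set H := height n d x in H1 *.
have EH : \det (toM n d x *m (toM n d x)^T) = H ^ 2.
  rewrite /H heightE pow2_sqrt //; apply: Rlt_le; apply/RltP.
  exact: det_posdef_gt0 (posdef_gram fX).
rewrite EH -/kappa -/K in hv.
have kap0 : 0 <= kappa.
  by apply: Rmult_le_pos; [apply: Rabs_pos | apply/Rlt_le/Rinv_0_lt_compat; apply: lamp].
have bd : 0 < b ^ d by apply: pow_lt.
have bd1 : 1 <= b ^ d by apply: pow_R1_Rle; lra.
have Bd : 0 < / b ^ d <= 1.
  split; first exact: Rinv_0_lt_compat.
  by rewrite -[X in _ <= X]Rinv_1; apply: Rinv_le_contravar; lra.
have hA : H ^ 2 <= (K * kappa ^ 2 + 2 / b ^ 2) * (A * (/ b ^ d) ^ 2).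
  apply: Rle_trans hv _; rewrite Rmult_assoc; apply: Rmult_le_compat_l.
    apply: Rplus_le_le_0_compat; first by apply: Rmult_le_pos; [lra | apply: pow2_ge_0].
    by apply: Rmult_le_pos; [lra | apply/Rlt_le/Rinv_0_lt_compat; apply: pow_lt].
  have -> : (4 / b ^ 2) ^ d = 4 ^ d * (/ b ^ d) ^ 2.
    by rewrite /Rdiv Rpow_mult_distr !pow_inv -!pow_mult Nat.mul_comm.
  have -> : A * (/ b ^ d) ^ 2 = 4 ^ d * (/ b ^ d) ^ 2 * C1 ^ 2 by rewrite /A; ring.
  apply: Rmult_le_compat_l.
    by apply: Rmult_le_pos; [apply: pow_le; lra | apply: pow2_ge_0].
  by apply: pow_incr; split=> //; apply: prod_ge0 => i; apply: Rlt_le.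
(* The threshold [b0] makes the part of the bound without [kappa] at most 1/2. As the height is at
   least 1, this part can be absorbed on the left. *)
have hsmall : 2 / b ^ 2 * (A * (/ b ^ d) ^ 2) <= 1 / 2.
  have h1 : / b ^ 2 * A <= 1 / 4.
    apply: (Rmult_le_reg_l (b ^ 2)); first exact: pow_lt.
    rewrite -Rmult_assoc Rinv_r; last by apply: pow_nonzero; lra.
    by rewrite /=; nra.
  have h2 : (/ b ^ d) ^ 2 <= 1 by rewrite /=; nra.
  have h3 := pow2_ge_0 (/ b ^ d).
  have h4 : 0 < / b ^ 2 * A by apply: Rmult_lt_0_compat => //; apply/Rinv_0_lt_compat/pow_lt.
  rewrite /Rdiv; move: h1 h2 h3 h4; move: (/ b ^ 2) ((/ b ^ d) ^ 2) => u v; nra.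
have hH2 : H ^ 2 <= 2 * (K * A) * (kappa * / b ^ d) ^ 2.
  rewrite Rpow_mult_distr.
  have : 1 <= H ^ 2 by rewrite /=; nra.
  by move: hA hsmall; move: (2 / b ^ 2) (H ^ 2) ((/ b ^ d) ^ 2) (kappa ^ 2) => u v w z *; nra.
(* If [kappa] were 0, the height would be 0. So the selected row has a nonzero column 0, and the
   subspace is not contained in the hyperplane at infinity. *)
have kapp : 0 < kappa.
  have [//|k0] := Rle_lt_or_eq_dec _ _ kap0.
  by move: hH2; rewrite -k0 Rmult_0_l [0 ^ 2]/= Rmult_0_l Rmult_0_r /=; nra.
have hH : H <= (1 + 2 * (K * A)) * (kappa * / b ^ d).
  apply: pow_bound_sqr; [lra | by apply: Rmult_le_pos; [lra | nra] |].
  apply: Rle_trans hH2 _; rewrite [X in _ <= X]Rpow_mult_distr.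
  by apply: Rmult_le_compat_r; [apply: pow2_ge_0 | rewrite /=; nra].
have x0 : toM n d x ord0 ord0 <> 0.
  by move=> h; move: kapp; rewrite /kappa h Rabs_R0 /Rdiv Rmult_0_l; lra.
have C0 : 0 < 1 + 2 * (K * A) by lra.
exists x; split.
  split=> //; split=> //; apply/(col0_toM n).
  by apply/eqP => /matrixP/(_ ord0 ord0); rewrite !mxE => h; apply: x0; rewrite !mxE.
have l0 := lamp ord0.
have hlq : lam ord0 ^ 2 = q (g ord0) by rewrite pow2_sqrt //; apply: Rlt_le.
split.
  apply: Rle_trans hH _; apply: Rmult_le_compat_l; first lra.
  have -> : b ^ (n - d) = b ^ n * / b ^ d.
    apply: (Rmult_eq_reg_r (b ^ d)); last lra.
    rewrite -pow_add; have -> : (n - d + d)%coq_nat = n by lia.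
    by field; lra.
  apply: Rmult_le_compat_r; first lra.
  apply: (Rmult_le_reg_r (/ b ^ n * lam ord0)).
    by apply: Rmult_lt_0_compat => //; apply: Rinv_0_lt_compat.
  have -> : kappa * (/ b ^ n * lam ord0) = / b ^ n * Rabs (toM n d x ord0 ord0).
    by rewrite /kappa; field; lra.
  have -> : b ^ n * (/ b ^ n * lam ord0) = lam ord0 by field; lra.
  apply: pow_bound_sqr; [|lra|].
    by apply: Rmult_le_pos; [apply/Rlt_le/Rinv_0_lt_compat | apply: Rabs_pos].
  rewrite hlq hq Rpow_mult_distr pow2_abs -Rpow_mult_distr.
  set S := (\Sum_(j < n) _); suff : 0 <= S by lra.
  by apply: sum_ge0 => j; apply: pow2_ge_0.
pose X := toM n d x.
pose P i := if ltnP i n is LtnNotGeq h then X ord0 (lift ord0 (Ordinal h)) / X ord0 ord0 else 0.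
exists P.
have hP (j : 'I_n) : P j = X ord0 (lift ord0 j) / X ord0 ord0.
  rewrite /P; case: ltnP => h; last by have := ltn_ord j; rewrite ltnNge h.
  by congr (X _ _ / _); congr lift; apply: val_inj.
split.
  apply/AffOfE; split.
    by move=> i /ssrnat.leP hi; rewrite /P; case: ltnP => // h; move: hi; rewrite leqNgt h.
  exists ((/ X ord0 ord0) *: delta_mx ord0 ord0)%R.
  have E l : ((/ X ord0 ord0 *: delta_mx ord0 ord0)
    *m toM n d x)%R ord0 l = / X ord0 ord0 * X ord0 l.
    rewrite [LHS]mxE (bigD1 ord0) //= big1 => [|k /negbTE hk].
      by rewrite !mxE !eqxx mulr1 addr0.
    by rewrite !mxE hk andbF mulr0 mul0r.
  split; first by rewrite E Rinv_l.
  by move=> l; rewrite E hP Rmult_comm.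
move=> i hi; rewrite -[i]/(val (Ordinal hi)); set j := Ordinal hi.
rewrite hP.
have -> : theta j - X ord0 (lift ord0 j) / X ord0 ord0 =
   - (X ord0 (lift ord0 j) - theta j * X ord0 ord0) / X ord0 ord0.
  by field; exact: x0.
set e := X _ _ - _.
have he0 : Rabs e <= lam ord0 / b.
  apply: pow_bound_sqr; first exact: Rabs_pos.
    by apply/Rlt_le/Rdiv_lt_0_compat.
  rewrite pow2_abs; apply: Rle_trans (he ord0).
  apply: (sum_ge_term (f := fun j : 'I_n => (toM n d x ord0 (lift ord0 j)
    - theta j * toM n d x ord0 ord0) ^ 2)) => k.
  exact: pow2_ge_0.
have X0 : 0 < Rabs (X ord0 ord0) by apply: Rabs_pos_lt.
have -> : Rabs (- e / X ord0 ord0) = Rabs e / Rabs (X ord0 ord0).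
  by rewrite /Rdiv Rabs_mult Rabs_Ropp Rabs_inv.
apply: Rle_trans (_ : (1 + 2 * (K * A)) * (kappa * / b ^ d) * ((lam ord0 / b)
  / Rabs (X ord0 ord0)) <= _).
  apply: Rmult_le_compat => //; first by rewrite -/H; lra.
    by apply: Rmult_le_pos; [apply: Rabs_pos | apply/Rlt_le/Rinv_0_lt_compat].
  by apply: Rmult_le_compat_r => //; apply/Rlt_le/Rinv_0_lt_compat.
by apply: Req_le; rewrite /kappa -/X /=; field; lra.
Qed.

(** * Coordinates on affine subspaces *)

Definition comb n k (u : 'I_k -> 'I_n -> R) (c : 'I_k -> R) (i : 'I_n) : R :=
  \Sum_(j < k) (c j * u j i).

(* Gaussian elimination with complete pivoting. *)
Lemma pivot_coordinates n k (u : 'I_k -> 'I_n -> R) :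
  (forall c, (forall i, comb u c i = 0) -> forall j, c j = 0) ->
  exists I : 'I_k -> 'I_n,
   (forall c t, 0 <= t -> (forall j, Rabs (comb u c (I j)) <= t) ->
      forall i, Rabs (comb u c i) <= 3 ^ k * t) /\
   (forall t : 'I_k -> R, exists c, forall j, comb u c (I j) = t j).
Proof.
elim: k u => [|k IH] u hu.
  have I0 : 'I_0 -> 'I_n by case.
  exists I0; split=> [c t t0 _ i|t]; first by rewrite /comb big_ord0 Rabs_R0 /=; lra.
  by exists (fun _ => 0); case.
have [i1 hi1] : exists i, u ord0 i <> 0.
  apply: contrapT => hn.
  have h0 : forall i, u ord0 i = 0 by move=> i; apply: contrapT => ne; apply: hn; exists i.
  have /(_ (fun j => if j == ord0 then 1 else 0)) hc := hu.
  have /(_ ord0) : forall j : 'I_k.+1, (if j == ord0 then 1 else 0) = 0.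
    apply: hc => i; rewrite /comb big1 // => j _; case: eqP => [->|_]; rewrite ?h0; ring.
  by rewrite eqxx; lra.
have [i0 hi0] : exists i0, forall i, Rabs (u ord0 i) <= Rabs (u ord0 i0).
  case: (@Order.TotalTheory.arg_maxP _ R _ i1 xpredT (fun i => Rabs (u ord0 i)) isT) => i0 _ h.
  by exists i0 => i; apply/RleP; apply: h.
set a := u ord0 i0 in hi0.
have a0 : 0 < Rabs a by apply: Rlt_le_trans (hi0 i1); apply: Rabs_pos_lt.
have a1 : a <> 0 by move=> h; move: a0; rewrite h Rabs_R0; lra.
pose w i := u ord0 i / a.
have w1 i : Rabs (w i) <= 1.
  rewrite /w /Rdiv Rabs_mult Rabs_inv; apply: (Rmult_le_reg_r (Rabs a)) => //.
  by rewrite Rmult_assoc Rinv_l; [have := hi0 i; lra | lra].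
pose u' (j : 'I_k) i := u (lift ord0 j) i - u (lift ord0 j) i0 * w i.
have dec c i : comb u c i = comb u c i0 * w i + comb u' (fun j => c (lift ord0 j)) i.
  rewrite /comb !big_ord_recl -/a Rmult_plus_distr_r Rplus_assoc; congr (_ + _).
    by rewrite /w; field.
  have h : \Sum_(j < k) (c (lift ord0 j) * u' j i) =
    \Sum_(j < k) (c (lift ord0 j) * u (lift ord0 j) i) + (- w i) * \Sum_(j < k) (c (lift ord0 j)
      * u (lift ord0 j) i0).
    by rewrite -sum_scal -big_split /=; apply: eq_bigr => j _; rewrite /u'; ring.
  by rewrite h; ring.
have [j|I' [hI1 hI2]] := IH u'.
  move=> hc j'.
  pose s := \Sum_(l < k) (j l * u (lift ord0 l) i0).
  pose c l := if unlift ord0 l is Some l' then j l' else - s / a.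
  have cS l : c (lift ord0 l) = j l by rewrite /c liftK.
  rewrite -cS; apply: hu => i; rewrite dec.
  have -> : comb u c i0 = 0.
    rewrite /comb big_ord_recl -/a; have -> : \Sum_(l < k) (c (lift ord0 l) * u (lift ord0 l) i0)
      = s.
      by apply: eq_bigr => l _; rewrite cS.
    by rewrite /c unlift_none; field.
  have -> : comb u' (fun l => c (lift ord0 l)) i = comb u' j i.
    by apply: eq_bigr => l _; rewrite cS.
  by rewrite hc; ring.
exists (fun j => if unlift ord0 j is Some j' then I' j' else i0); split.
  move=> c t t0 hc i; rewrite dec.
  have h0 := hc ord0; rewrite unlift_none in h0.
  have h1 : Rabs (comb u c i0 * w i) <= t.
    rewrite Rabs_mult; have := w1 i; have := Rabs_pos (w i); have := Rabs_pos (comb u c i0); nra.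
  have h2 : Rabs (comb u' (fun j => c (lift ord0 j)) i) <= 3 ^ k * (2 * t).
    apply: hI1 => [|j]; first lra.
    have := hc (lift ord0 j); rewrite liftK dec => h3.
    have h4 : Rabs (comb u c i0 * w (I' j)) <= t.
      rewrite Rabs_mult; have := w1 (I' j); have := Rabs_pos (w (I' j));
        have := Rabs_pos (comb u c i0); nra.
    move: h3 h4; move: (comb u c i0 * _) (comb u' _ _) => p q h3 h4.
    by move: h3 h4; split_Rabs; lra.
  have h3 : 1 <= 3 ^ k by apply: pow_R1_Rle; lra.
  apply: Rle_trans (Rabs_triang _ _) _; rewrite /=; nra.
move=> t.
have [c' hc'] := hI2 (fun j => t (lift ord0 j) - t ord0 * w (I' j)).
pose s := \Sum_(l < k) (c' l * u (lift ord0 l) i0).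
pose c l := if unlift ord0 l is Some l' then c' l' else (t ord0 - s) / a.
have cS l : c (lift ord0 l) = c' l by rewrite /c liftK.
have E0 : comb u c i0 = t ord0.
  rewrite /comb big_ord_recl -/a; have -> : \Sum_(l < k) (c (lift ord0 l) * u (lift ord0 l) i0) = s.
    by apply: eq_bigr => l _; rewrite cS.
  by rewrite /c unlift_none; field.
exists c => j; case: (unliftP ord0 j) => [j' ->|->]; last by [].
rewrite dec E0; have -> : comb u' (fun l => c (lift ord0 l)) (I' j') = comb u' c' (I' j').
  by apply: eq_bigr => l _; rewrite cS.
by rewrite hc'; ring.
Qed.

(** Reducing the rows modulo one with nonzero column 0 gives vectors [u] spanning the directions of
    the plane, to which [pivot_coordinates] applies. The first clause cuts neighbourhoods of the
    plane into cells; the second places the children at prescribed positions on it. *)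
Lemma affine_coordinates n d x : RLinIndep n d x ->
  (exists i, (i <= d)%coq_nat /\ x i 0%N <> Z0) ->
  exists I : 'I_d -> 'I_n,
   (forall P P' t, AffOf n d x P -> AffOf n d x P' -> 0 <= t ->
      (forall j, Rabs (P (I j) - P' (I j)) <= t) ->
      forall i, (i < n)%N -> Rabs (P i - P' i) <= 3 ^ d * t) /\
   (forall P (t : 'I_d -> R), AffOf n d x P ->
      exists P', AffOf n d x P' /\ forall j, P' (I j) = P (I j) + t j).
Proof.
move=> /RLinIndepE fX /(col0_toM n) hx.
set X := toM n d x in fX hx.
have [s hs] : exists s, X s ord0 <> 0.
  apply: contrapT => hn; move/eqP: hx; apply; apply/matrixP=> i j; rewrite [LHS]mxE [RHS]mxE.
  by apply: contrapT => ne; apply: hn; exists i => h; apply: ne; rewrite h.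
pose u (j : 'I_d) (l : 'I_n) : R :=
  X (lift s j) (lift ord0 l) - X (lift s j) ord0 / X s ord0 * X s (lift ord0 l).
pose ext (c : 'I_d -> R) : 'rV[R]_d.+1 :=
  (\row_i if unlift s i is Some j then c j else
     - (\Sum_(j < d) (c j * X (lift s j) ord0)) / X s ord0)%R.
have mulE (v : 'rV[R]_d.+1) l : (v *m X)%R ord0 l =
    v ord0 s * X s l + \Sum_(j < d) (v ord0 (lift s j) * X (lift s j) l).
  by rewrite mxE (bigD1_ord s).
have ext0 c : (ext c *m X)%R ord0 ord0 = 0.
  rewrite mulE /ext mxE unlift_none.
  have -> : \Sum_(j < d) ((ext c) ord0 (lift s j) * X (lift s j) ord0) = \Sum_(j < d)
    (c j * X (lift s j) ord0).
    by apply: eq_bigr => j _; rewrite mxE liftK.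
  have aux (S y : R) : y <> 0 -> - S / y * y + S = 0 by move=> ?; field.
  exact: aux.
have comb0 (v : 'rV[R]_d.+1) : (v *m X)%R ord0 ord0 = 0 ->
    forall l, (v *m X)%R ord0 (lift ord0 l) = comb u (fun j => v ord0 (lift s j)) l.
  rewrite mulE => h l; rewrite mulE /comb.
  have -> : \Sum_(j < d) (v ord0 (lift s j) * u j l) =
    \Sum_(j < d) (v ord0 (lift s j) * X (lift s j) (lift ord0 l)) +
    (- (X s (lift ord0 l) / X s ord0)) * \Sum_(j < d) (v ord0 (lift s j) * X (lift s j) ord0).
    by rewrite -sum_scal -big_split /=; apply: eq_bigr => j _; rewrite /u; field.
  have -> : \Sum_(j < d) (v ord0 (lift s j) * X (lift s j) ord0) = - (v ord0 s * X s ord0) by lra.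
  have aux (A y z b : R) : z <> 0 -> b * y + A = A + - (y / z) * - (b * z) by move=> ?; field.
  exact: aux.
have extl c l : (ext c *m X)%R ord0 (lift ord0 l) = comb u c l.
  by rewrite comb0 //; apply: eq_bigr => j _; rewrite mxE liftK.
have [|I [hI1 hI2]] := @pivot_coordinates n d u.
  move=> c hc j.
  have /matrixP/(_ ord0 (lift s j)) : ext c = 0%R.
    apply: (row_free_inj fX); rewrite mul0mx; apply/matrixP=> a b; rewrite (ord1 a) [RHS]mxE.
    by case: (unliftP ord0 b) => [l ->|->]; rewrite ?ext0 // extl hc.
  by rewrite !mxE liftK.
exists I; split.
  move=> P P' t /AffOfE [_ [v [v0 vl]]] /AffOfE [_ [v' [v0' vl']]] t0 ht i hi.
  have E0 : ((v - v') *m X)%R ord0 ord0 = 0.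
    by rewrite mulmxBl [LHS]mxE [X in (_ + X)%R]mxE v0 v0'; exact: Rplus_opp_r.
  have E l : P (nat_of_ord l) - P' (nat_of_ord l) = comb u (fun j => (v - v')%R ord0 (lift s j)) l.
    by rewrite -comb0 // mulmxBl [RHS]mxE [X in (_ + X)%R]mxE vl vl'.
  rewrite -[i]/(nat_of_ord (Ordinal hi)) E; apply: hI1 => // j; rewrite -E; exact: ht.
move=> P t /AffOfE [vP [v [v0 vl]]].
have [c hc] := hI2 t.
exists (fun i => if ltnP i n is LtnNotGeq h then P i + comb u c (Ordinal h) else 0).
have hP (l : 'I_n) : (if ltnP l n is LtnNotGeq h then P l + comb u c (Ordinal h) else 0)
  = P l + comb u c l.
  case: ltnP => h; last by have := ltn_ord l; rewrite ltnNge h.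
  by congr (_ + comb u c _); apply: val_inj.
split; last by move=> j; rewrite hP hc.
apply/AffOfE; split.
  by move=> i /ssrnat.leP hi; case: ltnP => // h; move: hi; rewrite leqNgt h.
exists (v + ext c)%R; split; first by rewrite mulmxDl [LHS]mxE v0 ext0; exact: Rplus_0_r.
by move=> l; rewrite hP mulmxDl [LHS]mxE vl extl.
Qed.

(** * Summing over rational subspaces *)

Lemma Rpower_gt0 x e : 0 < Rpower x e.
Proof. exact: exp_pos. Qed.

Lemma Rpower_base_le e x y : 0 <= e -> 0 < x -> x <= y -> Rpower x e <= Rpower y e.
Proof. by move=> e0 x0 xy; apply: Rle_Rpower_l. Qed.

Lemma Rpower_base_ge e x y : 0 <= e -> 0 < x -> x <= y -> Rpower y (- e) <= Rpower x (- e).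
Proof.
move=> e0 x0 xy; rewrite !Rpower_Ropp; apply: Rinv_le_contravar; first exact: Rpower_gt0.
exact: Rpower_base_le.
Qed.

Lemma Rpower_expo_le x a b : 1 <= x -> a <= b -> Rpower x a <= Rpower x b.
Proof.
move=> x1 ab; have [x1'|<-] := Rle_lt_or_eq_dec _ _ x1; first exact: Rle_Rpower.
by rewrite /Rpower ln_1 !Rmult_0_r; lra.
Qed.

Lemma Rpower_1_base e : Rpower 1 e = 1.
Proof. by rewrite /Rpower ln_1 Rmult_0_r exp_0. Qed.

Lemma Rpower_prod k (f : 'I_k -> R) e : (forall i, 0 < f i) ->
  Rpower (\Prod_(i < k) f i) e = \Prod_(i < k) Rpower (f i) e.
Proof.
move=> hf; elim: k f hf => [|k IH] f hf; first by rewrite !big_ord0 Rpower_1_base.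
rewrite !big_ord_recr /= -Rpower_mult_distr ?IH //; exact: prod_gt0.
Qed.

Lemma prod_const k (c : R) : \Prod_(i < k) c = c ^ k.
Proof. by elim: k => [|k IH]; rewrite ?big_ord0 // big_ord_recr IH /= Rmult_comm. Qed.

(** The right side is the integral of $x^{-1-\varepsilon}$ over $[m+1, m+2]$. The comparison follows
    from $1 + y \le e^y$, used once to bound $\ln((x-1)/x)$ by $-1/x$ and once more on the resulting
    power. *)
Lemma zeta_step eps (m : nat) : 0 < eps ->
  Rpower (INR m.+2) (- (1 + eps)) <= / eps * (Rpower (INR m.+1) (- eps) - Rpower (INR m.+2)
    (- eps)).
Proof.
move=> e0; set x := INR m.+2.
have x1 : INR m.+1 = x - 1 by rewrite /x [INR m.+2]S_INR; ring.
have m1 : 0 < INR m.+1 by apply: lt_0_INR; apply/ssrnat.ltP.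
have x0 : 0 < x by lra.
rewrite x1.
have -> : - (1 + eps) = - eps + - 1 by ring.
rewrite Rpower_plus [Rpower x (- 1)]Rpower_Ropp Rpower_1 //.
have -> : Rpower (x - 1) (- eps) = Rpower x (- eps) * Rpower ((x - 1) / x) (- eps).
  rewrite Rpower_mult_distr //; first by congr (Rpower _ _); field; lra.
  by apply: Rdiv_lt_0_compat; lra.
suff h : 1 + eps / x <= Rpower ((x - 1) / x) (- eps).
  have hx := Rpower_gt0 x (- eps).
  apply: (Rmult_le_reg_l eps) => //.
  rewrite -[X in _ <= X]Rmult_assoc Rinv_r ?Rmult_1_l; last lra.
  have -> : eps * (Rpower x (- eps) * / x) = Rpower x (- eps) * (eps / x) by field; lra.
  by nra.
rewrite /Rpower.
have hl : ln ((x - 1) / x) <= - / x.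
  have h := exp_ineq1_le (- / x).
  have E : (x - 1) / x = 1 + - / x by field; lra.
  apply: Rnot_lt_le => /exp_increasing; rewrite exp_ln; first lra.
  by apply: Rdiv_lt_0_compat; lra.
apply: Rle_trans (exp_ineq1_le _).
by apply: Rplus_le_compat_l; rewrite /Rdiv; nra.
Qed.

(** The [Rmax] gives a zero entry the weight of an entry of modulus 1, in accordance with [rmax]. *)
Definition decay eps (m : R) : R := Rpower (Rmax 1 m) (- (1 + eps)).

Lemma zeta_bound eps M : 0 < eps -> \Sum_(m < M) decay eps (INR m) <= 2 + / eps.
Proof.
move=> e0.
have ie : 0 < / eps by apply: Rinv_0_lt_compat.
have h k : \Sum_(m < k.+2) decay eps (INR m) <= 2 + / eps * (1 - Rpower (INR k.+1) (- eps)).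
  elim: k => [|k IH].
    rewrite !big_ord_recr big_ord0 /decay /= !(Rmax_left 1) ?Rpower_1_base; lra.
  have -> : \Sum_(m < k.+3) decay eps (INR m) = \Sum_(m < k.+2) decay eps (INR m)
    + decay eps (INR k.+2).
    by rewrite big_ord_recr.
  apply: Rle_trans (Rplus_le_compat_r _ _ _ IH) _.
  have h1 : 1 <= INR k.+2 by rewrite S_INR; have := pos_INR k.+1; lra.
  rewrite {1}/decay Rmax_right; last exact: h1.
  by have := zeta_step k e0; lra.
have hpos m : 0 <= decay eps m by apply/Rlt_le/Rpower_gt0.
have h2 k : \Sum_(m < k.+2) decay eps (INR m) <= 2 + / eps.
  by apply: Rle_trans (h k) _; have := Rpower_gt0 (INR k.+1) (- eps); nra.
apply: Rle_trans (h2 M).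
have -> : \Sum_(m < M.+2) decay eps (INR m) = \Sum_(m < M) decay eps (INR m) + decay eps (INR M)
  + decay eps (INR M.+1).
  by rewrite 2!big_ord_recr.
by have := hpos (INR M); have := hpos (INR M.+1); lra.
Qed.

(* A sign and an absolute value; 0 has two codes, which is harmless for upper bounds. *)
Definition zval M (p : 'I_M * bool) : Z := if p.2 then Z.of_nat p.1 else Z.opp (Z.of_nat p.1).

Definition intmx n d M := {ffun 'I_d.+1 * 'I_n.+1 -> 'I_M.+1 * bool}.

Definition zmx n d M (g : intmx n d M) : nat -> nat -> Z :=
  fun i l => zval (g (inord i, inord l)).

Lemma zmx_exists n d M x : (forall i l, (i <= d)%N -> (l <= n)%N -> Rabs (IZR (x i l)) <= INR M) ->
  exists g : intmx n d M, forall i l, (i <= d)%N -> (l <= n)%N -> zmx g i l = x i l.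
Proof.
move=> h.
exists [ffun p : 'I_d.+1 * 'I_n.+1 => (inord (Z.to_nat (Z.abs (x p.1 p.2))), Z.leb Z0 (x p.1 p.2))].
move=> i l hi hl; rewrite /zmx ffunE /= !inordK // /zval /=.
have hM : Z.le (Z.abs (x i l)) (Z.of_nat M).
  by have := h i l hi hl; rewrite -abs_IZR INR_IZR_INZ; apply: le_IZR.
rewrite inordK; first by case: Z.leb_spec => h2; rewrite Z2Nat.id; lia.
by lia.
Qed.

Lemma toM_ext n d x y : (forall i l, (i <= d)%N -> (l <= n)%N -> x i l = y i l) ->
  toM n d x = toM n d y.
Proof. by move=> h; apply/matrixP=> i l; rewrite !mxE h // -ltnS. Qed.

Lemma rowprod_ext n d x y : (forall i l, (i <= d)%N -> (l <= n)%N -> x i l = y i l) ->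
  rowprod n d x = rowprod n d y.
Proof.
by move=> h; apply: eq_bigr => i _; apply: eq_bigr => l _; rewrite h // -ltnS.
Qed.

Lemma AffOf_ext n d x y P : toM n d x = toM n d y -> AffOf n d x P <-> AffOf n d y P.
Proof. by move=> E; split; apply: (@AffOf_mul _ _ _ _ 1%:M%R); rewrite mul1mx. Qed.

(** The exponent is shared equally among the $n+1$ entries, each of which is at most the maximum.
    The sum over all rows thereby becomes a product of sums over single entries. *)
Lemma rmax_decay eps n x i : 0 < eps ->
  Rpower (rmax n x i) (- (INR n.+1 * (1 + eps))) <= \Prod_(l < n.+1) decay eps (Rabs (IZR (x i l))).
Proof.
move=> e0.
have -> : - (INR n.+1 * (1 + eps)) = - (1 + eps) * INR n.+1 by ring.
rewrite -Rpower_mult Rpower_pow; last exact: Rpower_gt0.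
rewrite -prod_const; apply: prod_le => l; split; first exact/Rlt_le/Rpower_gt0.
apply: Rpower_base_ge; first lra.
  by apply: Rlt_le_trans (Rmax_l _ _); lra.
apply: Rmax_lub; first exact: rmax_ge1.
by apply: rmax_ge; rewrite -ltnS.
Qed.

(* Rankin: [N^(- tau) <= Y^(p - tau) N^(- p)] when [N <= Y], and the sum of [N^(- p)] factors over
   the entries of the matrix. *)
Lemma rowprod_sum n d eps tau : 0 < eps -> tau <= INR n.+1 * (1 + eps) ->
  exists Z, 0 < Z /\ forall M Y, 1 <= Y ->
   \big[Rplus/0]_(g : intmx n d M | `[< rowprod n d (zmx g) <= Y >]) Rpower (rowprod n d (zmx g))
     (- tau)
    <= Z * Rpower Y (INR n.+1 * (1 + eps) - tau).
Proof.
move=> e0; set p := INR n.+1 * (1 + eps) => hp.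
pose Z1 := 2 * (2 + / eps).
have ie : 0 < / eps by apply: Rinv_0_lt_compat.
exists (Z1 ^ #|{: 'I_d.+1 * 'I_n.+1}|); split; first by apply: pow_lt; rewrite /Z1; lra.
move=> M Y Y1.
have YY := Rpower_gt0 Y (p - tau).
pose F (v : 'I_M.+1 * bool) := decay eps (INR v.1).
have F0 v : 0 < F v by apply: Rpower_gt0.
have hF : \big[Rplus/0]_v F v <= Z1.
  have -> : \big[Rplus/0]_v F v = \Sum_(m < M.+1) (decay eps (INR m) + decay eps (INR m)).
    rewrite -(pair_bigA _ (fun (m : 'I_M.+1) (b : bool) => decay eps (INR m))) /=.
    by apply: eq_bigr => m _; rewrite big_bool.
  rewrite big_split /=; have h := zeta_bound M.+1 e0.
  by apply: Rle_trans (Rplus_le_compat _ _ _ _ h h) _; rewrite /Z1; lra.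
have key g : rowprod n d (zmx g) <= Y -> Rpower (rowprod n d (zmx g)) (- tau) <=
    Rpower Y (p - tau) * \big[Rmult/1]_(q : 'I_d.+1 * 'I_n.+1) F (g q).
  move=> hY; set N := rowprod n d (zmx g) in hY *.
  have N1 : 1 <= N by apply: rowprod_ge1.
  have -> : - tau = (p - tau) + (- p) by ring.
  rewrite Rpower_plus; apply: Rmult_le_compat; try exact/Rlt_le/Rpower_gt0.
    by apply: Rpower_base_le; lra.
  rewrite /N /rowprod Rpower_prod; last by move=> i; have := rmax_ge1 n (zmx g) i; lra.
  have -> : \big[Rmult/1]_(q : 'I_d.+1 * 'I_n.+1) F (g q) = \Prod_(i < d.+1) \Prod_(l < n.+1)
    F (g (i, l)).
    by rewrite pair_bigA; apply: eq_bigr => -[].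
  apply: prod_le => i; split; first exact/Rlt_le/Rpower_gt0.
  apply: Rle_trans (rmax_decay _ _ _ e0) _; apply: Req_le; apply: eq_bigr => l _.
  rewrite /zmx !inord_val /F /zval; congr (decay _ _).
  by case: (g (i, l)) => m [] /=; rewrite ?opp_IZR ?Rabs_Ropp -INR_IZR_INZ Rabs_pos_eq //;
    apply: pos_INR.
apply: Rle_trans (_ : \big[Rplus/0]_(g : intmx n d M) (Rpower Y (p - tau)
  * \big[Rmult/1]_(q : 'I_d.+1 * 'I_n.+1) F (g q)) <= _).
  rewrite big_mkcond /=; elim/big_ind2: _ => [|a b a' b' h1 h2|g _]; [lra | lra |].
  case: asboolP => hg; first exact: key.
  apply: Rmult_le_pos; first exact: Rlt_le.
  by elim/big_ind: _ => [|u v hu hv|q _]; [lra | nra | exact: Rlt_le].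
rewrite -big_distrr /= Rmult_comm; apply: Rmult_le_compat_r; first exact: Rlt_le.
rewrite -(bigA_distr_bigA (fun q v => F v)) /=.
have iterE k x : iter k (Rmult x) 1 = x ^ k by elim: k => //= k ->.
rewrite big_const iterE; apply: pow_incr; split=> //.
by elim/big_ind: _ => [|a b h1 h2|i _]; [lra | lra | exact: Rlt_le].
Qed.

(** * Null sets *)

Lemma sum_if_eq_le N (m : nat) (a : R) : 0 <= a ->
  \Sum_(j < N) (if m == j :> nat then a else 0) <= a.
Proof.
move=> a0; have [h|h] := ltnP m N.
  rewrite (bigD1 (Ordinal h)) //= eqxx big1 => [|j /negbTE hj]; first lra.
  by rewrite eq_sym; have -> : (nat_of_ord j == m) = false by rewrite -[m]/(nat_of_ord (Ordinal h)).
rewrite big1 => [|j _]; first lra.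
by case: eqP => // E; move: (ltn_ord j); rewrite -E ltnNge h.
Qed.

Lemma geometric_sum N : \Sum_(j < N) (/ 2) ^ j.+1 <= 1.
Proof.
have -> : \Sum_(j < N) (/ 2) ^ j.+1 = 1 - (/ 2) ^ N.
  elim: N => [|N IH]; first by rewrite big_ord0 /=; lra.
  by rewrite big_ord_recr IH /=; field.
by have := pow_lt (/ 2) N; lra.
Qed.

Definition diam_le n (U : (nat -> R) -> Prop) (r : R) :=
  forall x y, U x -> U y -> euclid n x y <= r.

(** Pairs are enumerated by [pickle_inv]. Since [HNull] wants a positive radius at every index, an
    index that codes no valid pair receives the empty set with a radius so small that all such
    indices together cost at most [eps / 4]. *)
Lemma HNull_pairs n s (E : (nat -> R) -> Prop) : 0 < s ->
  (forall delta eps, 0 < delta -> 0 < eps ->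
    exists (V : nat -> nat -> bool) (U : nat -> nat -> (nat -> R) -> Prop) (r : nat -> nat -> R),
     (forall k i, V k i -> 0 < r k i <= delta /\ diam_le n (U k i) (r k i)) /\
     (forall x, E x -> exists k i, V k i /\ U k i x) /\
     forall K, \Sum_(k < K) \Sum_(i < K) (if V k i then Rpower (r k i) s else 0) <= eps) ->
  HNull n s E.
Proof.
move=> s0 h delta eps d0 e0.
have e4 : 0 < eps / 4 by lra.
have [V [U [r [hr [hE hs]]]]] := h delta (eps / 4) d0 e4.
pose dec j := @pickle_inv (nat * nat)%type j.
pose ok j := if dec j is Some p then V p.1 p.2 else false.
pose dummy j := Rmin delta (Rpower (eps / 4 * (/ 2) ^ j.+1) (/ s)).
have i2 k : 0 < (/ 2) ^ k by apply: pow_lt; lra.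
have dummy0 j : 0 < dummy j <= delta.
  split; last exact: Rmin_l.
  by apply: Rmin_glb_lt => //; apply: Rpower_gt0.
have dummys j : Rpower (dummy j) s <= eps / 4 * (/ 2) ^ j.+1.
  apply: Rle_trans (_ : Rpower (Rpower (eps / 4 * (/ 2) ^ j.+1) (/ s)) s <= _).
    apply: Rpower_base_le; [lra | by case: (dummy0 j) | exact: Rmin_r].
  rewrite Rpower_mult Rinv_l ?Rpower_1; try lra.
  exact: Rmult_lt_0_compat.
pose R0 j := if dec j is Some p then (if V p.1 p.2 then r p.1 p.2 else dummy j) else dummy j.
exists (fun j => if dec j is Some p then (if V p.1 p.2 then U p.1 p.2 else fun=> False)
  else fun=> False), R0.
split.
  move=> j; rewrite /R0; case: (dec j) => [[k i]|]; last exact: dummy0.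
  by case: ifP => hV; [case: (hr _ _ hV) | apply: dummy0].
split.
  move=> j x y; rewrite /R0; case: (dec j) => [[k i]|] //.
  by case: ifP => // hV; case: (hr _ _ hV) => _; apply.
split.
  move=> x /hE [k [i [hV hU]]]; exists (pickle (k, i)).
  by rewrite /dec pickleK_inv hV.
exists (eps / 2); split; first lra.
move=> N; rewrite sumR_big.
pose f j := if dec j is Some p then (if V p.1 p.2 then Rpower (r p.1 p.2) s else 0) else 0.
apply: Rle_trans (_ : \Sum_(j < N) (f j + eps / 4 * (/ 2) ^ j.+1) <= _).
  apply: sum_le => j; rewrite /R0 /f.
  have := dummys j; have : 0 < eps / 4 * (/ 2) ^ j.+1 by apply: Rmult_lt_0_compat.
  move: (eps / 4 * (/ 2) ^ j.+1) => y h1 h2.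
  case: (dec j) => [[k i]|]; last by lra.
  by case: ifP => _; lra.
rewrite big_split /= sum_scal.
suff hf : \Sum_(j < N) f j <= eps / 4.
  have h1 : eps / 4 * \Sum_(j < N) (/ 2) ^ j.+1 <= eps / 4 * 1.
    by apply: Rmult_le_compat_l; [lra | apply: geometric_sum].
  by apply: Rle_trans (Rplus_le_compat _ _ _ _ hf h1) _; lra.
pose co j := if dec j is Some p then maxn p.1 p.2 else 0%N.
pose K := (\max_(j < N) co j).+1.
apply: Rle_trans (hs K).
rewrite pair_bigA /=.
pose g (p : 'I_K * 'I_K) := if V p.1 p.2 then Rpower (r p.1 p.2) s else 0.
have g0 p : 0 <= g p by rewrite /g; case: ifP => _; [apply/Rlt_le/Rpower_gt0 | lra].
apply: Rle_trans (_ : \Sum_(j < N) \big[Rplus/0]_(p : 'I_K * 'I_K)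
     (if pickle (nat_of_ord p.1, nat_of_ord p.2) == j :> nat then g p else 0) <= _).
  apply: sum_le => j; rewrite /f.
  case E1: (dec j) => [[k i]|] /=; last first.
    by elim/big_ind: _ => [|u v hu hv|p _]; [lra | lra |]; case: ifP => _; [apply: g0 | lra].
  have hj : pickle (k, i) = j by have := @pickle_invK (nat * nat)%type j; rewrite -/(dec j) E1.
  have hm : (maxn k i < K)%N.
    rewrite ltnS; have := @leq_bigmax _ (fun j : 'I_N => co j) j; rewrite /co E1; exact.
  have hk : (k < K)%N by apply: leq_ltn_trans hm; apply: leq_maxl.
  have hi : (i < K)%N by apply: leq_ltn_trans hm; apply: leq_maxr.
  rewrite (bigD1 (Ordinal hk, Ordinal hi)) //= hj eqxx /g /=.
  set S := \big[_/_]_(p | _) _; suff : 0 <= S by lra.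
  by rewrite /S; elim/big_ind: _ => [|u v hu hv|p _]; [lra | lra |]; case: ifP => _;
    [apply: g0 | lra].
rewrite exchange_big /=.
elim/big_ind2: _ => [|a b a' b' h1 h2|p _]; [lra | lra | exact: sum_if_eq_le].
Qed.

Lemma sum_trunc K m (g : nat -> R) : (forall i, 0 <= g i) ->
  \Sum_(i < K) (if (i < m)%N then g i else 0) <= \Sum_(i < m) g i.
Proof.
move=> g0; pose h i := if (i < m)%N then g i else 0.
have h0 i : 0 <= h i by rewrite /h; case: ifP => // _; lra.
apply: Rle_trans (_ : \Sum_(i < m + K) h i <= _).
  rewrite addnC big_split_ord /=.
  rewrite -[X in X <= _]Rplus_0_r; apply: Rplus_le_compat_l.
  by apply: sum_ge0 => i; apply: h0.
rewrite big_split_ord /= [X in _ + X]big1 => [|i _]; last by rewrite /h ltnNge leq_addr.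
by rewrite Rplus_0_r; apply: Req_le; apply: eq_bigr => i _; rewrite /h ltn_ord.
Qed.

(** This is the shape in which the cover of the upper bound arises: for each dyadic range of
    heights, a finite type of planes with cells, filtered by [V]. *)
Lemma HNull_fin n s (E : (nat -> R) -> Prop) : 0 < s ->
  (forall delta eps, 0 < delta -> 0 < eps ->
    exists (T : nat -> finType) (V : forall k, T k -> bool) (U : forall k, T k -> (nat -> R)
      -> Prop)
      (r : forall k, T k -> R),
     (forall k t, V k t -> 0 < r k t <= delta /\ diam_le n (U k t) (r k t)) /\
     (forall x, E x -> exists k t, V k t /\ U k t x) /\
     forall K, \Sum_(k < K) \big[Rplus/0]_(t : T k | V k t) Rpower (r k t) s <= eps) ->
  HNull n s E.
Proof.
move=> s0 h; apply: HNull_pairs => // delta eps d0 e0.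
have [T [V [U [r [hr [hE hs]]]]]] := h delta eps d0 e0.
pose r' k i := if ltnP i #|T k| is LtnNotGeq hi then r k (enum_val (Ordinal hi)) else 1.
pose V' k i := if ltnP i #|T k| is LtnNotGeq hi then V k (enum_val (Ordinal hi)) else false.
have hr' k (i : 'I_#|T k|) : r' k i = r k (enum_val i).
  rewrite /r'; case: ltnP => hi; last by have := ltn_ord i; rewrite ltnNge hi.
  by congr (r k (enum_val _)); apply: val_inj.
have hV' k (i : 'I_#|T k|) : V' k i = V k (enum_val i).
  rewrite /V'; case: ltnP => hi; last by have := ltn_ord i; rewrite ltnNge hi.
  by congr (V k (enum_val _)); apply: val_inj.
have V'P k i : V' k i -> (i < #|T k|)%N by rewrite /V'; case: ltnP.
exists V', (fun k i x => exists hi : (i < #|T k|)%N, U k (enum_val (Ordinal hi)) x), r'.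
split.
  move=> k i hVi; have hi := V'P _ _ hVi.
  move: hVi; rewrite (hV' k (Ordinal hi)) (hr' k (Ordinal hi)) => /hr [h1 h2]; split=> //.
  move=> x y [hx Ux] [hy Uy]; apply: h2.
    by rewrite (bool_irrelevance hi hx).
  by rewrite (bool_irrelevance hi hy).
split.
  move=> x /hE [k [t [Vt ht]]]; exists k, (enum_rank t); rewrite hV' enum_rankK; split=> //.
  exists (ltn_ord (enum_rank t)).
  have -> : Ordinal (ltn_ord (enum_rank t)) = enum_rank t by apply: val_inj.
  by rewrite enum_rankK.
move=> K; apply: Rle_trans (hs K); apply: sum_le => k.
pose g i := if V' k i then Rpower (r' k i) s else 0.
have -> : \Sum_(i < K) (if V' k i then Rpower (r' k i) s else 0) = \Sum_(i < K)
  (if (i < #|T k|)%N then g i else 0).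
  by apply: eq_bigr => i _; rewrite /g; case E1: (V' k i); [rewrite (V'P _ _ E1) | case: ifP].
apply: Rle_trans (sum_trunc _ _ _) _.
  by move=> i; rewrite /g; case: ifP => _; [apply/Rlt_le/Rpower_gt0 | lra].
rewrite [X in _ <= X]big_mkcond [X in _ <= X](reindex_onto enum_val enum_rank) /=; last by move=>
  t _; rewrite enum_rankK.
by apply: Req_le; apply: eq_big => [i|i _]; rewrite ?enum_valK ?eqxx // /g hr' hV'.
Qed.

Lemma HNull_sub n s (E F : (nat -> R) -> Prop) : (forall x, E x -> F x)
  -> HNull n s F -> HNull n s E.
Proof.
move=> EF h delta eps d0 e0; have [U [r [h1 [h2 [h3 h4]]]]] := h delta eps d0 e0.
by exists U, r; do 2!split=> //; split=> // x /EF; apply: h3.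
Qed.

(** The mesh may be taken at most 1, and there $r^t \le r^s$. *)
Lemma HNull_le n s t (E : (nat -> R) -> Prop) : s <= t -> HNull n s E -> HNull n t E.
Proof.
move=> st h delta eps d0 e0.
have d1 : 0 < Rmin delta 1 by apply: Rmin_glb_lt; lra.
have [U [r [h1 [h2 [h3 [B [hB h4]]]]]]] := h _ eps d1 e0.
exists U, r; split.
  by move=> k; have := h1 k; have := Rmin_l delta 1; lra.
do 2!split=> //; exists B; split=> // N; apply: Rle_trans (h4 N).
rewrite !sumR_big; apply: sum_le => k.
have := h1 k; have := Rmin_r delta 1 => m1 [r0 r1].
have -> : r k = / / r k by rewrite Rinv_inv.
have i1 : 1 <= / r k by rewrite -Rinv_1; apply: Rinv_le_contravar; lra.
rewrite /Rpower ln_Rinv; last by apply: Rinv_0_lt_compat.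
have l0 : 0 <= ln (/ r k) by rewrite -ln_1; have [e|e] := Rle_lt_or_eq_dec _ _ i1; [left;
  apply: ln_increasing; lra | rewrite -e; lra].
have : t * - ln (/ r k) <= s * - ln (/ r k) by nra.
by case=> [/exp_increasing|->]; lra.
Qed.

Lemma HNull_union n s (E : nat -> (nat -> R) -> Prop) : 0 < s ->
  (forall m, HNull n s (E m)) -> HNull n s (fun x => exists m, E m x).
Proof.
move=> s0 h; apply: HNull_pairs => // delta eps d0 e0.
have i2 k : 0 < (/ 2) ^ k by apply: pow_lt; lra.
have /choice [U] : forall m, exists U : nat -> (nat -> R) -> Prop, exists r : nat -> R,
   (forall k, 0 < r k <= delta) /\ (forall k, diam_le n (U k) (r k)) /\
   (forall x, E m x -> exists k, U k x) /\ forall N, sumR N (fun k => Rpower (r k) s)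
     <= eps * (/ 2) ^ m.+1.
  move=> m; have em : 0 < eps * (/ 2) ^ m.+1 by apply: Rmult_lt_0_compat.
  have [U [r [h1 [h2 [h3 [B [hB h4]]]]]]] := h m _ _ d0 em.
  exists U, r; do 3!split=> //; move=> N; have := h4 N; lra.
move=> /choice [r hr].
exists (fun _ _ => true), U, r; split.
  by move=> k i _; case: (hr k) => h1 [h2 _]; split; [apply: h1 | apply: h2].
split.
  by move=> x [m Em]; case: (hr m) => _ [_ [h3 _]]; have [i hi] := h3 x Em; exists m, i.
move=> K; apply: Rle_trans (_ : \Sum_(k < K) (eps * (/ 2) ^ k.+1) <= _).
  by apply: sum_le => k; case: (hr k) => _ [_ [_ h4]]; have := h4 K; rewrite sumR_big.
by rewrite sum_scal; have := geometric_sum K; nra.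
Qed.

(** * Covering neighbourhoods of thin sets *)

Definition nfloor (y : R) : nat := Z.to_nat (Int_part y).

Lemma nfloorP y : 0 <= y -> INR (nfloor y) <= y < INR (nfloor y) + 1.
Proof.
move=> y0; have [h1 h2] := base_Int_part y.
have hz : Z.le Z0 (Int_part y).
  have h3 : IZR (-1) < IZR (Int_part y) by lra.
  by have := lt_IZR _ _ h3; lia.
by rewrite /nfloor INR_IZR_INZ Z2Nat.id //; lra.
Qed.

Lemma nfloor_le x y : 0 <= x -> x <= y -> (nfloor x <= nfloor y)%N.
Proof.
move=> x0 xy; have [h1 h2] := nfloorP x0.
have [h3 h4] := nfloorP (Rle_trans _ _ _ x0 xy).
by rewrite -ltnS; apply/ssrnat.ltP; apply: INR_lt; rewrite S_INR; lra.
Qed.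

Definition cube n (c : nat -> R) (M : R) (x : nat -> R) : Prop :=
  VecN n x /\ forall i, (i < n)%N -> Rabs (x i - c i) <= M.

Definition near n (L : (nat -> R) -> Prop) (r : R) (x : nat -> R) : Prop :=
  exists P, L P /\ forall i, (i < n)%N -> Rabs (x i - P i) <= r.

(* [I] parametrizes [L], with Lipschitz inverse, by [d] of the [n] coordinates. *)
Definition thin n d (C : R) (L : (nat -> R) -> Prop) (I : 'I_d -> 'I_n) : Prop :=
  forall P P' t, L P -> L P' -> 0 <= t -> (forall j, Rabs (P (I j) - P' (I j)) <= t) ->
    forall i, (i < n)%N -> Rabs (P i - P' i) <= C * t.

(** Records which cell of side [r] contains the coordinates of [x] selected by [I]. For [x] in the
    cube the quotients lie between 0 and [2 * M / r], so [inord] does not alter the index. *)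
Definition cellkey n d (I : 'I_d -> 'I_n) (c : nat -> R) (M r : R) (x : nat -> R) :
  {ffun 'I_d -> 'I_(nfloor (2 * M / r)).+1} :=
  [ffun j => inord (nfloor ((x (I j) - c (I j) + M) / r))].

(** In the selected coordinates [x] and [y] differ by at most [r], hence their companions in [L] by
    at most [3 * r]. Thinness carries this to all coordinates at the price of [C], and returning to
    [x] and [y] adds [2 * r]. *)
Lemma cell_diam n d C L (I : 'I_d -> 'I_n) c M r x y :
  thin C L I -> 0 < r -> cube n c M x -> cube n c M y -> near n L r x -> near n L r y ->
  cellkey I c M r x = cellkey I c M r y ->
  forall i, (i < n)%N -> Rabs (x i - y i) <= (3 * C + 2) * r.
Proof.
move=> hI r0 [_ cx] [_ cy] [P [LP hP]] [P' [LP' hP']] /ffunP hkey.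
have hc j : Rabs (x (I j) - y (I j)) <= r.
  have := hkey j; rewrite !ffunE => /(congr1 val) /=.
  have b z : Rabs (z - c (I j)) <= M -> 0 <= (z - c (I j) + M) / r /\
     (nfloor ((z - c (I j) + M) / r) < (nfloor (2 * M / r)).+1)%N.
    move=> hz; have hz2 : 0 <= z - c (I j) + M <= 2 * M by split_Rabs; lra.
    have ir : 0 < / r by apply: Rinv_0_lt_compat.
    have h0 : 0 <= (z - c (I j) + M) / r by apply: Rmult_le_pos; lra.
    split=> //; rewrite ltnS; apply: nfloor_le => //.
    by apply: Rmult_le_compat_r; lra.
  have [x0 xk] := b _ (cx _ (ltn_ord (I j))); have [y0 yk] := b _ (cy _ (ltn_ord (I j))).
  rewrite !inordK // => E.
  have [h1 h2] := nfloorP x0; have [h3 h4] := nfloorP y0; rewrite E in h1 h2.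
  have h5 : Rabs ((x (I j) - c (I j) + M) / r - (y (I j) - c (I j) + M) / r) <= 1 by split_Rabs;
    lra.
  have -> : x (I j) - y (I j) = ((x (I j) - c (I j) + M) / r - (y (I j) - c (I j) + M) / r)
    * r by field; lra.
  by rewrite Rabs_mult (Rabs_pos_eq r); [nra | lra].
move=> i hi.
have h : Rabs (P i - P' i) <= C * (3 * r).
  apply: hI => // [|j]; first lra.
  have := hP _ (ltn_ord (I j)); have := hP' _ (ltn_ord (I j)); have := hc j.
  by split_Rabs; lra.
by have := hP i hi; have := hP' i hi; split_Rabs; lra.
Qed.

Lemma euclid_le n x y t : 0 <= t -> (forall i, (i < n)%N -> Rabs (x i - y i) <= t) ->
  euclid n x y <= INR n * t.
Proof.
move=> t0 h; rewrite /euclid sumR_big.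
have nn := pos_INR n.
apply: Rle_trans (_ : sqrt ((INR n * t) ^ 2) <= _); last by rewrite sqrt_pow2; [lra | nra].
apply: sqrt_le_1_alt; apply: Rle_trans (_ : INR n * t ^ 2 <= _).
  rewrite -sum_const; apply: sum_le => i; rewrite -pow2_abs; apply: pow_incr.
  by split; [apply: Rabs_pos | apply: h].
rewrite Rpow_mult_distr; apply: Rmult_le_compat_r; first exact: pow2_ge_0.
have [n0|n1] : INR n = 0 \/ 1 <= INR n.
    by case: (n) => [|k]; [left | right; rewrite S_INR; have := pos_INR k; lra].
  by rewrite n0 /=; lra.
by rewrite /=; nra.
Qed.

Lemma coord_le_euclid n x y i : (i < n)%N -> Rabs (x i - y i) <= euclid n x y.
Proof.
move=> hi; rewrite /euclid sumR_big -(sqrt_pow2 (Rabs _)); last exact: Rabs_pos.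
apply: sqrt_le_1_alt; rewrite pow2_abs.
apply: (sum_ge_term (f := fun i : 'I_n => (x i - y i) ^ 2) (Ordinal hi)) => j.
exact: pow2_ge_0.
Qed.

Lemma plane_thin n d : (d < n)%N -> exists I : (nat -> nat -> Z) -> 'I_d -> 'I_n,
  forall x, RLinIndep n d x -> (exists i, (i <= d)%coq_nat /\ x i 0%N <> Z0) ->
  thin (3 ^ d) (AffOf n d x) (I x).
Proof.
move=> hd; have i0 : 'I_n by exists d.
suff /choice [I hI] : forall x, exists I : 'I_d -> 'I_n, RLinIndep n d x ->
    (exists i, (i <= d)%coq_nat /\ x i 0%N <> Z0) -> thin (3 ^ d) (AffOf n d x) I by exists I.
move=> x.
have [h1|h1] := pselect (RLinIndep n d x /\ (exists i, (i <= d)%coq_nat /\ x i 0%N <> Z0));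
  last first.
  by exists (fun _ => i0) => a b; case: h1.
have [I [hI _]] := affine_coordinates (proj1 h1) (proj2 h1).
by exists I.
Qed.

Lemma floor_log2 H : 1 <= H -> exists k : nat, 2 ^ k <= H < 2 ^ k.+1.
Proof.
move=> H1.
have [N hN] : exists N : nat, H < 2 ^ N.
  have [N h] := Pow_x_infinity 2 (ltac:(rewrite Rabs_pos_eq; lra)) (H + 1).
  exists N; have := h N (le_n N); rewrite Rabs_pos_eq; first lra.
  by apply: pow_le; lra.
elim: N hN => [|N IH] hN; first by move: hN; rewrite /=; lra.
have [h|h] := Rlt_le_dec H (2 ^ N); first exact: IH.
by exists N.
Qed.

Lemma geometric_tail q C eps : 0 <= q < 1 -> 0 <= C -> 0 < eps ->
  exists k0 : nat, forall K, \Sum_(k < K) (C * q ^ (k0 + k)) <= eps.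
Proof.
move=> [q0 q1] C0 e0.
have hs K : \Sum_(k < K) (q ^ k) <= / (1 - q).
  have : (1 - q) * \Sum_(k < K) (q ^ k) = 1 - q ^ K.
    elim: K => [|K IH]; first by rewrite big_ord0 /=; ring.
    by rewrite big_ord_recr /= Rmult_plus_distr_l IH; ring.
  move=> E; apply: (Rmult_le_reg_l (1 - q)); first lra.
  by rewrite E Rinv_r; [have := pow_le q K q0; lra | lra].
have i1 : 0 < / (1 - q) by apply: Rinv_0_lt_compat; lra.
pose b := eps / (C * / (1 - q) + 1).
have d0 : 0 < C * / (1 - q) + 1 by nra.
have b0 : 0 < b by apply: Rdiv_lt_0_compat.
have [k0 hk] := pow_lt_1_zero q (ltac:(rewrite Rabs_pos_eq; lra)) b b0.
exists k0 => K.
have -> : \Sum_(k < K) (C * q ^ (k0 + k)) = C * q ^ k0 * \Sum_(k < K) (q ^ k).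
  by rewrite -sum_scal; apply: eq_bigr => k _; rewrite pow_add; ring.
have h1 := hk k0 (le_n k0); rewrite Rabs_pos_eq in h1; last exact: pow_le.
have qk := pow_le q k0 q0.
apply: Rle_trans (_ : (C * / (1 - q)) * b <= _).
  have -> : C * / (1 - q) * b = C * b * / (1 - q) by ring.
  apply: Rmult_le_compat => //; first nra.
    by apply: sum_ge0 => k; apply: pow_le.
  by nra.
have -> : eps = b * (C * / (1 - q) + 1) by rewrite /b; field; lra.
by nra.
Qed.

(** * The upper bound *)

Lemma INR_expn (a b : nat) : INR (a ^ b)%N = INR a ^ b.
Proof. by elim: b => [|b IH] //; rewrite expnS mult_INR IH. Qed.

Lemma Rpower_powl x k e : 0 < x -> Rpower (x ^ k) e = Rpower x e ^ k.
Proof.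
move=> x0; rewrite -Rpower_pow // Rpower_mult -Rpower_pow; last exact: Rpower_gt0.
by rewrite Rpower_mult Rmult_comm.
Qed.

Lemma Rpower_inv x e : 0 < x -> Rpower (/ x) e = Rpower x (- e).
Proof. by move=> x0; rewrite /Rpower ln_Rinv //; congr exp; ring. Qed.

Lemma Rpower_lt1 x e : 1 < x -> e < 0 -> Rpower x e < 1.
Proof. by move=> x1 e0; rewrite -(Rpower_O x); [apply: Rpower_lt | lra]. Qed.

Lemma dist_attained n d theta x delta eta : distAff n d theta x delta -> 0 < eta ->
  exists P, AffOf n d x P /\ euclid n theta P <= delta + eta.
Proof.
move=> [h1 h2] e0; apply: contrapT => hn.
suff : delta + eta <= delta by lra.
apply: h2 => a [P [hP ->]]; apply: Rnot_lt_le => h; apply: hn.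
by exists P; split=> //; lra.
Qed.

Lemma sum_const_fin (T : finType) (c : R) : \big[Rplus/0]_(t : T) c = INR #|T| * c.
Proof.
have iterE k : iter k (Rplus c) 0 = INR k * c.
  by elim: k => [|k IH]; rewrite ?Rmult_0_l // iterS IH S_INR; ring.
by rewrite big_const iterE.
Qed.

Lemma approx_null n d w s : (d < n)%N -> 0 < w -> INR d < s -> s - INR d <= INR n.+1 ->
  INR n.+1 < (1 + w) * (s - INR d) ->
  HNull n s (fun theta => VecN n theta /\ exists omega, w <= omega /\ ExpSet n d theta omega).
Proof.
move=> hd w0 sd1 sd2 hs.
set tau := s - INR d in sd2 hs.
have nd := pos_INR d.
have s0 : 0 < s by lra.
have nn : 1 <= INR n by rewrite -[1]/(INR 1); apply/le_INR/ssrnat.leP; apply: leq_ltn_trans hd.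
have n1 : 0 < INR n.+1 by rewrite S_INR; lra.
have tau0 : 0 < tau by rewrite /tau; lra.
(* Chosen so that [p] is the midpoint of $n+1$ and $(1+w)\tau$: the Rankin exponent stays above
   $n+1$, where the sum converges, and the ratio [q] below stays under 1. *)
pose ep := ((1 + w) * tau - INR n.+1) / (2 * INR n.+1).
have ep0 : 0 < ep by apply: Rdiv_lt_0_compat; lra.
pose p := INR n.+1 * (1 + ep).
have Ep : p = INR n.+1 + ((1 + w) * tau - INR n.+1) / 2 by rewrite /p /ep; field; lra.
have ptau : tau <= p by lra.
have [Z [Zp hZ]] := rowprod_sum d ep0 ptau.
have [I hI] := plane_thin hd.
pose C2 := sqrt (2 ^ (d.+1 * d.+1)).
have C21 : 1 <= C2 by rewrite -sqrt_1; apply: sqrt_le_1_alt; apply: pow_R1_Rle; lra.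
pose q0 := Rpower 2 (- w).
have q00 : 0 < q0 by apply: Rpower_gt0.
have q01 : q0 < 1 by apply: Rpower_lt1; lra.
pose Cn := INR n * (3 * 3 ^ d + 2).
have d3 : 1 <= 3 ^ d by apply: pow_R1_Rle; lra.
have Cn1 : 1 <= Cn by rewrite /Cn; nra.
have Cn0 : 0 < Cn by lra.
(* Restricting to bounded pieces leaves finitely many cells for each plane. *)
apply: (@HNull_sub _ _ _ (fun x =>
  exists m : nat, VecN n x /\ (forall i, (i < n)%N -> Rabs (x i - 0) <= INR m.+1) /\
    exists omega, w <= omega /\ ExpSet n d x omega)).
  move=> x [vx hx]; pose S := \Sum_(i < n) Rabs (x i).
  have S0 : 0 <= S by apply: sum_ge0 => i; apply: Rabs_pos.
  exists (nfloor S); do 2!split=> //; move=> i hi; rewrite Rminus_0_r S_INR.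
  have [_ h2] := nfloorP S0.
  have := sum_ge_term (f := fun i : 'I_n => Rabs (x i)) (Ordinal hi) (fun i => Rabs_pos _).
  by rewrite -/S /=; lra.
apply: HNull_union => // m; set A := INR m.+1.
have A1 : 1 <= A by rewrite /A S_INR; have := pos_INR m; lra.
apply: HNull_fin => // delta eps del0 eps0.
pose q := Rpower 2 (p - (1 + w) * tau).
have q1 : 0 <= q < 1.
  split; first exact/Rlt_le/Rpower_gt0.
  by apply: Rpower_lt1; lra.
pose B := (3 * A) ^ d * Rpower Cn s * Rpower (2 * C2) tau * Z * Rpower (2 * C2) (p - tau).
have B0 : 0 <= B.
  by rewrite /B; repeat (apply: Rmult_le_pos; last by apply/Rlt_le;
    (apply: Rpower_gt0 || assumption)); apply: pow_le; lra.
have [k0 hk0] := geometric_tail q1 B0 eps0.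
pose eta := Rmin delta 1 / (2 * C2 * Cn).
have eta0 : 0 < eta.
  by apply: Rdiv_lt_0_compat; [apply: Rmin_glb_lt; lra | nra].
have [k1 hk1] := pow_lt_1_zero q0 (ltac:(rewrite Rabs_pos_eq; lra)) eta eta0.
(* Starting at [k0] makes the total cost at most [eps]; starting at [k1] makes all diameters at most
   [delta]. *)
pose kk k := (k0 + k1 + k)%N.
pose Y k := 2 * C2 * 2 ^ kk k.
have p2 k : 1 <= 2 ^ k by apply: pow_R1_Rle; lra.
have Y1 k : 1 <= Y k by have := p2 (kk k); rewrite /Y; nra.
pose M k := (nfloor (Y k)).+1.
pose N k (g : intmx n d (M k)) := rowprod n d (zmx g).
have N1 k g : 1 <= N k g by apply: rowprod_ge1.
(* If $h$ is the height, the distance is at most [q0 ^ kk k / h]; it is an infimum, and a point of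
   the plane nearly attaining it costs the factor 2. Replacing $h$ by the row product costs [C2]. *)
pose r0 k (g : intmx n d (M k)) := 2 * C2 * q0 ^ kk k / N k g.
have qk k : 0 < q0 ^ k by apply: pow_lt.
have r00 k g : 0 < r0 k g.
  by apply: Rdiv_lt_0_compat; [apply: Rmult_lt_0_compat => //; lra | have := N1 k g; lra].
have r0le k g : Cn * r0 k g <= Rmin delta 1.
  have h1 : q0 ^ kk k <= eta.
    have := hk1 (kk k) (ltac:(apply/ssrnat.leP; rewrite /kk; lia)); rewrite Rabs_pos_eq; first lra.
    exact/Rlt_le.
  have h2 : r0 k g <= 2 * C2 * q0 ^ kk k.
    rewrite /r0 -[X in _ <= X]Rmult_1_r; apply: Rmult_le_compat_l; first by have := qk (kk k); nra.
    by rewrite -Rinv_1; apply: Rinv_le_contravar; [lra | apply: N1].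
  apply: Rle_trans (_ : Cn * (2 * C2 * eta) <= _).
    apply: Rmult_le_compat_l; first lra.
    by apply: Rle_trans h2 _; apply: Rmult_le_compat_l; lra.
  by rewrite /eta; apply: Req_le; field; lra.
have dm1 := Rmin_l delta 1; have dm2 := Rmin_r delta 1.
pose ck k (g : intmx n d (M k)) := cellkey (I (zmx g)) (fun _ => 0) A (r0 k g).
pose J k (g : intmx n d (M k)) : finType := {ffun 'I_d -> 'I_(nfloor (2 * A / r0 k g)).+1}.
exists (fun k => {g : intmx n d (M k) & J k g} : finType).
exists (fun k t => `[< N k (tag t) <= Y k >]).
exists (fun k t x => cube n (fun _ => 0) A x /\ near n (AffOf n d (zmx (tag t))) (r0 k (tag t)) x /\
   thin (3 ^ d) (AffOf n d (zmx (tag t))) (I (zmx (tag t))) /\ ck k (tag t) x = tagged t).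
exists (fun k t => Cn * r0 k (tag t)).
split.
  move=> k [g key] /= _; split.
    split; first exact: Rmult_lt_0_compat.
    by apply: Rle_trans dm1; apply: r0le.
  move=> x y [cx [nx [tx kx]]] [cy [ny [ty ky]]].
  have := cell_diam tx (r00 k g) cx cy nx ny (etrans kx (esym ky)).
  move=> h; rewrite /Cn Rmult_assoc; apply: euclid_le => //.
  by apply: Rmult_le_pos; [lra | apply/Rlt_le].
split.
  move=> x [vx [bx [omega [womega hexp]]]].
  have [H [hH [y [ry [hy [del [hdel hdist]]]]]]] := hexp (2 ^ (k0 + k1)).
  have H1 : 1 <= H by apply: Rle_trans hH; apply: p2.
  (* The block is determined by the bound [H], not by the height of the plane. A plane of small
     height thus recurs in all later blocks, with shrinking radii. *)
  have [k' [hk1' hk2']] := floor_log2 H1.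
  have hk' : (k0 + k1 <= k')%N.
    rewrite leqNgt; apply/negP => hlt.
    have : 2 ^ k'.+1 <= 2 ^ (k0 + k1) by apply: Rle_pow; [lra | apply/ssrnat.leP].
    lra.
  pose k := (k' - (k0 + k1))%N.
  have Ek : kk k = k' by rewrite /kk /k subnKC.
  have [y' [ly' [affy [cy' hrow]]]] := reduced_rep ry.
  have hy1 := height_ge1 (proj1 ry).
  set h := height n d y in hy hdist hrow hy1.
  have hY : rowprod n d y' <= Y k.
    apply: Rle_trans hrow _; rewrite /Y Ek -/C2.
    have -> : 2 * C2 * 2 ^ k' = C2 * 2 ^ k'.+1 by rewrite /=; ring.
    by apply: Rmult_le_compat_l; lra.
  have [g hg] : exists g : intmx n d (M k), forall i l, (i <= d)%N -> (l <= n)%N -> zmx g i l =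
    y' i l.
    apply: zmx_exists => i l hi hl; apply: Rle_trans (rmax_ge y' i hl) _.
    apply: Rle_trans (rmax_le_rowprod _ _ hi) _; apply: Rle_trans hY _.
    by rewrite /M S_INR; have := nfloorP (Rle_trans _ _ _ Rle_0_1 (Y1 k)); lra.
  have ET := toM_ext hg.
  have EN : N k g = rowprod n d y' by apply: rowprod_ext.
  exists k, (Tagged (J k) (ck k g x)); rewrite /=; split; first by apply/asboolP; rewrite EN.
  have lg : RLinIndep n d (zmx g) by apply/RLinIndepE; rewrite ET; apply/RLinIndepE.
  have cg : exists i, (i <= d)%coq_nat /\ zmx g i 0%N <> Z0.
    by apply/(col0_toM n); rewrite ET; apply/(col0_toM n).
  split; first by split.
  split; last by split=> //; apply: hI.
  have eta1 : 0 < q0 ^ k' / h by apply: Rdiv_lt_0_compat => //; lra.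
  have [P [hP hdP]] := dist_attained hdel eta1.
  exists P; split; first by apply/(AffOf_ext _ ET); apply/affy.
  move=> i hi; apply: Rle_trans (coord_le_euclid _ _ hi) _; apply: Rle_trans hdP _.
  have hpow : Rpower H (- omega) <= q0 ^ k'.
    apply: Rle_trans (_ : Rpower (2 ^ k') (- omega) <= _).
      apply: Rpower_base_ge => //; [lra | by apply: pow_lt; lra].
    apply: Rle_trans (_ : Rpower (2 ^ k') (- w) <= _).
      by apply: Rpower_expo_le => //; lra.
    by rewrite Rpower_powl; [apply: Req_le | lra].
  have hdelta : del <= q0 ^ k' / h.
    apply: (Rmult_le_reg_l h); first lra.
    have -> : h * (q0 ^ k' / h) = q0 ^ k' by field; lra.
    lra.
  apply: Rle_trans (_ : 2 * q0 ^ k' * / h <= _); first by rewrite /Rdiv in hdelta *; lra.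
  have -> : r0 k g = 2 * q0 ^ k' * (C2 / N k g) by rewrite /r0 Ek; field; have := N1 k g; lra.
  apply: Rmult_le_compat_l; first by have := qk k'; lra.
  have Ng := N1 k g.
  apply: (Rmult_le_reg_l h); first lra.
  rewrite Rinv_r; last lra.
  have -> : h * (C2 / N k g) = C2 * h / N k g by field; lra.
  apply: (Rmult_le_reg_r (N k g)); first lra.
  have -> : C2 * h / N k g * N k g = C2 * h by field; lra.
  by rewrite EN; move: hrow; rewrite -/C2; lra.
move=> K.
apply: Rle_trans (hk0 K); apply: sum_le => k.
have hq : q ^ (kk k) <= q ^ (k0 + k).
  have -> : kk k = (k0 + k + k1)%N by rewrite /kk; lia.
  rewrite pow_add -[X in _ <= X]Rmult_1_r; apply: Rmult_le_compat_l; first by apply: pow_le; lra.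
  by rewrite -(pow1 k1); apply: pow_incr; lra.
apply: Rle_trans (_ : B * q ^ kk k <= _); last exact: Rmult_le_compat_l.
have sig := @sig_big_dep R 0 Rplus (intmx n d (M k)) (J k) (fun g => `[< N k g <= Y k >])
  (fun g (_ : J k g) => true)
  (fun g _ => Rpower (Cn * r0 k g) s).
have -> : \big[Rplus/0]_(t : {g : intmx n d (M k) & J k g} | `[< N k (tag t) <= Y k >])
     Rpower (Cn * r0 k (tag t)) s =
  \big[Rplus/0]_(g : intmx n d (M k) | `[< N k g <= Y k >]) (INR #|J k g| * Rpower (Cn * r0 k g) s).
  transitivity (\big[Rplus/0]_(g : intmx n d (M k) | `[< N k g <= Y k >])
     \big[Rplus/0]_(j : J k g) Rpower (Cn * r0 k g) s).
    by rewrite sig; apply: eq_bigl => t; rewrite andbT.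
  by apply: eq_bigr => g _; rewrite sum_const_fin.
(* A plane needs about $r_0^{-d}$ cells of cost $r_0^s$ each, which is $r_0^\tau$ up to constants.
   [D] collects everything except the power of the row product. *)
pose D := (3 * A) ^ d * Rpower Cn s * Rpower (2 * C2) tau * Rpower (q0 ^ kk k) tau.
have D0 : 0 <= D.
  by rewrite /D; repeat (apply: Rmult_le_pos; last by apply/Rlt_le/Rpower_gt0); apply: pow_le; lra.
apply: Rle_trans (_ : \big[Rplus/0]_(g : intmx n d (M k) | `[< N k g <= Y k >])
  (D * Rpower (N k g) (- tau)) <= _).
  elim/big_ind2: _ => [|a b a' b' h1 h2|g _]; [lra | lra |].
  have r0g := r00 k g; have Ng := N1 k g.
  have r1 : r0 k g <= 1 by have := r0le k g; nra.
  have hJ : INR #|J k g| <= (3 * A / r0 k g) ^ d.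
    rewrite card_ffun !card_ord INR_expn; apply: pow_incr; split; first exact: pos_INR.
    rewrite S_INR; have h0 : 0 <= 2 * A / r0 k g by apply/Rlt_le/Rdiv_lt_0_compat; lra.
    have [h1 _] := nfloorP h0.
    have h2 : 1 <= A / r0 k g.
      apply: (Rmult_le_reg_r (r0 k g)) => //.
      by have -> : A / r0 k g * r0 k g = A by [field; lra]; lra.
    have -> : 3 * A / r0 k g = 2 * A / r0 k g + A / r0 k g by field; lra.
    lra.
  apply: Rle_trans (Rmult_le_compat_r _ _ _ (Rlt_le _ _ (Rpower_gt0 _ _)) hJ) _.
  apply: Req_le; rewrite -Rpower_mult_distr //.
  have -> : Rpower (r0 k g) s = r0 k g ^ d * Rpower (r0 k g) tau.
    by rewrite -Rpower_pow // -Rpower_plus; congr Rpower; rewrite /tau; ring.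
  have -> : (3 * A / r0 k g) ^ d = (3 * A) ^ d * / (r0 k g ^ d)
    by rewrite /Rdiv Rpow_mult_distr pow_inv.
  have -> : Rpower (r0 k g) tau = Rpower (2 * C2) tau * Rpower (q0 ^ kk k) tau * Rpower (N k g)
    (- tau).
    rewrite -Rpower_inv; last lra.
    by rewrite !Rpower_mult_distr //; [apply: Rmult_lt_0_compat => //;
      lra | apply: Rinv_0_lt_compat; lra | lra].
  by rewrite /D; field; apply: pow_nonzero; lra.
rewrite -big_distrr /=.
apply: Rle_trans (Rmult_le_compat_l _ _ _ D0 (hZ (M k) (Y k) (Y1 k))) _.
apply: Req_le; rewrite -/p /D /B /Y -(Rpower_mult_distr (2 * C2) (2 ^ kk k));
  [|lra|by have := p2 (kk k); lra].
have -> : q ^ kk k = Rpower (q0 ^ kk k) tau * Rpower (2 ^ kk k) (p - tau).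
  rewrite !Rpower_powl //; last lra.
  rewrite -Rpow_mult_distr; congr (_ ^ _).
  by rewrite /q0 Rpower_mult -Rpower_plus /q; congr Rpower; ring.
ring.
Qed.

(** * Grids *)

Lemma INR_card (T : finType) (S : {set T}) : INR #|S| = \big[Rplus/0]_(t in S) 1.
Proof.
have iterE k : iter k (Rplus 1) 0 = INR k.
  by elim: k => [|k IH] //; rewrite iterS IH S_INR; ring.
by rewrite big_const iterE.
Qed.

Lemma sum_le_in (T : finType) (P : pred T) (f g : T -> R) : (forall t, P t -> f t <= g t) ->
  \big[Rplus/0]_(t | P t) f t <= \big[Rplus/0]_(t | P t) g t.
Proof. by move=> h; elim/big_ind2: _ => [|a b a' b' h1 h2|t Pt]; [lra | lra | exact: h]. Qed.

Lemma card_fibers (T J : finType) (f : T -> J) (S : {set T}) (B : R) :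
  (forall j, INR #|[set t in S | f t == j]| <= B) -> INR #|S| <= INR #|f @: S| * B.
Proof.
move=> h; rewrite INR_card.
rewrite (partition_big f (mem (f @: S))) /=; last by move=> t tS; apply: imset_f.
apply: Rle_trans (_ : \big[Rplus/0]_(j in f @: S) B <= _).
  apply: sum_le_in => j _; apply: Rle_trans (h j); rewrite INR_card.
  by apply: Req_le; apply: eq_bigl => t; rewrite inE.
by rewrite INR_card big_distrl /=; apply: Req_le; apply: eq_bigr => j _; rewrite Rmult_1_l.
Qed.

Lemma leq_INR m k : (m <= k)%N -> INR m <= INR k.
Proof. by move=> h; apply/le_INR/ssrnat.leP. Qed.

(** With $m = \lfloor D \rfloor$ and a fixed $k_0$ in [S], the translate $k - k_0 + m$ of each
    element of [S] has its coordinates in $\{0, \dots, 2m\}$. *)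
Lemma grid_box a K (S : {set {ffun 'I_a -> 'I_K}}) (D : R) : 0 <= D ->
  (forall k k' i, k \in S -> k' \in S -> INR (k i) <= INR (k' i) + D) ->
  INR #|S| <= (2 * D + 1) ^ a.
Proof.
move=> D0 h; have [h1 h2] := nfloorP D0; set m := nfloor D in h1 h2.
have hn k k' i : k \in S -> k' \in S -> (k i <= k' i + m)%N.
  move=> kS k'S; have := h k k' i kS k'S => h3.
  rewrite -ltnS; apply/ssrnat.ltP; apply: INR_lt; rewrite S_INR plus_INR; lra.
have [->|[k0 k0S]] := set_0Vmem S.
  by rewrite cards0 /=; apply: pow_le; lra.
pose f (k : {ffun 'I_a -> 'I_K}) : {ffun 'I_a -> 'I_(2 * m).+1} := [ffun i =>
  inord (k i + m - k0 i)%N].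
have finj : {in S &, injective f}.
  move=> k k' kS k'S /ffunP e; apply/ffunP => i; apply: val_inj.
  have := e i; rewrite !ffunE => /(congr1 val) /=.
  have := hn k k0 i kS k0S; have := hn k0 k i k0S kS.
  have := hn k' k0 i k'S k0S; have := hn k0 k' i k0S k'S.
  by rewrite /= => e1 e2 e3 e4; rewrite !inordK; lia.
rewrite -(card_in_imset finj).
apply: Rle_trans (_ : INR #|{ffun 'I_a -> 'I_(2 * m).+1}| <= _); first exact/leq_INR/max_card.
rewrite card_ffun !card_ord INR_expn; apply: pow_incr; split; first exact: pos_INR.
by rewrite S_INR mult_INR /=; lra.
Qed.

(** The grid fills only the concentric cube of half the size, so that children lying within [M / 2]
    of a grid point remain in the parent. *)
Definition gpt n (c : nat -> R) (M : R) K (k : {ffun 'I_n -> 'I_K}) : nat -> R :=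
  fun i => if ltnP i n is LtnNotGeq h then c i - M / 2 + M * INR (k (Ordinal h)) / INR K else 0.

Lemma gptE n c M K (k : {ffun 'I_n -> 'I_K}) (i : 'I_n) :
  gpt c M k i = c i - M / 2 + M * INR (k i) / INR K.
Proof.
rewrite /gpt; case: ltnP => h; last by have := ltn_ord i; rewrite ltnNge h.
by congr (_ + _ * INR (k _) / _); apply: val_inj.
Qed.

Lemma gpt_VecN n c M K (k : {ffun 'I_n -> 'I_K}) : VecN n (gpt c M k).
Proof. by move=> i /ssrnat.leP hi; rewrite /gpt; case: ltnP => // h; move: hi;
  rewrite leqNgt h. Qed.

Lemma gpt_half n c M K (k : {ffun 'I_n -> 'I_K}) i : 0 <= M -> (i < n)%N ->
  Rabs (gpt c M k i - c i) <= M / 2.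
Proof.
move=> M0 hi; rewrite -[i]/(nat_of_ord (Ordinal hi)) gptE; set l := k _.
have K0 : 0 < INR K by apply/lt_0_INR/ssrnat.ltP; apply: leq_ltn_trans (ltn_ord l).
have lK : INR l <= INR K by apply/leq_INR/ltnW/ltn_ord.
have l0 := pos_INR l.
have h1 : 0 <= INR l / INR K <= 1.
  have iK : 0 < / INR K by apply: Rinv_0_lt_compat.
  split; first by apply: Rmult_le_pos; lra.
  by apply: (Rmult_le_reg_r (INR K)) => //; have -> : INR l / INR K * INR K = INR l by [field;
    lra]; lra.
have -> : c (Ordinal hi) - M / 2 + M * INR l / INR K - c (Ordinal hi) = M * (INR l / INR K) - M / 2.
  by field; lra.
by apply: Rabs_le; nra.
Qed.

Lemma gpt_cube n c M K (k : {ffun 'I_n -> 'I_K}) : 0 <= M -> cube n c M (gpt c M k).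
Proof.
move=> M0; split; first exact: gpt_VecN.
by move=> i hi; have := gpt_half c k M0 hi; lra.
Qed.

Lemma grid_close n c M K (S : {set {ffun 'I_n -> 'I_K}}) (D : R) : 0 < M -> (0 < K)%N -> 0 <= D ->
  (forall k k', k \in S -> k' \in S -> forall i, (i < n)%N -> Rabs (gpt c M k i - gpt c M k' i)
    <= D) ->
  INR #|S| <= (2 * (D * INR K / M) + 1) ^ n.
Proof.
move=> M0 K0 D0 h.
have K0' : 0 < INR K by apply/lt_0_INR/ssrnat.ltP.
have iM : 0 < / M by apply: Rinv_0_lt_compat.
apply: grid_box.
  by apply: Rmult_le_pos; [apply: Rmult_le_pos; lra | lra].
move=> k k' i kS k'S; have := h k k' kS k'S i (ltn_ord i).
rewrite !gptE.
have -> : c i - M / 2 + M * INR (k i) / INR K - (c i - M / 2 + M * INR (k' i) / INR K) =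
   (INR (k i) - INR (k' i)) * (M / INR K) by field; lra.
rewrite Rabs_mult [Rabs (M / INR K)]Rabs_pos_eq; last by apply/Rlt_le/Rdiv_lt_0_compat.
move=> h1; suff: Rabs (INR (k i) - INR (k' i)) <= D * INR K / M by split_Rabs; lra.
apply: (Rmult_le_reg_r (M / INR K)); first exact: Rdiv_lt_0_compat.
by have -> : D * INR K / M * (M / INR K) = D by field; lra.
Qed.

(** The neighbourhood splits into about $(M/\delta)^d$ cells, each with about $(\delta K/M)^n$ grid
    points. The grid step must not exceed $\delta$, for otherwise the rounding in the count of a
    cell would dominate. *)
Lemma grid_near n d C L (I : 'I_d -> 'I_n) c M K delta :
  (d < n)%N -> thin C L I -> 1 <= C -> 0 < M -> (0 < K)%N -> M / INR K <= delta -> delta <= M ->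
  INR #|[set k : {ffun 'I_n -> 'I_K} | `[< near n L delta (gpt c M k) >]]| <=
   3 ^ d * (3 * (3 * C + 2)) ^ n * (INR K ^ n * (delta / M) ^ (n - d)).
Proof.
move=> hd hI C1 M0 K0 hdel hdel2.
have K0' : 0 < INR K by apply/lt_0_INR/ssrnat.ltP.
have del0 : 0 < delta by apply: Rlt_le_trans hdel; apply: Rdiv_lt_0_compat.
set S := [set k | _].
pose key (k : {ffun 'I_n -> 'I_K}) := cellkey I c M delta (gpt c M k).
have u1 : 1 <= delta * INR K / M.
  apply: (Rmult_le_reg_r (M / INR K)); first exact: Rdiv_lt_0_compat.
  by have -> : delta * INR K / M * (M / INR K) = delta by [field; lra]; lra.
set u := delta * INR K / M in u1.
have fib j : INR #|[set k in S | key k == j]| <= (3 * (3 * C + 2) * u) ^ n.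
  apply: Rle_trans (_ : (2 * ((3 * C + 2) * delta * INR K / M) + 1) ^ n <= _).
    apply: (grid_close (c := c)) => //; first nra.
    move=> k k'; rewrite !inE => /andP[/asboolP nk /eqP kk] /andP[/asboolP nk' /eqP kk'].
    by apply: (cell_diam hI del0 (gpt_cube c k (Rlt_le _ _ M0)) (gpt_cube c k' (Rlt_le _ _ M0)))
      => //; rewrite -/(key _) kk.
  have -> : (3 * C + 2) * delta * INR K / M = (3 * C + 2) * u by rewrite /u; field; lra.
  by apply: pow_incr; nra.
apply: Rle_trans (card_fibers fib) _.
apply: Rle_trans (_ : (3 * M / delta) ^ d * (3 * (3 * C + 2) * u) ^ n <= _).
  apply: Rmult_le_compat_r; first by apply: pow_le; nra.
  apply: Rle_trans (_ : INR #|{ffun 'I_d -> 'I_(nfloor (2 * M / delta)).+1}| <= _);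
    first exact/leq_INR/max_card.
  rewrite card_ffun !card_ord INR_expn; apply: pow_incr; split; first exact: pos_INR.
  have v1 : 1 <= M / delta.
    by apply: (Rmult_le_reg_r delta) => //; have -> : M / delta * delta = M by [field; lra]; lra.
  have e1 : 2 * M / delta = 2 * (M / delta) by field; lra.
  have e2 : 3 * M / delta = 3 * (M / delta) by field; lra.
  rewrite S_INR e1 e2; have [h1 _] := nfloorP (ltac:(lra) : 0 <= 2 * (M / delta)); lra.
apply: Req_le.
have -> : (3 * M / delta) ^ d = 3 ^ d * ((M / delta) ^ d).
  by rewrite -Rpow_mult_distr; congr (_ ^ _); field; lra.
rewrite [(_ * u) ^ n]Rpow_mult_distr.
have -> : u ^ n = INR K ^ n * ((delta / M) ^ d * (delta / M) ^ (n - d)).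
  rewrite -pow_add; have -> : (d + (n - d))%coq_nat = n by lia.
  by rewrite -Rpow_mult_distr; congr (_ ^ _); rewrite /u; field; lra.
have E : (M / delta) ^ d * (delta / M) ^ d = 1.
  by rewrite -Rpow_mult_distr; have -> : M / delta * (delta / M) = 1 by [field; lra]; rewrite pow1.
transitivity (3 ^ d * (3 * (3 * C + 2)) ^ n * (INR K ^ n * (delta / M) ^ (n - d)) * ((M / delta)
  ^ d * (delta / M) ^ d)); first by ring.
by rewrite E; ring.
Qed.

(** * One step of the Cantor construction *)

Definition meets n (U : (nat -> R) -> Prop) (c : nat -> R) (M : R) : Prop :=
  exists x, U x /\ cube n c M x.

(** Sets with [r j >= M] are left out because the construction maintains that none of them meets the
    cube. *)
Definition potential n (U : nat -> (nat -> R) -> Prop) (r : nat -> R) (t : R)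
    (c : nat -> R) (M : R) (N : nat) : R :=
  \Sum_(j < N) (if `[< r j < M /\ meets n (U j) c M >] then Rpower (r j / M) t else 0).

(** Comes from [hit_grid]: the grid points of two children hit by one set differ by at most $3v +
    2(1+3^d)v = (5+2\cdot 3^d)v$, and [grid_close] doubles this and adds 1. *)
Definition gridC (d : nat) : R := 11 + 4 * 3 ^ d.
(** Bounds the number of children hit by a set of diameter at most the side of a child. The 7 is $2
    \cdot 3 + 1$, from [grid_box] along a plane. *)
Definition smallC (n d : nat) : R := gridC d ^ n * 7 ^ d.
(** A set of diameter $r$ between the sizes of child and parent hits at most the fraction [killC]
    times $(r/M)^t$ of the children. The two summands serve diameters above and below [sigma]. The
    factor $2^{1+n+d}$ pays for the two roundings to integers and for the discarded half of the
    grid. *)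
Definition killC (n d : nat) : R := 2 * (2 * gridC d) ^ n + smallC n d * 2 ^ (1 + n + d).
(** A potential of this size loses at most a quarter of the children to sets that have become too
    large. *)
Definition kappa0 (n d : nat) : R := / (4 * killC n d).
(** With this many children the mean potential of a child is at most [kappa0 / 8], so at most a
    quarter of them exceed [kappa0 / 2]. *)
Definition stepC (n d : nat) : R := 8 * smallC n d * 2 ^ (1 + n + d).

Lemma gridC_ge1 d : 1 <= gridC d.
Proof. by rewrite /gridC; have := pow_lt 3 d; lra. Qed.

Lemma smallC_ge1 n d : 1 <= smallC n d.
Proof.
have h1 : 1 <= gridC d ^ n by apply: pow_R1_Rle; apply: gridC_ge1.
have h2 : 1 <= 7 ^ d by apply: pow_R1_Rle; lra.
by rewrite /smallC; nra.
Qed.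

Lemma killC_ge n d : 2 * (2 * gridC d) ^ n <= killC n d /\ smallC n d * 2 ^ (1 + n + d)
  <= killC n d /\ 1 <= killC n d.
Proof.
have h1 : 1 <= (2 * gridC d) ^ n by apply: pow_R1_Rle; have := gridC_ge1 d; lra.
have h2 := smallC_ge1 n d.
have h3 : 1 <= 2 ^ (1 + n + d) by apply: pow_R1_Rle; lra.
by rewrite /killC; split; [nra | split; nra].
Qed.

Lemma abs_quad a b u v y z : Rabs (a - b) <= y -> Rabs (a - u) <= z -> Rabs (b - v) <= z ->
  Rabs (u - v) <= y + 2 * z.
Proof. by split_Rabs; lra. Qed.

Lemma abs_shift a b c z : Rabs (a + b - (a + c)) <= z -> b <= c + z.
Proof. by split_Rabs; lra. Qed.

(** * Children of a cube that meet a given set *)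

Section Children.
Variables (n d K Mm : nat) (c : nat -> R) (M sigma rho : R).
Notation grid := {ffun 'I_n -> 'I_K}.
Notation T := (grid * {ffun 'I_d -> 'I_Mm})%type.
Variables (G : {set grid}) (x : grid -> nat -> nat -> Z) (P : grid -> nat -> R)
  (I : grid -> 'I_d -> 'I_n) (p : T -> nat -> R).
Hypotheses (M0 : 0 < M) (rho0 : 0 < rho) (rs : rho <= sigma) (K0 : (0 < K)%N)
  (hK : INR K <= M / sigma)
  (hp : forall t i, t.1 \in G -> (i < n)%N -> Rabs (p t i - gpt c M t.1 i) <= (1 + 3 ^ d) * sigma)
  (hI : forall t j, t.1 \in G -> p t (I t.1 j) = P t.1 (I t.1 j) + rho * INR (t.2 j)).

(** A child is a pair: a grid point, which determines a plane, and a position on a grid of step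
    [rho] in the coordinates [I] of that plane. *)
Definition hit (V : (nat -> R) -> Prop) : {set T} :=
  [set t | (t.1 \in G) && `[< meets n V (p t) rho >]].

Lemma hit_close V rr t t' i : diam_le n V rr -> rho <= rr -> t \in hit V -> t' \in hit V ->
  (i < n)%N -> Rabs (p t i - p t' i) <= 3 * rr.
Proof.
move=> hd hr; rewrite !inE => /andP[_ /asboolP[a [Va [_ ca]]]] /andP[_ /asboolP[b [Vb [_ cb]]]] hi.
have := ca i hi; have := cb i hi; have := Rle_trans _ _ _ (coord_le_euclid a b hi) (hd _ _ Va Vb).
by split_Rabs; lra.
Qed.

(** The parameter [v] stands for the larger of [rr] and [sigma], so that one count serves both
    regimes: a set smaller than [sigma] may still touch planes of several neighbouring grid
    points. *)
Lemma hit_grid V rr v : diam_le n V rr -> rho <= rr -> rr <= v -> sigma <= v ->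
  INR #|fst @: hit V| <= (gridC d * (v / sigma)) ^ n.
Proof.
move=> hd hr hv sv.
have s0 : 0 < sigma by lra.
have d3 : 0 < 3 ^ d by apply: pow_lt; lra.
pose D := (5 + 2 * 3 ^ d) * v.
have D0 : 0 <= D by rewrite /D; nra.
apply: Rle_trans (_ : (2 * (D * INR K / M) + 1) ^ n <= _).
  apply: (grid_close (c := c)) => // k k' /imsetP[t tS ->] /imsetP[t' t'S ->] i hi.
  have h1 := hit_close hd hr tS t'S hi.
  have tG : t.1 \in G by move: tS; rewrite inE => /andP[].
  have tG' : t'.1 \in G by move: t'S; rewrite inE => /andP[].
  have h2 := hp tG hi; have h3 := hp tG' hi.
  apply: Rle_trans (abs_quad h1 h2 h3) _.
  by rewrite /D; nra.
have vs : 1 <= v / sigma.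
  by apply: (Rmult_le_reg_r sigma) => //; have -> : v / sigma * sigma = v by [field; lra]; lra.
have K1 := pos_INR K.
have h : D * INR K / M <= (5 + 2 * 3 ^ d) * (v / sigma).
  have -> : (5 + 2 * 3 ^ d) * (v / sigma) = D * (M / sigma) / M by rewrite /D; field; lra.
  apply: Rmult_le_compat_r; first by apply/Rlt_le/Rinv_0_lt_compat.
  exact: Rmult_le_compat_l.
have h0 : 0 <= D * INR K / M.
  by apply: Rmult_le_pos; [nra | apply/Rlt_le/Rinv_0_lt_compat].
by apply: pow_incr; rewrite /gridC; split; lra.
Qed.

Lemma card_fst_fiber (S : {set T}) g :
  #|[set t in S | t.1 == g]| = #|snd @: [set t in S | t.1 == g]|.
Proof.
rewrite card_in_imset // => -[g1 m1] [g2 m2]; rewrite !inE /= => /andP[_ /eqP ->]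
  /andP[_ /eqP ->] -> //.
Qed.

(** A set larger than [sigma] may contain all children attached to a grid point, so only the grid
    points are counted with care. *)
Lemma hit_large V rr : diam_le n V rr -> rho <= rr -> sigma <= rr ->
  INR #|hit V| <= (gridC d * (rr / sigma)) ^ n * INR Mm ^ d.
Proof.
move=> hd hr hs.
apply: Rle_trans (card_fibers (f := fst) (S := hit V) (B := INR Mm ^ d) _) _.
  move=> g; rewrite card_fst_fiber.
  apply: (Rle_trans _ (INR #|{ffun 'I_d -> 'I_Mm}|)); first exact/leq_INR/max_card.
  by rewrite card_ffun !card_ord INR_expn; lra.
apply: Rmult_le_compat_r; first by apply: pow_le; apply: pos_INR.
by apply: (@hit_grid V rr rr) => //; apply: Rle_refl.
Qed.

(** Boundedly many planes are touched, and on each of them the children are spaced by [rho] in [d]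
    coordinates: the set is seen in dimension [d] only. *)
Lemma hit_small V rr : diam_le n V rr -> rho <= rr -> rr <= sigma ->
  INR #|hit V| <= gridC d ^ n * (7 * (rr / rho)) ^ d.
Proof.
move=> hd hr hs.
have v1 : 1 <= rr / rho.
  by apply: (Rmult_le_reg_r rho) => //; have -> : rr / rho * rho = rr by [field; lra]; lra.
apply: Rle_trans (card_fibers (f := fst) (S := hit V) (B := (7 * (rr / rho)) ^ d) _) _.
  move=> g; rewrite card_fst_fiber.
  apply: Rle_trans (_ : (2 * (3 * (rr / rho)) + 1) ^ d <= _); last by apply: pow_incr; lra.
  apply: grid_box; first lra.
  move=> k k' j /imsetP[t]; rewrite inE => /andP[tS /eqP tg] -> /imsetP[t']; rewrite inE =>
    /andP[t'S /eqP tg'] ->.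
  have h := hit_close hd hr tS t'S (ltn_ord (I g j)).
  have tG : t.1 \in G by move: tS; rewrite inE => /andP[].
  have tG' : t'.1 \in G by move: t'S; rewrite inE => /andP[].
  have e1 := hI j tG; have e2 := hI j tG'; rewrite tg in e1; rewrite tg' in e2.
  rewrite e1 e2 in h.
  apply: (Rmult_le_reg_l rho) => //.
  have -> : rho * (INR (t'.2 j) + 3 * (rr / rho)) = rho * INR (t'.2 j) + 3 * rr by field; lra.
  exact: abs_shift h.
apply: Rmult_le_compat_r; first by apply: pow_le; lra.
have := @hit_grid V rr sigma hd hr hs (Rle_refl _).
by have -> : gridC d * (sigma / sigma) = gridC d by field; lra.
Qed.
End Children.

Lemma Rpower_le1_ge_pow x t k : 0 < x <= 1 -> t <= INR k -> x ^ k <= Rpower x t.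
Proof.
move=> [x0 x1] tk; rewrite -Rpower_pow // -[x]Rinv_inv !(Rpower_inv _ (Rinv_0_lt_compat _ x0)).
apply: Rpower_expo_le; last lra.
by rewrite -Rinv_1; apply: Rinv_le_contravar.
Qed.

Lemma Rpower_ge1_ge_pow x t k : 1 <= x -> INR k <= t -> x ^ k <= Rpower x t.
Proof. by move=> x1 kt; rewrite -Rpower_pow; [apply: Rpower_expo_le | lra]. Qed.

Lemma div_ge1 a b : 0 < b -> b <= a -> 1 <= a / b.
Proof.
by move=> b0 ba; apply: (Rmult_le_reg_r b) => //; have -> : a / b * b = a by [field; lra]; lra.
Qed.

Lemma div_le1 a b : 0 < b -> a <= b -> a / b <= 1.
Proof.
by move=> b0 ba; apply: (Rmult_le_reg_r b) => //; have -> : a / b * b = a by [field; lra]; lra.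
Qed.

(* The ratio of both sides is a power of [rr], so only [rr = rho] (if [d <= t]) or [rr = sigma]
   (if [t < d]) matters. *)
Lemma fine_scale_ratio n d M sigma rho rr t : 0 < rho -> rho <= rr -> rr <= sigma -> sigma <= M ->
  0 <= t <= INR n -> Rpower (M / rho) t <= (M / sigma) ^ n * (sigma / rho) ^ d ->
  (rr / rho) ^ d <= Rpower (rr / M) t * ((M / sigma) ^ n * (sigma / rho) ^ d).
Proof.
move=> r0 h1 h2 h3 [t0 tn] hX.
have s0 : 0 < sigma by lra.
have M0 : 0 < M by lra.
have rr0 : 0 < rr by lra.
have dp a b : 0 < a -> 0 < b -> 0 < a / b by move=> *; apply: Rdiv_lt_0_compat.
have [dt|td] := Rle_lt_dec (INR d) t.
  apply: Rle_trans (_ : Rpower (rr / rho) t <= _).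
    by apply: Rpower_ge1_ge_pow => //; apply: div_ge1.
  apply: Rle_trans (_ : Rpower (rr / M) t * Rpower (M / rho) t <= _).
    rewrite Rpower_mult_distr; try exact: dp.
    by apply: Req_le; congr Rpower; field; lra.
  by apply: Rmult_le_compat_l; first exact/Rlt_le/Rpower_gt0.
apply: Rle_trans (_ : Rpower (rr / M) t * (Rpower (M / sigma) t * (sigma / rho) ^ d) <= _);
  last first.
  apply: Rmult_le_compat_l; first exact/Rlt_le/Rpower_gt0.
  apply: Rmult_le_compat_r; first by apply/pow_le/Rlt_le/dp.
  by rewrite -Rpower_pow; [apply: Rpower_expo_le => //; apply: div_ge1 | apply: dp].
rewrite -Rmult_assoc Rpower_mult_distr; try exact: dp.
have -> : rr / M * (M / sigma) = rr / sigma by field; lra.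
have -> : (rr / rho) ^ d = (rr / sigma) ^ d * (sigma / rho) ^ d.
  by rewrite -Rpow_mult_distr; congr (_ ^ _); field; lra.
apply: Rmult_le_compat_r; first by apply/pow_le/Rlt_le/dp.
apply: Rpower_le1_ge_pow; last lra.
by split; [apply: dp | apply: div_le1].
Qed.

Lemma nfloor_half y : 1 <= y -> y / 2 <= INR (nfloor y).
Proof.
move=> y1; have [h1 h2] := nfloorP (ltac:(lra) : 0 <= y).
have : (0 < nfloor y)%N by apply/ssrnat.ltP/INR_lt; rewrite /=; lra.
by move=> /leq_INR; rewrite /=; lra.
Qed.

(** The covers are infinite while the averaging handles partial sums. For properties monotone in the
    truncation, one truncation decides for all of the finitely many children. *)
Lemma finite_witness (T : finType) (Q : T -> nat -> Prop) :
  (forall t N N', (N <= N')%N -> Q t N -> Q t N') ->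
  exists N0, forall t, (exists N, Q t N) -> Q t N0.
Proof.
move=> mono.
have /choice [w hw] : forall t, exists N, (exists N', Q t N') -> Q t N.
  move=> t; have [[N hN]|h] := pselect (exists N', Q t N'); first by exists N.
  by exists 0%N.
exists (\max_t w t) => t /hw; apply: mono; exact: leq_bigmax.
Qed.

Lemma sum_swap_card (T : finType) (S : {set T}) N (a : 'I_N -> R) (b : 'I_N -> T -> bool) :
  \big[Rplus/0]_(t in S) \Sum_(j < N) (if b j t then a j else 0) =
  \Sum_(j < N) (a j * INR #|[set t in S | b j t]|).
Proof.
rewrite exchange_big /=; apply: eq_bigr => j _.
rewrite INR_card big_distrr /= -big_mkcondr /=.
by apply: eq_big => [t|t _]; rewrite ?inE // Rmult_1_r.
Qed.

(** Two exceptional sets of children, each at most a quarter of all: those meeting a set no smaller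
    than themselves ([bad1], by a union bound) and those of potential above [kappa0 / 2] ([bad2], by
    Markov). The lower bound on the number of children in terms of $(M/\rho)^t$ is the only place
    where the dimension enters. *)
Lemma step_core n d K M sigma rho t c (G : {set {ffun 'I_n -> 'I_K}})
    (x : {ffun 'I_n -> 'I_K} -> nat -> nat -> Z) (P : {ffun 'I_n -> 'I_K} -> nat -> R)
    (U : nat -> (nat -> R) -> Prop) (r : nat -> R) :
  (d < n)%N -> 0 < rho -> rho <= sigma -> rho + (1 + 3 ^ d) * sigma <= M / 2 ->
  K = nfloor (M / sigma) ->
  (forall g, g \in G -> RLinIndep n d (x g) /\ (exists i, (i <= d)%coq_nat /\ x g i 0%N <> Z0) /\
     AffOf n d (x g) (P g) /\ forall i, (i < n)%N -> Rabs (gpt c M g i - P g i) <= sigma) ->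
  INR K ^ n / 2 <= INR #|G| ->
  0 <= t <= INR n ->
  stepC n d * Rpower (M / rho) t <= (M / sigma) ^ n * (sigma / rho) ^ d ->
  (forall j, diam_le n (U j) (r j)) -> (forall j, 0 < r j) ->
  (forall N, potential n U r t c M N <= kappa0 n d) ->
  exists g p, g \in G /\ AffOf n d (x g) p /\
    (forall i, (i < n)%N -> Rabs (p i - gpt c M g i) <= (1 + 3 ^ d) * sigma) /\
    (forall j, rho <= r j < M -> ~ meets n (U j) p rho) /\
    forall N, potential n U r t p rho N <= kappa0 n d / 2.
Proof.
move=> hd r0 rs hM EK hG cG tn hX hU rp hpot.
have s0 : 0 < sigma by lra.
have d31 : 1 <= 3 ^ d by apply: pow_R1_Rle; lra.
have sM : sigma <= M by nra.
have M0 : 0 < M by lra.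
have Ms1 : 1 <= M / sigma by apply: div_ge1.
have sr1 : 1 <= sigma / rho by apply: div_ge1.
pose Mm := nfloor (sigma / rho).
have hK2 : M / sigma / 2 <= INR K by rewrite EK; apply: nfloor_half.
have hM2 : sigma / rho / 2 <= INR Mm by apply: nfloor_half.
have [hK1 _] := nfloorP (ltac:(lra) : 0 <= M / sigma); rewrite -EK in hK1.
have [hM1 _] := nfloorP (ltac:(lra) : 0 <= sigma / rho); rewrite -/Mm in hM1.
have K0 : (0 < K)%N by apply/ssrnat.ltP/INR_lt; rewrite /=; lra.
have i0 : 'I_n by exists d.
pose grid := {ffun 'I_n -> 'I_K}.
have /choice [I hI] : forall g : grid, exists I : 'I_d -> 'I_n, g \in G ->
   (forall Q Q' t, AffOf n d (x g) Q -> AffOf n d (x g) Q' -> 0 <= t ->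
      (forall j, Rabs (Q (I j) - Q' (I j)) <= t) ->
      forall i, (i < n)%N -> Rabs (Q i - Q' i) <= 3 ^ d * t) /\
   (forall Q (t : 'I_d -> R), AffOf n d (x g) Q ->
      exists Q', AffOf n d (x g) Q' /\ forall j, Q' (I j) = Q (I j) + t j).
  move=> g; have [gG|gG] := boolP (g \in G); last by exists (fun _ => i0).
  have [lg [cg _]] := hG g gG.
  by have [I hI] := affine_coordinates lg cg; exists I.
have /choice [p hp] : forall s : grid * {ffun 'I_d -> 'I_Mm}, exists p, s.1 \in G ->
    AffOf n d (x s.1) p /\ forall j, p (I s.1 j) = P s.1 (I s.1 j) + rho * INR (s.2 j).
  move=> [g m] /=; have [gG|gG] := boolP (g \in G); last by exists (P g).
  have [_ [_ [aP _]]] := hG g gG; have [_ h2] := hI g gG.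
  by have [Q hQ] := h2 (P g) (fun j => rho * INR (m j)) aP; exists Q.
have hp1 s i : s.1 \in G -> (i < n)%N -> Rabs (p s i - P s.1 i) <= 3 ^ d * sigma.
  move=> tG; have [aQ hQ] := hp s tG; have [_ [_ [aP _]]] := hG _ tG.
  have [h1 _] := hI _ tG; apply: h1 => // [|j]; first lra.
  rewrite hQ; have -> : P s.1 (I s.1 j) + rho * INR (s.2 j) - P s.1 (I s.1 j) = rho * INR (s.2 j)
    by ring.
  have m0 := pos_INR (s.2 j); have m1 := leq_INR (ltnW (ltn_ord (s.2 j))).
  rewrite Rabs_pos_eq; last by apply: Rmult_le_pos; lra.
  have -> : sigma = rho * (sigma / rho) by field; lra.
  by apply: Rmult_le_compat_l; lra.
have hp2 s i : s.1 \in G -> (i < n)%N -> Rabs (p s i - gpt c M s.1 i) <= (1 + 3 ^ d) * sigma.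
  move=> tG hi; have := hp1 s i tG hi; have [_ [_ [_ h]]] := hG _ tG; have := h i hi.
  move: (p s i) (P s.1 i) (gpt c M s.1 i) => u v w h1 h2.
  have -> : (1 + 3 ^ d) * sigma = 3 ^ d * sigma + sigma by ring.
  by split_Rabs; lra.
have hp3 s y : s.1 \in G -> cube n (p s) rho y -> cube n c M y.
  move=> tG [vy hy]; split=> // i hi.
  have h1 := hy i hi; have h2 := hp2 s i tG hi; have h3 := gpt_half c s.1 (Rlt_le _ _ M0) hi.
  by move: h1 h2 h3; move: (p s i) (gpt c M s.1 i) => u v; split_Rabs; lra.
pose J := [set t : grid * {ffun 'I_d -> 'I_Mm} | t.1 \in G].
have cJ : INR #|J| = INR #|G| * INR Mm ^ d.
  have -> : J = setX G [set: {ffun 'I_d -> 'I_Mm}].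
    by apply/setP => -[g m]; rewrite !inE andbT.
  by rewrite cardsX mult_INR cardsT card_ffun !card_ord INR_expn.
have M0' := pow_le (INR Mm) d (pos_INR _).
pose two := 2 ^ (1 + n + d).
have two0 : 0 < two by apply: pow_lt; lra.
(* Rounding costs $2^n$ on the grid and $2^d$ on the planes, and restriction to [G] costs 2. *)
have J1 : (M / sigma) ^ n * (sigma / rho) ^ d <= two * INR #|J|.
  rewrite cJ /two !pow_add pow_1.
  have e1 : (M / sigma) ^ n <= 2 ^ n * (2 * INR #|G|).
    apply: Rle_trans (_ : 2 ^ n * INR K ^ n <= _).
      by rewrite -Rpow_mult_distr; apply: pow_incr; lra.
    by apply: Rmult_le_compat_l; [apply: pow_le; lra | lra].
  have e2 : (sigma / rho) ^ d <= 2 ^ d * INR Mm ^ d.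
    by rewrite -Rpow_mult_distr; apply: pow_incr; lra.
  have -> : 2 * 2 ^ n * 2 ^ d * (INR #|G| * INR Mm ^ d) = (2 ^ n * (2 * INR #|G|))
    * (2 ^ d * INR Mm ^ d) by ring.
  by apply: Rmult_le_compat => //; apply: pow_le; lra.
have Jpos : 0 < INR #|J|.
  have : 0 < (M / sigma) ^ n * (sigma / rho) ^ d by apply: Rmult_lt_0_compat; apply: pow_lt; lra.
  by move=> h; nra.
have hX1 : Rpower (M / rho) t <= (M / sigma) ^ n * (sigma / rho) ^ d.
  have h8 : 1 <= stepC n d.
    have : 1 <= 2 ^ (1 + n + d) by apply: pow_R1_Rle; lra.
    by have := smallC_ge1 n d; rewrite /stepC; nra.
  by have := Rpower_gt0 (M / rho) t; nra.
have [kc1 [kc2 kc3]] := killC_ge n d.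
pose hitj j := @hit n d K Mm rho G p (U j).
(* Above [sigma] the set is seen in dimension [n], and $(r/M)^n \le (r/M)^t$. Below [sigma] it is
   seen in dimension [d], and [fine_scale_ratio] compares with the total number of children. *)
have kill j : rho <= r j < M -> INR #|hitj j| <= killC n d * Rpower (r j / M) t * INR #|J|.
  move=> [rj1 rj2].
  have P0 := Rpower_gt0 (r j / M) t.
  have [hs|hs] := Rle_lt_dec sigma (r j).
    have := hit_large M0 r0 rs K0 hK1 hp2 (hU j) rj1 hs; rewrite -/(hitj j) => h.
    apply: Rle_trans h _; rewrite cJ.
    have e : (r j / M) ^ n <= Rpower (r j / M) t.
      by apply: Rpower_le1_ge_pow; [split; [apply: Rdiv_lt_0_compat | apply: div_le1; lra] | lra].
    apply: Rle_trans (_ : (2 * (2 * gridC d) ^ n) * (r j / M) ^ n * ((M / sigma / 2)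
      ^ n / 2 * INR Mm ^ d) <= _).
      apply: Req_le.
      have -> : (gridC d * (r j / sigma)) ^ n = (2 * gridC d) ^ n * (r j / M)
        ^ n * (M / sigma / 2) ^ n.
        by rewrite -!Rpow_mult_distr; congr (_ ^ _); field; lra.
      by field.
    have g1 := gridC_ge1 d.
    have q1 : 0 <= (2 * gridC d) ^ n by apply: pow_le; lra.
    have q2 : 0 <= (r j / M) ^ n by apply/pow_le/Rlt_le/Rdiv_lt_0_compat.
    have q3 : 0 <= (M / sigma / 2) ^ n by apply: pow_le; lra.
    have q4 : (M / sigma / 2) ^ n <= INR K ^ n by apply: pow_incr; lra.
    apply: Rmult_le_compat; [nra | nra | apply: Rmult_le_compat; nra | apply: Rmult_le_compat; nra].
  have := hit_small M0 r0 rs K0 hK1 hp2 (fun s j tG => proj2 (hp s tG) j) (hU j)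
    rj1 (Rlt_le _ _ hs).
  rewrite -/(hitj j) => h; apply: Rle_trans h _.
  have f := fine_scale_ratio (d := d) r0 rj1 (Rlt_le _ _ hs) sM tn hX1.
  have -> : gridC d ^ n * (7 * (r j / rho)) ^ d = smallC n d * (r j / rho) ^ d.
    by rewrite Rpow_mult_distr /smallC; ring.
  have sc := smallC_ge1 n d.
  apply: Rle_trans (_ : smallC n d * (Rpower (r j / M) t * (two * INR #|J|)) <= _).
    apply: Rmult_le_compat_l; first lra.
    by apply: Rle_trans f _; apply: Rmult_le_compat_l; lra.
  have -> : smallC n d * (Rpower (r j / M) t * (two * INR #|J|)) = (smallC n d * two)
    * (Rpower (r j / M) t * INR #|J|) by ring.
  by rewrite [X in _ <= X]Rmult_assoc; apply: Rmult_le_compat_r => //; nra.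
have small j : r j < rho -> INR #|hitj j| <= smallC n d.
  move=> rj.
  have hU' : diam_le n (U j) rho by move=> a b ha hb; have := hU j a b ha hb; lra.
  have := hit_small M0 r0 rs K0 hK1 hp2 (fun s j tG => proj2 (hp s tG) j) hU' (Rle_refl _) rs.
  rewrite -/(hitj j); have -> : 7 * (rho / rho) = 7 by field; lra.
  by [].
have hit_meets j s : s \in hitj j -> meets n (U j) c M.
  rewrite inE => /andP[tG /asboolP[y [Uy cy]]]; exists y; split=> //; exact: hp3 cy.
pose isj j := `[< r j < M /\ meets n (U j) c M >].
have kap0 : 0 < kappa0 n d by apply/Rinv_0_lt_compat; lra.
pose bad1 N := [set s in J | [exists j : 'I_N, `[< rho <= r j < M >] && (s \in hitj j)]].
have cbad1 N : INR #|bad1 N| <= INR #|J| / 4.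
  rewrite INR_card.
  apply: Rle_trans (_ : \big[Rplus/0]_(s in J) \Sum_(j < N) (if `[< rho <= r j < M >]
    && (s \in hitj j) then 1 else 0) <= _).
    have E : \big[Rplus/0]_(s in bad1 N) 1 = \big[Rplus/0]_(s in J)
      (if [exists j : 'I_N, `[< rho <= r j < M >] && (s \in hitj j)] then 1 else 0).
      by rewrite -big_mkcondr; apply: eq_bigl => s; rewrite !inE.
    rewrite E; apply: sum_le_in => s _; case: existsP => [[j hj]|_].
      apply: Rle_trans (sum_ge_term (f := fun j : 'I_N => if `[< rho <= r j < M >]
        && (s \in hitj j) then 1 else 0) j _).
        by rewrite hj; lra.
      by move=> l; case: ifP => _; lra.
    by apply: sum_ge0 => l; case: ifP => _; lra.
  rewrite (sum_swap_card J (fun _ => 1)).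
  apply: Rle_trans (_ : \Sum_(j < N) (killC n d * INR #|J| * (if isj j then Rpower (r j / M)
    t else 0)) <= _).
    apply: sum_le => j; rewrite Rmult_1_l.
    case: (asboolP (rho <= r j < M)) => hj; last first.
      have -> : [set s in J | false && (s \in hitj j)] = set0.
        by apply/setP => s; rewrite !inE andbF.
      rewrite cards0 [INR 0]/=; apply: Rmult_le_pos; first nra.
      by case: ifP => _; [apply/Rlt_le/Rpower_gt0 | lra].
    have [h0|[s0' hs0]] := set_0Vmem (hitj j).
      have -> : [set s in J | true && (s \in hitj j)] = set0.
        by apply/setP => s; rewrite h0 !inE !andbF.
      rewrite cards0 [INR 0]/=; apply: Rmult_le_pos; first nra.
      by case: ifP => _; [apply/Rlt_le/Rpower_gt0 | lra].
    have -> : isj j by apply/asboolP; split; [case: hj | apply: hit_meets hs0].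
    apply: Rle_trans (leq_INR (subset_leq_card _)) (Rle_trans _ _ _ (kill j hj) _).
      by apply/subsetP => s; rewrite inE => /andP[].
    by apply: Req_le; ring.
  rewrite sum_scal; have := hpot N; rewrite /potential -/(isj _) => hN.
  apply: Rle_trans (_ : killC n d * INR #|J| * kappa0 n d <= _).
    by apply: Rmult_le_compat_l => //; nra.
  by apply: Req_le; rewrite /kappa0; field; lra.
pose bad2 N := [set s in J | `[< kappa0 n d / 2 < potential n U r t (p s) rho N >]].
have pot_term0 c' M' j : 0 <= (if `[< r j < M' /\ meets n (U j) c' M' >] then Rpower (r j / M')
  t else 0).
  by case: ifP => _; [apply/Rlt_le/Rpower_gt0 | lra].
have cbad2 N : INR #|bad2 N| <= INR #|J| / 4.
  (* After exchanging the sums, each set smaller than [rho] is counted at most [smallC] times, and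
     passing from parent to child multiplies its term by $(M/\rho)^t$. *)
  have hsum : \big[Rplus/0]_(s in J) potential n U r t (p s) rho N <=
     smallC n d * Rpower (M / rho) t * kappa0 n d.
    have E : \big[Rplus/0]_(s in J) potential n U r t (p s) rho N =
        \big[Rplus/0]_(s in J) \Sum_(j < N) (if `[< r j < rho >] && (s \in hitj j)
          then Rpower (r j / rho) t else 0).
      apply: eq_bigr => s sJ; apply: eq_bigr => j _.
      have -> : `[< r j < rho /\ meets n (U j) (p s) rho >] = `[< r j < rho >] && (s \in hitj j)
        => //.
      have sG : s.1 \in G by move: sJ; rewrite inE.
      by rewrite inE sG /=; apply/asboolP/andP => -[/asboolP h1 /asboolP h2].
    rewrite E (sum_swap_card J (fun j : 'I_N => Rpower (r j / rho) t)).
    apply: Rle_trans (_ : \Sum_(j < N) (smallC n d * Rpower (M / rho)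
      t * (if isj j then Rpower (r j / M) t else 0)) <= _).
      have C0 : 0 <= smallC n d * Rpower (M / rho) t.
        by apply: Rmult_le_pos; [have := smallC_ge1 n d; lra | apply/Rlt_le/Rpower_gt0].
      apply: sum_le => j.
      case: (asboolP (r j < rho)) => hj; last first.
        have -> : [set s in J | false && (s \in hitj j)] = set0.
          by apply/setP => s; rewrite !inE andbF.
        rewrite cards0 Rmult_0_r; apply: Rmult_le_pos => //.
        by case: ifP => _; [apply/Rlt_le/Rpower_gt0 | lra].
      have [h0|[s0' hs0]] := set_0Vmem (hitj j).
        have -> : [set s in J | true && (s \in hitj j)] = set0.
          by apply/setP => s; rewrite h0 !inE !andbF.
        rewrite cards0 Rmult_0_r; apply: Rmult_le_pos => //.
        by case: ifP => _; [apply/Rlt_le/Rpower_gt0 | lra].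
      have -> : isj j by apply/asboolP; split; [lra | apply: hit_meets hs0].
      have -> : smallC n d * Rpower (M / rho) t * Rpower (r j / M) t = Rpower (r j / rho)
        t * smallC n d.
        rewrite Rmult_assoc Rpower_mult_distr; [|exact: Rdiv_lt_0_compat|exact: Rdiv_lt_0_compat].
        by rewrite Rmult_comm; congr (Rpower _ _ * _); field; lra.
      apply: Rmult_le_compat_l; first exact/Rlt_le/Rpower_gt0.
      apply: Rle_trans (leq_INR (subset_leq_card _)) (small j hj).
      by apply/subsetP => s; rewrite inE => /andP[].
    rewrite sum_scal; apply: Rmult_le_compat_l; last exact: hpot.
    by apply: Rmult_le_pos; [have := smallC_ge1 n d; lra | apply/Rlt_le/Rpower_gt0].
  have hlow : INR #|bad2 N| * (kappa0 n d / 2) <= \big[Rplus/0]_(s in J) potential n U r t (p s)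
    rho N.
    have E : INR #|bad2 N| * (kappa0 n d / 2) = \big[Rplus/0]_(s in J)
       (if `[< kappa0 n d / 2 < potential n U r t (p s) rho N >] then kappa0 n d / 2 else 0).
      rewrite INR_card big_distrl /= -big_mkcondr.
      by apply: eq_big => [s|s _]; rewrite ?inE // Rmult_1_l.
    rewrite E; apply: sum_le_in => s _; case: asboolP => h; first lra.
    by apply: sum_ge0 => j; apply: pot_term0.
  have hfin : smallC n d * Rpower (M / rho) t * 8 <= INR #|J|.
    have := Rle_trans _ _ _ hX J1; rewrite /stepC -/two => h.
    by apply: (Rmult_le_reg_l two) => //; lra.
  apply: (Rmult_le_reg_r (kappa0 n d / 2)); first lra.
  apply: Rle_trans hlow _; apply: Rle_trans hsum _.
  by nra.
have [|N1 hN1] := @finite_witness _ (fun s N => s \in bad1 N).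
  move=> s N N' NN'; rewrite !inE => /andP[-> /existsP[j hj]]; apply/existsP.
  by exists (widen_ord NN' j).
have pot_mono s N N' : (N <= N')%N -> potential n U r t (p s) rho N <= potential n U r t (p s)
  rho N'.
  move=> /subnK <-; rewrite addnC /potential big_split_ord /=.
  rewrite -[X in X <= _]Rplus_0_r; apply: Rplus_le_compat_l.
  by apply: sum_ge0 => j; apply: pot_term0.
have [|N2 hN2] := @finite_witness _ (fun s N => s \in bad2 N).
  move=> s N N' NN'; rewrite !inE => /andP[-> /asboolP h]; apply/asboolP.
  exact: Rlt_le_trans h (pot_mono _ _ _ NN').
have [s [sJ s1 s2]] : exists s, [/\ s \in J, s \notin bad1 N1 & s \notin bad2 N2].
  apply: contrapT => hn.
  have /subset_leq_card/leq_INR : J \subset bad1 N1 :|: bad2 N2.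
    apply/subsetP => s sJ; apply: contrapT => /negP; rewrite inE negb_or => /andP[h1 h2].
    by apply: hn; exists s.
  have /leq_INR := leq_card_setU (bad1 N1) (bad2 N2); rewrite plus_INR.
  by have := cbad1 N1; have := cbad2 N2; lra.
have sG : s.1 \in G by move: sJ; rewrite inE.
exists s.1, (p s); split=> //; split; first by case: (hp s sG).
split; first by move=> i; apply: hp2.
split.
  move=> j hj hm; move/negP: s1; apply; apply: hN1; exists j.+1.
  rewrite inE sJ /=; apply/existsP; exists ord_max; apply/andP; split; first exact/asboolP.
  by rewrite inE sG; apply/asboolP.
move=> N; apply: Rnot_lt_le => h; move/negP: s2; apply; apply: hN2; exists N.
by rewrite inE sJ; apply/asboolP.
Qed.

(* [q n] is the constant term. *)
Definition hyperplane n (q : nat -> R) (y : nat -> R) : Prop :=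
  q n + \Sum_(i < n) (q i * y i) = 0.

(** Solving for the coordinate with the largest coefficient expresses it through the others with
    coefficients of modulus at most 1. *)
Lemma hyperplane_thin n q : (exists i, (i < n.+1)%N /\ q i <> 0) ->
  exists I : 'I_n -> 'I_n.+1, thin (INR n.+1) (hyperplane n.+1 q) I.
Proof.
move=> [i1 [hi1 qi1]].
have [i0 hi0] : exists i0 : 'I_n.+1, forall i : 'I_n.+1, Rabs (q i) <= Rabs (q i0).
  case: (@Order.TotalTheory.arg_maxP _ R _ (Ordinal hi1) xpredT (fun i : 'I_n.+1 => Rabs (q i))
    isT) => i0 _ h.
  by exists i0 => i; apply/RleP; apply: h.
have q0 : 0 < Rabs (q i0) by apply: Rlt_le_trans (hi0 (Ordinal hi1)); apply: Rabs_pos_lt.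
exists (lift i0) => P P' t hP hP' t0 ht i hi.
have n1 : 1 <= INR n.+1 by rewrite S_INR; have := pos_INR n; lra.
rewrite -[i]/(nat_of_ord (Ordinal hi)); case: (unliftP i0 (Ordinal hi)) => [j ->|->].
  by apply: Rle_trans (ht j) _; nra.
move: hP hP'; rewrite /hyperplane !(bigD1_ord i0) // => hP hP'.
have E : q i0 * (P i0 - P' i0) = - \Sum_(j < n) (q (lift i0 j) * (P (lift i0 j) - P' (lift i0 j))).
  have -> : \Sum_(j < n) (q (lift i0 j) * (P (lift i0 j) - P' (lift i0 j))) =
     \Sum_(j < n) (q (lift i0 j) * P (lift i0 j)) + (-1) * \Sum_(j < n) (q (lift i0 j)
       * P' (lift i0 j)).
    by rewrite -sum_scal -big_split /=; apply: eq_bigr => j _; ring.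
  have aux (a b u v S S' : R) : a + (b * u + S) = 0 -> a + (b * v + S') = 0 ->
    b * (u - v) = - (S + -1 * S') by move=> *; lra.
  exact: aux hP hP'.
have hs : Rabs (\Sum_(j < n) (q (lift i0 j) * (P (lift i0 j) - P' (lift i0 j)))) <= \Sum_(j < n)
  (Rabs (q i0) * t).
  elim/big_ind2: _ => [|a b a' b' h1 h2|j _]; first by rewrite Rabs_R0; lra.
    by apply: Rle_trans (Rabs_triang _ _) _; lra.
  rewrite Rabs_mult; apply: Rmult_le_compat; try exact: Rabs_pos; [exact: hi0 | exact: ht].
apply: (Rmult_le_reg_l (Rabs (q i0))) => //.
rewrite -Rabs_mult E Rabs_Ropp; apply: Rle_trans hs _; rewrite sum_const.
apply: Rle_trans (_ : INR n.+1 * (Rabs (q i0) * t) <= _); last by apply: Req_le; ring.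
apply: Rmult_le_compat_r; first by apply: Rmult_le_pos; lra.
exact: leq_INR.
Qed.

Lemma grid_hyperplane n q c M K delta : (exists i, (i < n)%N /\ q i <> 0) ->
  0 < M -> (0 < K)%N -> M / INR K <= delta -> delta <= M ->
  INR #|[set k : {ffun 'I_n -> 'I_K} | `[< near n (hyperplane n q) delta (gpt c M k) >]]| <=
   3 ^ n.-1 * (3 * (3 * INR n + 2)) ^ n * (INR K ^ n * (delta / M)).
Proof.
case: n => [[i [//]]|n] hq M0 K0 h1 h2.
have [I hI] := hyperplane_thin hq.
have n1 : 1 <= INR n.+1 by rewrite S_INR; have := pos_INR n; lra.
have := grid_near c (ltnSn n) hI n1 M0 K0 h1 h2.
by rewrite subSnn pow_1.
Qed.

(** * Planes of low height and the choice of a large parameter *)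

Definition for_large (Q : R -> Prop) := exists x0, forall x, x0 <= x -> Q x.

Lemma for_large_and P Q : for_large P -> for_large Q -> for_large (fun x => P x /\ Q x).
Proof.
move=> [a ha] [b hb]; exists (Rmax a b) => x hx.
by have := Rmax_l a b; have := Rmax_r a b => h1 h2; split; [apply: ha | apply: hb]; lra.
Qed.

Lemma for_large_ge a : for_large (fun x => a <= x).
Proof. by exists a. Qed.

Lemma for_large_power A a : 0 < a -> for_large (fun x => A * Rpower x (- a) <= 1).
Proof.
move=> a0; pose A' := Rmax A 1.
have A1 : 1 <= A' by apply: Rmax_r.
exists (Rpower A' (/ a)) => x hx.
have x0 : 0 < x by apply: Rlt_le_trans hx; apply: Rpower_gt0.
have h : A' <= Rpower x a.
  have -> : A' = Rpower (Rpower A' (/ a)) a by rewrite Rpower_mult Rinv_l ?Rpower_1; lra.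
  by apply: Rpower_base_le => //; [lra | apply: Rpower_gt0].
rewrite Rpower_Ropp; have p0 := Rpower_gt0 x a.
apply: (Rmult_le_reg_r (Rpower x a)) => //.
rewrite Rmult_assoc Rinv_l; last lra.
by have := Rmax_l A 1; rewrite -/A'; lra.
Qed.

(** A grid point counted here is within about $Q^{-w_c}/N$ of a plane of row product $N \ll
    Q^{1-e}$, so [grid_near] allows $K^n (Q^{-w_c}/N)^{n-d}$ grid points for that plane. Summing
    $N^{-(n-d)}$ by [rowprod_sum], with $e'$ such that $(n+1)(1+e') = n+1+e$, leaves $K^n$ times $Q$
    to the power $-(d+1) + (1-e)(d+1+e) = -(ed+e^2)$, up to a constant. *)
Lemma low_height_count n d (hd : (d < n)%N) c M C1 e : 0 < M -> 0 < C1 -> 0 < e <= 1 ->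
  for_large (fun Q => forall K (x : {ffun 'I_n -> 'I_K} -> nat -> nat -> Z)
    (P : {ffun 'I_n -> 'I_K} -> nat -> R),
    (0 < K)%N ->
    M / INR K <= 2 * (C1 * Rpower Q (- (INR d.+1 / INR (n - d) + 1 - e))) ->
    (forall g, RatAffData n d (x g) /\ AffOf n d (x g) (P g) /\
       forall i, (i < n)%N -> height n d (x g) * Rabs (gpt c M g i - P g i)
         <= C1 * Rpower Q (- (INR d.+1 / INR (n - d)))) ->
    INR #|[set g | `[< height n d (x g) <= Rpower Q (1 - e) >]]| <= INR K ^ n / 4).
Proof.
move=> M0 C10 [e0 e1].
have nd0 : 0 < INR (n - d) by apply/lt_0_INR/ssrnat.ltP; rewrite subn_gt0.
set wc := INR d.+1 / INR (n - d).
have d10 : 0 < INR d.+1 by rewrite S_INR; have := pos_INR d; lra.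
have wc0 : 0 < wc by apply: Rdiv_lt_0_compat.
have n10 : 0 < INR n.+1 by rewrite S_INR; have := pos_INR n; lra.
pose e' := e / INR n.+1.
have e'0 : 0 < e' by apply: Rdiv_lt_0_compat.
have Ep : INR n.+1 * (1 + e') = INR n.+1 + e by rewrite /e'; field; lra.
have nsum : INR n.+1 = INR (n - d) + INR d.+1.
  by rewrite -plus_INR; congr INR; lia.
have tau_le : INR (n - d) <= INR n.+1 * (1 + e') by rewrite Ep; lra.
have [Z [Zp hZ]] := rowprod_sum d e'0 tau_le.
have [I hI] := plane_thin hd.
pose C2 := sqrt (2 ^ (d.+1 * d.+1)).
have C21 : 1 <= C2 by rewrite -sqrt_1; apply: sqrt_le_1_alt; apply: pow_R1_Rle; lra.
pose A2 := 3 ^ d * (3 * (3 * 3 ^ d + 2)) ^ n.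
have d3 : 1 <= 3 ^ d by apply: pow_R1_Rle; lra.
have A20 : 0 < A2 by apply: Rmult_lt_0_compat; apply: pow_lt; lra.
pose m := (n - d)%N.
pose B := 4 * (A2 * (2 * C1 * C2 / M) ^ m * (Z * Rpower C2 (INR d.+1 + e))).
have a0 : 0 < e * INR d + e * e by have := pos_INR d; nra.
have [q1 hq1] := for_large_power B a0.
have [q2 hq2] := for_large_power (2 * C1 * C2 / M) wc0.
exists (Rmax 1 (Rmax q1 q2)) => Q hQ.
have Q1 : 1 <= Q by apply: Rle_trans hQ; apply: Rmax_l.
have hB : B * Rpower Q (- (e * INR d + e * e)) <= 1.
  by apply: hq1; apply: Rle_trans hQ; apply: Rle_trans (Rmax_r _ _); apply: Rmax_l.
have hd2 : 2 * C1 * C2 / M * Rpower Q (- wc) <= 1.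
  by apply: hq2; apply: Rle_trans hQ; apply: Rle_trans (Rmax_r _ _); apply: Rmax_r.
move=> K x P K0 hK hx.
have K0' : 0 < INR K by apply/lt_0_INR/ssrnat.ltP.
have Kn : 0 < INR K ^ n by apply: pow_lt.
have Qe1 : 1 <= Rpower Q (1 - e) by rewrite -[X in X <= _](Rpower_O Q); [apply: Rpower_expo_le;
  lra | lra].
pose Y := C2 * Rpower Q (1 - e).
have Y1 : 1 <= Y by rewrite /Y; nra.
have Qp := Rpower_gt0 Q (- wc).
pose Mi := (nfloor Y).+1.
pose N (g' : intmx n d Mi) := rowprod n d (zmx g').
have N1 g' : 1 <= N g' by apply: rowprod_ge1.
(* Twice what the distance requires: the grid step is only known to be at most twice $C_1
   Q^{-(w_c+1-e)}$, and [grid_near] needs it to be at most [delta g']. *)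
pose delta (g' : intmx n d Mi) := 2 * C1 * C2 * Rpower Q (- wc) / N g'.
pose nearset (g' : intmx n d Mi) : {set {ffun 'I_n -> 'I_K}} :=
  [set k | `[< thin (3 ^ d) (AffOf n d (zmx g')) (I (zmx g')) >]
    && `[< near n (AffOf n d (zmx g')) (delta g') (gpt c M k) >]].
have cnear g' : N g' <= Y -> INR #|nearset g'| <= A2 * (INR K ^ n * (delta g' / M) ^ m).
  move=> NY; have Ng := N1 g'.
  have del0 : 0 < delta g' by apply: Rdiv_lt_0_compat; [apply: Rmult_lt_0_compat => //; nra | lra].
  have h1 : M / INR K <= delta g'.
    apply: Rle_trans hK _; rewrite /delta -/wc.
    have -> : - (wc + 1 - e) = - wc + - (1 - e) by ring.
    rewrite Rpower_plus [Rpower Q (- (1 - e))]Rpower_Ropp.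
    have NY2 : N g' <= C2 * Rpower Q (1 - e) by [].
    move: (Rpower Q (1 - e)) Qe1 NY2 => y y1 NY2.
    have -> : 2 * C1 * C2 * Rpower Q (- wc) / N g' = 2 * (C1 * (Rpower Q (- wc) * (C2 / N g')))
      by field; lra.
    do 2!(apply: Rmult_le_compat_l; first lra); apply: Rmult_le_compat_l; first lra.
    apply: (Rmult_le_reg_r (N g')); first lra.
    have -> : C2 / N g' * N g' = C2 by field; lra.
    apply: (Rmult_le_reg_l y); first lra.
    by have -> : y * (/ y * N g') = N g' by [field; lra]; rewrite Rmult_comm.
  have h2 : delta g' <= M.
    apply: Rle_trans (_ : 2 * C1 * C2 * Rpower Q (- wc) <= _).
      have p0 : 0 < 2 * C1 * C2 * Rpower Q (- wc) by apply: Rmult_lt_0_compat => //; nra.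
      rewrite /delta -[X in _ <= X]Rmult_1_r; apply: Rmult_le_compat_l; first lra.
      by rewrite -Rinv_1; apply: Rinv_le_contravar; lra.
    have -> : 2 * C1 * C2 * Rpower Q (- wc) = M * (2 * C1 * C2 / M * Rpower Q (- wc)) by field; lra.
    by rewrite -[X in _ <= X]Rmult_1_r; apply: Rmult_le_compat_l; lra.
  have [ht|ht] := pselect (thin (3 ^ d) (AffOf n d (zmx g')) (I (zmx g'))).
    apply: Rle_trans (grid_near c hd ht d3 M0 K0 h1 h2); apply: leq_INR; apply: subset_leq_card.
    by apply/subsetP => k; rewrite !inE => /andP[].
  have -> : nearset g' = set0.
    by apply/setP => k; rewrite !inE; case: asboolP.
  rewrite cards0 [INR 0]/=; apply: Rmult_le_pos; first lra.
  by apply: Rmult_le_pos; [lra | apply/pow_le/Rlt_le/Rdiv_lt_0_compat].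
have cover : [set g | `[< height n d (x g) <= Rpower Q (1 - e) >]] \subset
    \bigcup_(g' | `[< N g' <= Y >]) nearset g'.
  apply/subsetP => g; rewrite inE => /asboolP hg.
  have [rx [aP hP]] := hx g.
  have h1 := height_ge1 (proj1 rx).
  have [y [ly [affy [cy hrow]]]] := reduced_rep rx.
  have hY : rowprod n d y <= Y by apply: Rle_trans hrow _; rewrite -/C2;
    apply: Rmult_le_compat_l; lra.
  have [g' hg'] : exists g' : intmx n d Mi, forall i l, (i <= d)%N -> (l <= n)%N -> zmx g' i l =
    y i l.
    apply: zmx_exists => i l hi hl; apply: Rle_trans (rmax_ge y i hl) _.
    apply: Rle_trans (rmax_le_rowprod _ _ hi) _; apply: Rle_trans hY _.
    by rewrite /Mi S_INR; have := nfloorP (Rle_trans _ _ _ Rle_0_1 Y1); lra.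
  have ET := toM_ext hg'.
  have EN : N g' = rowprod n d y by apply: rowprod_ext.
  apply/bigcupP; exists g'; first by apply/asboolP; rewrite EN.
  rewrite inE; apply/andP; split; apply/asboolP.
    apply: hI; first by apply/RLinIndepE; rewrite ET; apply/RLinIndepE.
    by apply/(col0_toM n); rewrite ET; apply/(col0_toM n).
  exists (P g); split; first by apply/(AffOf_ext _ ET); apply/affy.
  move=> i hi; have hPi := hP i hi.
  set h := height n d (x g) in h1 hg hPi hrow *.
  apply: Rle_trans (_ : C1 * Rpower Q (- wc) / h <= _).
    apply: (Rmult_le_reg_l h); first lra.
    by have -> : h * (C1 * Rpower Q (- wc) / h) = C1 * Rpower Q (- wc) by [field; lra].
  have Ng := N1 g'.
  have -> : delta g' = C1 * Rpower Q (- wc) * (2 * C2 / N g') by rewrite /delta; field; lra.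
  apply: Rmult_le_compat_l; first by apply: Rmult_le_pos; lra.
  apply: (Rmult_le_reg_r (N g')); first lra.
  have -> : 2 * C2 / N g' * N g' = 2 * C2 by field; lra.
  apply: (Rmult_le_reg_l h); first lra.
  have -> : h * (/ h * N g') = N g' by field; lra.
  by rewrite EN; move: hrow; rewrite -/C2; nra.
apply: Rle_trans (leq_INR (subset_leq_card cover)) _.
apply: Rle_trans (_ : \big[Rplus/0]_(g' | `[< N g' <= Y >]) INR #|nearset g'| <= _).
  elim/big_ind2: _ => [|a s b s' h1 h2|g' _]; [by rewrite cards0 /=; lra | | exact: Rle_refl].
  by have /leq_INR := leq_card_setU s s'; rewrite plus_INR => h3;
    exact: Rle_trans h3 (Rplus_le_compat _ _ _ _ h1 h2).
apply: Rle_trans (sum_le_in (g := fun g' => A2 * INR K ^ n * (2 * C1 * C2 * Rpower Q (- wc) / M)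
  ^ m * Rpower (N g') (- INR m)) _) _.
  move=> g' /asboolP NY; apply: Rle_trans (cnear g' NY) _; apply: Req_le.
  have Ng := N1 g'.
  rewrite [Rpower (N g') _]Rpower_Ropp Rpower_pow; last lra.
  have -> : delta g' / M = 2 * C1 * C2 * Rpower Q (- wc) / M * / N g' by rewrite /delta; field; lra.
  by rewrite Rpow_mult_distr pow_inv; ring.
rewrite -big_distrr /=.
have pd0 : 0 <= A2 * INR K ^ n * (2 * C1 * C2 * Rpower Q (- wc) / M) ^ m.
  apply: Rmult_le_pos; first nra.
  by apply/pow_le/Rlt_le/Rdiv_lt_0_compat => //; apply: Rmult_lt_0_compat => //; nra.
apply: Rle_trans (Rmult_le_compat_l _ _ _ pd0 (hZ Mi Y Y1)) _.
rewrite Ep; have -> : INR n.+1 + e - INR (n - d) = INR d.+1 + e by lra.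
have -> : Rpower Y (INR d.+1 + e) = Rpower C2 (INR d.+1 + e) * Rpower Q ((1 - e) * (INR d.+1 + e)).
  by rewrite /Y -Rpower_mult_distr ?Rpower_mult; [| lra | apply: Rpower_gt0].
have -> : (2 * C1 * C2 * Rpower Q (- wc) / M) ^ m = (2 * C1 * C2 / M) ^ m * Rpower Q (- INR d.+1).
  have -> : 2 * C1 * C2 * Rpower Q (- wc) / M = 2 * C1 * C2 / M * Rpower Q (- wc) by field; lra.
  rewrite Rpow_mult_distr; congr (_ * _).
  rewrite -Rpower_pow // Rpower_mult; congr Rpower.
  by rewrite /wc /m; field; lra.
have -> : A2 * INR K ^ n * ((2 * C1 * C2 / M) ^ m * Rpower Q (- INR d.+1)) *
    (Z * (Rpower C2 (INR d.+1 + e) * Rpower Q ((1 - e) * (INR d.+1 + e)))) =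
   INR K ^ n / 4 * (B * (Rpower Q (- INR d.+1) * Rpower Q ((1 - e) * (INR d.+1 + e)))).
  by rewrite /B; field; lra.
rewrite -Rpower_plus.
have -> : - INR d.+1 + (1 - e) * (INR d.+1 + e) = - (e * INR d + e * e).
  by rewrite [INR d.+1]S_INR; ring.
rewrite -[X in _ <= X]Rmult_1_r; apply: Rmult_le_compat_l; first lra.
exact: hB.
Qed.

(** Here [sigma] is the distance from a grid point to its plane when the height exceeds $Q^{1-e}$,
    and $\rho = Q^{-(1+w)}$ makes height times distance at most $Q^{-w}$ up to a constant on the
    whole child. The loss [eta] absorbs that constant and the passage from $Q$ to $H = C_1 Q$. *)
Lemma nested_cube_step n d t w eta c M (U : nat -> (nat -> R) -> Prop) (r : nat -> R) q H0 :
  (d < n)%N -> INR d.+1 / INR (n - d) <= w -> 0 <= t <= INR n ->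
  (t - INR d) * (1 + w) < INR n.+1 -> 0 < eta -> 0 < M ->
  (forall j, diam_le n (U j) (r j)) -> (forall j, 0 < r j) ->
  (forall N, potential n U r t c M N <= kappa0 n d) ->
  (exists i, (i < n)%N /\ q i <> 0) ->
  exists c' M', 0 < M' <= M / 2 /\ (forall y, cube n c' M' y -> cube n c M y) /\
    (forall y, cube n c' M' y -> ~ hyperplane n q y) /\
    (forall j, M' <= r j < M -> ~ meets n (U j) c' M') /\
    (forall N, potential n U r t c' M' N <= kappa0 n d / 2) /\
    exists H x, H0 <= H /\ 1 <= H /\ RatAffData n d x /\ height n d x <= H /\
      forall y, cube n c' M' y -> exists P, AffOf n d x P /\
        height n d x * euclid n y P <= Rpower H (- (w - eta)).
Proof.
move=> hd hw tn hgap eta0 M0 hU rp hpot hq.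
have nd0 : 0 < INR (n - d) by apply/lt_0_INR/ssrnat.ltP; rewrite subn_gt0.
set wc := INR d.+1 / INR (n - d) in hw.
have d10 : 0 < INR d.+1 by rewrite S_INR; have := pos_INR d; lra.
have wc0 : 0 < wc by apply: Rdiv_lt_0_compat.
have n10 : 0 < INR n.+1 by rewrite S_INR; have := pos_INR n; lra.
have nn := pos_INR n.
pose m := (n - d)%N; rewrite -/m in nd0 wc wc0 hw.
have nsum : INR n.+1 = INR m + INR d.+1.
  by rewrite -plus_INR; congr INR; rewrite /m; lia.
pose gap := INR n.+1 - (t - INR d) * (1 + w).
have gap0 : 0 < gap by rewrite /gap; lra.
(* The loss of $Q^{e(n-d)}$ children is kept to half of the available exponent [gap], so [a5] stays
   positive. *)
pose e := Rmin 1 (gap / (2 * INR m)).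
have e0 : 0 < e by apply: Rmin_glb_lt; [lra | apply: Rdiv_lt_0_compat; lra].
have e1 : e <= 1 by apply: Rmin_l.
have em : e * INR m <= gap / 2.
  have h : e <= gap / (2 * INR m) by apply: Rmin_r.
  apply: Rle_trans (Rmult_le_compat_r _ _ _ (Rlt_le _ _ nd0) h) _.
  by apply: Req_le; field; lra.
(* A common bound for the coordinates of all points of the cube. The constants of [dirichlet] depend
   on it and must be fixed before [Q]. *)
pose S := \Sum_(i < n) (Rabs (c i) + M).
have S0 : 0 <= S by apply: sum_ge0 => i; have := Rabs_pos (c i); lra.
have [C [b0 [C0 [b01 hdir]]]] := dirichlet hd S0.
pose C1 := C + 1.
have C10 : 0 < C1 by rewrite /C1; lra.
pose s1 := wc + 1 - e.
have s10 : 0 < s1 by rewrite /s1; lra.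
have d31 : 1 <= 3 ^ d by apply: pow_R1_Rle; lra.
pose A3 := 3 ^ n.-1 * (3 * (3 * INR n + 2)) ^ n.
have A30 : 0 < A3 by apply: Rmult_lt_0_compat; apply: pow_lt; lra.
pose a5 := gap - e * INR m.
have a50 : 0 < a5 by rewrite /a5; lra.
have im0 : 0 < / INR m by apply: Rinv_0_lt_compat.
(* The requirements on [Q], in order: at least 1; [C1 * Q] beyond [H0] and 1; at most a quarter of
   the grid has planes of low height; at most a quarter is near the hyperplane; the hyperplane
   neighbourhood is no wider than the cube; children stay inside the parent; children are numerous
   enough; constants are absorbed by [eta]; the parameter of [dirichlet] passes its threshold. *)
have [X0 hX0] := for_large_and (for_large_ge 1)
  (for_large_and (for_large_ge (Rabs H0 / C1 + / C1))
  (for_large_and (low_height_count hd c M0 C10 (conj e0 e1))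
  (for_large_and (for_large_power (4 * (A3 * ((3 + 3 ^ d) * C1 / M))) s10)
  (for_large_and (for_large_power ((3 + 3 ^ d) * C1 / M) s10)
  (for_large_and (for_large_power (2 * ((2 + 3 ^ d) * C1 / M)) s10)
  (for_large_and (for_large_power (stepC n d * Rpower M t * C1 ^ m / M ^ n) a50)
  (for_large_and (for_large_power (C1 * INR n * Rpower C1 (w - eta)) eta0)
   (for_large_power b0 im0)))))))).
have [Q1 [hH [hbad [hE2 [hE3 [hE4 [hE5 [hE6 hE8]]]]]]]] := hX0 X0 (Rle_refl _).
move: X0 {hX0} Q1 hH hbad hE2 hE3 hE4 hE5 hE6 hE8 => Q Q1 hH hbad hE2 hE3 hE4 hE5 hE6 hE8.
have Q0 : 0 < Q by lra.
have Qp a := Rpower_gt0 Q a.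
pose sigma := C1 * Rpower Q (- s1).
have s0 : 0 < sigma by apply: Rmult_lt_0_compat.
pose rho := Rpower Q (- (1 + w)).
have r0 : 0 < rho by apply: Qp.
have rs : rho <= sigma.
  apply: Rle_trans (_ : 1 * Rpower Q (- s1) <= _); last by apply: Rmult_le_compat_r;
    [apply: Rlt_le | rewrite /C1; lra].
  by rewrite Rmult_1_l; apply: Rpower_expo_le => //; rewrite /s1; lra.
have sM4 : (2 + 3 ^ d) * sigma <= M / 2.
  apply: (Rmult_le_reg_l (2 / M)); first by apply: Rdiv_lt_0_compat; lra.
  have -> : 2 / M * (M / 2) = 1 by field; lra.
  apply: Rle_trans hE4; apply: Req_le; rewrite /sigma; field; lra.
have hM : rho + (1 + 3 ^ d) * sigma <= M / 2 by lra.
have sM : sigma <= M by nra.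
have Ms1 : 1 <= M / sigma by apply: div_ge1.
pose K := nfloor (M / sigma).
have hK2 : M / sigma / 2 <= INR K by apply: nfloor_half.
have K0 : (0 < K)%N by apply/ssrnat.ltP/INR_lt; rewrite /=; lra.
have K0' : 0 < INR K by apply/lt_0_INR/ssrnat.ltP.
have MK : M / INR K <= 2 * sigma.
  apply: (Rmult_le_reg_r (INR K)) => //.
  have -> : M / INR K * INR K = M by field; lra.
  apply: Rle_trans (_ : 2 * sigma * (M / sigma / 2) <= _); first by apply: Req_le; field; lra.
  by apply: Rmult_le_compat_l; lra.
(* Then $b^{n-d} = Q$ and $b^{d+1} = Q^{w_c}$, which puts [dirichlet] in terms of [Q]. *)
pose b := Rpower Q (/ INR m).
have b0b : b0 <= b.
  move: hE8; rewrite Rpower_Ropp -/b => h.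
  have bp : 0 < b by apply: Qp.
  apply: (Rmult_le_reg_r (/ b)); first exact: Rinv_0_lt_compat.
  by rewrite Rinv_r; lra.
have bm : b ^ m = Q.
  by rewrite -Rpower_pow; [rewrite /b Rpower_mult Rinv_l ?Rpower_1; lra | apply: Qp].
have bd : C / b ^ d.+1 <= C1 * Rpower Q (- wc).
  have -> : b ^ d.+1 = Rpower Q wc.
    rewrite -Rpower_pow; last exact: Qp.
    by rewrite /b Rpower_mult /wc; congr Rpower; rewrite Rmult_comm.
  rewrite Rpower_Ropp; apply: Rmult_le_compat_r; last by rewrite /C1; lra.
  by apply/Rlt_le/Rinv_0_lt_compat.
pose grid := {ffun 'I_n -> 'I_K}.
have /choice [x /choice [P hxP]]
  : forall g : grid, exists x, exists P, RatAffData n d x /\ height n d x <= C1 * Q /\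
    AffOf n d x P /\ forall i, (i < n)%N -> height n d x * Rabs (gpt c M g i - P i)
      <= C1 * Rpower Q (- wc).
  move=> g; have [|x [rx [hx [P [aP hP]]]]] := hdir (gpt c M g) b _ b0b.
    move=> i hi; have [_ /(_ i hi) h1] := gpt_cube c g (Rlt_le _ _ M0).
    have := sum_ge_term (f := fun i : 'I_n => Rabs (c i) + M) (Ordinal hi) _.
    rewrite -/S /= => h2.
    apply: Rle_trans (h2 _); last by move=> j; have := Rabs_pos (c j); lra.
    by move: h1; split_Rabs; lra.
  exists x, P; split=> //; split; last by split=> // i hi; apply: Rle_trans (hP i hi) bd.
  by apply: Rle_trans hx _; rewrite bm; apply: Rmult_le_compat_r; [lra | rewrite /C1; lra].
have cbad := hbad K x P K0 MK (fun g => conj (proj1 (hxP g)) (proj2 (proj2 (hxP g)))).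
(* All points of a child are within [(2 + 3 ^ d) * sigma] of its grid point, so a grid point farther
   than [dh] from the hyperplane has only children that miss it. *)
pose dh := (3 + 3 ^ d) * sigma.
have dhM : dh <= M.
  apply: (Rmult_le_reg_r (/ M)); first exact: Rinv_0_lt_compat.
  rewrite Rinv_r; last lra.
  by apply: Rle_trans hE3; apply: Req_le; rewrite /dh /sigma; field; lra.
have cq := grid_hyperplane c hq M0 K0 (ltac:(rewrite /dh; nra) : M / INR K <= dh) dhM.
have Kn : 0 < INR K ^ n by apply: pow_lt.
have cq2 : INR #|[set k : grid | `[< near n (hyperplane n q) dh (gpt c M k) >]]| <= INR K ^ n / 4.
  apply: Rle_trans cq _; rewrite -/A3.
  have -> : A3 * (INR K ^ n * (dh / M)) = INR K ^ n / 4 * (4 * (A3 * ((3 + 3 ^ d) * C1 / M))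
    * Rpower Q (- s1)).
    by rewrite /dh /sigma; field; lra.
  by rewrite -[X in _ <= X]Rmult_1_r; apply: Rmult_le_compat_l; [lra | exact: hE2].
set B1 := [set g | _] in cbad; set B2 := [set k | _] in cq2.
pose G := ~: (B1 :|: B2).
have cG : INR K ^ n / 2 <= INR #|G|.
  have e3 : (#|B1 :|: B2| + #|G|)%N = (K ^ n)%N by rewrite cardsC card_ffun !card_ord.
  have := congr1 INR e3; rewrite plus_INR INR_expn.
  have /leq_INR := leq_card_setU B1 B2; rewrite plus_INR; lra.
have hG g : g \in G -> Rpower Q (1 - e) < height n d (x g) /\ ~ near n (hyperplane n q)
  dh (gpt c M g).
  rewrite !inE negb_or => /andP[/asboolP h1 /asboolP h2]; split=> //; lra.
have X5 : stepC n d * Rpower (M / rho) t <= (M / sigma) ^ n * (sigma / rho) ^ d.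
  have e5 : stepC n d * Rpower M t * C1 ^ m / M ^ n <= Rpower Q a5.
    have qa := Qp a5; move: hE5; rewrite Rpower_Ropp => h.
    apply: (Rmult_le_reg_r (/ Rpower Q a5)); first exact: Rinv_0_lt_compat.
    by rewrite Rinv_r; lra.
  have Mn : 0 < M ^ n by apply: pow_lt.
  have Cm : 0 < C1 ^ m by apply: pow_lt.
  have -> : Rpower (M / rho) t = Rpower M t * Rpower Q ((1 + w) * t).
    rewrite -[Rpower Q ((1 + w) * t)]Rpower_mult Rpower_mult_distr //; congr Rpower.
    by rewrite /rho Rpower_Ropp /Rdiv Rinv_inv.
  have -> : (M / sigma) ^ n * (sigma / rho) ^ d = M ^ n * / C1 ^ m * (Rpower Q ((1 + w) * t)
    * Rpower Q a5).
    have -> : (M / sigma) ^ n = M ^ n * ((/ sigma) ^ m * (/ sigma) ^ d).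
      rewrite -pow_add; have -> : (m + d)%coq_nat = n by rewrite /m; lia.
      by rewrite -Rpow_mult_distr.
    have -> : (sigma / rho) ^ d = sigma ^ d * (/ rho) ^ d by rewrite -Rpow_mult_distr.
    have es : (/ sigma) ^ d * sigma ^ d = 1.
      by rewrite -Rpow_mult_distr Rinv_l ?pow1; lra.
    transitivity (M ^ n * ((/ sigma) ^ m * (/ rho) ^ d) * ((/ sigma) ^ d * sigma ^ d));
      first by ring.
    rewrite es Rmult_1_r [RHS]Rmult_assoc; congr (_ * _).
    have -> : / sigma = / C1 * Rpower Q s1.
      by rewrite /sigma Rpower_Ropp Rinv_mult Rinv_inv.
    have -> : / rho = Rpower Q (1 + w) by rewrite /rho Rpower_Ropp Rinv_inv.
    rewrite Rpow_mult_distr pow_inv Rmult_assoc; congr (_ * _).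
    rewrite -!Rpower_pow ?Rpower_mult -?Rpower_plus; try exact: Qp.
    congr Rpower.
    have ews : s1 * INR m = INR n.+1 - e * INR m by rewrite nsum /s1 /wc; field; lra.
    by rewrite ews /a5 /gap; ring.
  have qt := Qp ((1 + w) * t).
  apply: (Rmult_le_reg_r (C1 ^ m / M ^ n)); first exact: Rdiv_lt_0_compat.
  have -> : M ^ n * / C1 ^ m * (Rpower Q ((1 + w) * t) * Rpower Q a5) * (C1 ^ m / M ^ n) =
    Rpower Q ((1 + w) * t) * Rpower Q a5 by field; lra.
  have -> : stepC n d * (Rpower M t * Rpower Q ((1 + w) * t)) * (C1 ^ m / M ^ n) =
    Rpower Q ((1 + w) * t) * (stepC n d * Rpower M t * C1 ^ m / M ^ n) by field; lra.
  by apply: Rmult_le_compat_l; lra.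
have [|g [p [gG [ap [hp [hkill hpot']]]]]] := step_core (x := x) (P := P) hd r0 rs hM (erefl _)
  _ cG tn X5 hU rp hpot.
  move=> g gG; have [rx [hx [aP hP]]] := hxP g; have [hg _] := hG g gG.
  split; first exact: (proj1 rx).
  split; first exact: (proj2 (proj2 rx)).
  split=> // i hi; apply: (Rmult_le_reg_l (height n d (x g))); first by have := Qp (1 - e); lra.
  apply: Rle_trans (hP i hi) _.
  apply: Rle_trans (_ : Rpower Q (1 - e) * sigma <= _); last by apply: Rmult_le_compat_r; lra.
  apply: Req_le; rewrite /sigma -Rmult_assoc [Rpower Q (1 - e)
    * C1]Rmult_comm Rmult_assoc -Rpower_plus.
  by congr (_ * Rpower _ _); rewrite /s1; ring.
have hcl y i : cube n p rho y -> (i < n)%N -> Rabs (y i - gpt c M g i) <= (2 + 3 ^ d) * sigma.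
  move=> [_ hy] hi; have := hy i hi; have := hp i hi.
  move: (p i) (gpt c M g i) => u v h1 h2.
  have -> : (2 + 3 ^ d) * sigma = (1 + 3 ^ d) * sigma + sigma by ring.
  by split_Rabs; lra.
have [hg nhg] := hG g gG; have [rx [hx [aP hP]]] := hxP g.
exists p, rho; split; first by split=> //; nra.
split.
  move=> y cy; split=> [|i hi]; first by case: cy.
  have h1 := hcl y i cy hi; have h3 := gpt_half c g (Rlt_le _ _ M0) hi.
  by move: h1 h3; move: (gpt c M g i) => v; split_Rabs; lra.
split.
  move=> y cy hy; apply: nhg; exists y; split=> // i hi.
  by rewrite Rabs_minus_sym; apply: Rle_trans (hcl y i cy hi) _; rewrite /dh; lra.
do 2!split=> //.
exists (C1 * Q), (x g).
have HQ : Rabs H0 + 1 <= C1 * Q.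
  have -> : Rabs H0 + 1 = C1 * (Rabs H0 / C1 + / C1) by field; lra.
  by apply: Rmult_le_compat_l; lra.
split; first by have := Rle_abs H0; lra.
split; first by have := Rabs_pos H0; lra.
do 2!split=> //.
move=> y cy; exists p; split=> //.
have [_ hy] := cy; have he := euclid_le (Rlt_le _ _ r0) hy.
apply: Rle_trans (_ : (C1 * Q) * (INR n * rho) <= _).
  apply: Rmult_le_compat => //; first by have := Qp (1 - e); lra.
  exact: sqrt_pos.
have -> : C1 * Q * (INR n * rho) = C1 * INR n * (Q * rho) by ring.
have -> : Q * rho = Rpower Q (- w).
  by rewrite -{1}(Rpower_1 Q) // -Rpower_plus; congr Rpower; ring.
rewrite -(Rpower_mult_distr C1 Q) // [Rpower C1 (- _)]Rpower_Ropp.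
have c1 := Rpower_gt0 C1 (w - eta).
apply: (Rmult_le_reg_l (Rpower C1 (w - eta))) => //.
rewrite -[X in _ <= X]Rmult_assoc Rinv_r ?Rmult_1_l; last lra.
have -> : - (w - eta) = - w + eta by ring.
have -> : - w = (- w + eta) + - eta by ring.
have -> : - w + eta + - eta + eta = - w + eta by ring.
rewrite Rpower_plus.
have q1 := Qp (- w + eta).
have -> : Rpower C1 (w - eta) * (C1 * INR n * (Rpower Q (- w + eta) * Rpower Q (- eta))) =
   Rpower Q (- w + eta) * (C1 * INR n * Rpower C1 (w - eta) * Rpower Q (- eta)) by ring.
by rewrite -[X in _ <= X]Rmult_1_r; apply: Rmult_le_compat_l; lra.
Qed.

(** * The limit point *)

(** A triple $(a, b, c)$ of naturals stands for $(a-b)/c$, so that rational vectors can be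
    enumerated by [pickle] on sequences. The default triple of [ratvec] codes 0. *)
Definition ratcode (p : nat * nat * nat) : R := (INR p.1.1 - INR p.1.2) / INR p.2.

Definition ratvec (m : nat) (i : nat) : R :=
  ratcode (nth (0, 0, 1)%N (odflt [::] (@unpickle (seq (nat * nat * nat)%type) m)) i).

Lemma ratvec_surj n (q : nat -> Q) : exists m, forall i, (i <= n)%N -> ratvec m i = Q2R (q i).
Proof.
pose code (x : Q) : (nat * nat * nat)%type :=
  (Z.to_nat (Qnum x), Z.to_nat (Z.opp (Qnum x)), Pos.to_nat (Qden x)).
have codeE x : ratcode (code x) = Q2R x.
  rewrite /ratcode /= /Q2R !INR_IZR_INZ positive_nat_Z -minus_IZR.
  have -> // : (Z.sub (Z.of_nat (Z.to_nat (Qnum x))) (Z.of_nat (Z.to_nat (Z.opp (Qnum x)))))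
    = Qnum x.
  by case: (Z.le_ge_cases Z0 (Qnum x)) => h; lia.
exists (pickle (mkseq (fun i => code (q i)) n.+1)) => i hi.
by rewrite /ratvec pickleK /= nth_mkseq.
Qed.

(** Vectors with zero linear part are replaced by a constant one, so that every index names a
    genuine hyperplane that a cube can be made to avoid. *)
Definition nonconst_ratvec n m : nat -> R :=
  if `[< exists i, (i < n)%N /\ ratvec m i <> 0 >] then ratvec m else fun=> 1.

Lemma nonconst_ratvec_neq0 n m : (0 < n)%N -> exists i, (i < n)%N /\ nonconst_ratvec n m i <> 0.
Proof.
move=> n0; rewrite /nonconst_ratvec; case: asboolP => // _.
by exists 0%N; split=> //; lra.
Qed.

Lemma QIndep_off_hyperplanes n theta :
  (forall m, ~ hyperplane n (nonconst_ratvec n m) theta) -> QIndep n theta.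
Proof.
move=> h q hq.
have hz : forall i, (i < n)%N -> Q2R (q i) = 0.
  move=> i hi; apply: contrapT => ne.
  have [m hm] := ratvec_surj n q; apply: (h m).
  rewrite /nonconst_ratvec; case: asboolP => [_|]; last first.
    by case; exists i; split=> //; rewrite hm // ltnW.
  rewrite /hyperplane hm // -[RHS]hq sumR_big; congr (_ + _).
  by apply: eq_bigr => j _; rewrite hm // ltnW.
move=> i /ssrnat.leP; rewrite leq_eqVlt => /orP[/eqP ->|]; last exact: hz.
move: hq; rewrite sumR_big big1 => [|j _]; first lra.
by rewrite hz // Rmult_0_l.
Qed.

(* A cube together with the countable family of sets still to be avoided, and their diameters. *)
Record state := State {
  st_c : nat -> R; st_M : R; st_U : nat -> (nat -> R) -> Prop; st_r : nat -> R }.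

(** Merges the family inherited from earlier cubes with a new cover, so that no set is ever
    dropped. *)
Definition interleave (T : Type) (f g : nat -> T) (j : nat) : T :=
  if odd j then g j./2 else f j./2.

Lemma sum_interleave N (f g : nat -> R) : (forall j, 0 <= f j) -> (forall j, 0 <= g j) ->
  \Sum_(j < N) interleave f g j <= \Sum_(j < N) f j + \Sum_(j < N) g j.
Proof.
move=> f0 g0.
have h k : \Sum_(j < k.*2) interleave f g j = \Sum_(j < k) f j + \Sum_(j < k) g j.
  elim: k => [|k IH]; first by rewrite !big_ord0; lra.
  rewrite doubleS !big_ord_recr /= IH /interleave /= odd_double /= doubleK uphalf_double; lra.
rewrite -h -addnn big_split_ord /= -[X in X <= _]Rplus_0_r; apply: Rplus_le_compat_l.
by apply: sum_ge0 => j; rewrite /interleave; case: ifP.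
Qed.

Lemma interleave_even T (f g : nat -> T) j : interleave f g j.*2 = f j.
Proof. by rewrite /interleave odd_double doubleK. Qed.

Lemma interleave_odd T (f g : nat -> T) j : interleave f g j.*2.+1 = g j.
Proof. by rewrite /interleave /= odd_double /= uphalf_double. Qed.

Lemma nested_intervals (a b : nat -> R) : (forall m, a m <= b m) ->
  (forall m, a m <= a m.+1) -> (forall m, b m.+1 <= b m) -> exists x, forall m, a m <= x <= b m.
Proof.
move=> ab ha hb.
have ha' m k : a m <= a (m + k)%N by elim: k => [|k IH]; rewrite ?addn0 ?addnS;
  [lra | have := ha (m + k)%N; lra].
have hb' m k : b (m + k)%N <= b m by elim: k => [|k IH]; rewrite ?addn0 ?addnS;
  [lra | have := hb (m + k)%N; lra].
have hab m k : a m <= b k.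
  by have := ha' m k; have := hb' k m; have := ab (m + k)%N; rewrite addnC; lra.
have bnd : bound (fun y => exists m, y = a m) by exists (b 0%N) => y [m ->].
have [x [h1 h2]] := completeness _ bnd (ex_intro _ (a 0%N) (ex_intro _ 0%N erefl)).
exists x => m; split; first by apply: h1; exists m.
by apply: h2 => y [k ->].
Qed.

Section LimitPoint.
Variables (n d : nat) (E : nat -> (nat -> R) -> Prop) (t w : nat -> R).
Hypotheses (hd : (d < n)%N) (t_mono : forall m, t m <= t m.+1) (t_bnd : forall m, 0 <= t m <= INR n)
  (w_ge : forall m, INR d.+1 / INR (n - d) <= w m)
  (tw : forall m, (t m - INR d) * (1 + w m) < INR n.+1)
  (E_null : forall m, HNull n (t m) (E m)).

Definition approximant m (y : nat -> R) : Prop :=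
  exists H x, INR m <= H /\ 1 <= H /\ RatAffData n d x /\ height n d x <= H /\
    exists P, AffOf n d x P /\ height n d x * euclid n y P <= Rpower H (- (w m - / INR m.+1)).

Definition good_state m (s : state) : Prop :=
  0 < st_M s /\ (forall j, diam_le n (st_U s j) (st_r s j)) /\ (forall j, 0 < st_r s j) /\
  (forall N, potential n (st_U s) (st_r s) (t m) (st_c s) (st_M s) N <= kappa0 n d) /\
  (forall j, st_M s <= st_r s j -> ~ meets n (st_U s j) (st_c s) (st_M s)) /\
  (forall y, E m y -> exists j, st_U s j y).

Definition next_state m (s s' : state) : Prop :=
  st_M s' <= st_M s / 2 /\
  (forall y, cube n (st_c s') (st_M s') y -> cube n (st_c s) (st_M s) y) /\
  (forall y, cube n (st_c s') (st_M s') y -> ~ hyperplane n (nonconst_ratvec n m) y) /\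
  (forall y, cube n (st_c s') (st_M s') y -> approximant m y) /\
  (forall j, exists j', st_U s' j' = st_U s j /\ st_r s' j' = st_r s j).

Lemma kappa0_gt0 : 0 < kappa0 n d.
Proof. by apply: Rinv_0_lt_compat; have [_ [_]] := killC_ge n d; lra. Qed.

(** The mesh [M / 2] keeps the new sets smaller than the cube, so none of them violates the
    invariant on large sets. The cost is prescribed relative to $M^t$ because the potential is
    normalised by [M]. *)
Lemma small_cover m M b : 0 < M -> 0 < b -> exists V r, (forall j, diam_le n (V j) (r j)) /\
  (forall j, 0 < r j < M) /\ (forall y, E m y -> exists j, V j y) /\
  forall c N, potential n V r (t m) c M N <= b.
Proof.
move=> M0 b0.
have e0 : 0 < b * Rpower M (t m) by apply: Rmult_lt_0_compat => //; apply: Rpower_gt0.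
have [V [r [h1 [h2 [h3 [B [hB h4]]]]]]] := E_null m (ltac:(lra) : 0 < M / 2) e0.
exists V, r; split; first exact: h2.
split; first by move=> j; have := h1 j; lra.
split=> // c N; have pM := Rpower_gt0 M (t m).
apply: (Rmult_le_reg_r (Rpower M (t m))) => //.
apply: Rle_trans (Rlt_le _ _ hB); apply: Rle_trans (h4 N);
  rewrite sumR_big /potential big_distrl /=.
apply: sum_le => j; case: ifP => _; last by rewrite Rmult_0_l; apply/Rlt_le/Rpower_gt0.
have rj := h1 j; rewrite Rpower_mult_distr //; last by apply: Rdiv_lt_0_compat; lra.
by apply: Req_le; congr Rpower; field; lra.
Qed.

(** Only sets with [r j < M] contribute. This is what allows the exponent to grow from one stage to
    the next without losing the sets already carried. *)
Lemma potential_expo U r t1 t2 c M N : 0 < M -> (forall j, 0 < r j) -> t1 <= t2 ->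
  potential n U r t2 c M N <= potential n U r t1 c M N.
Proof.
move=> M0 rp t12; apply: sum_le => j; case: asboolP => [[rj _]|_]; last lra.
have h : 1 <= M / r j by apply: div_ge1 => //; lra.
have -> : r j / M = / (M / r j) by field; have := rp j; lra.
by rewrite !Rpower_inv; try lra; apply: Rpower_expo_le; lra.
Qed.

Lemma initial_state : exists s, good_state 0 s.
Proof.
have [V [r [h1 [h2 [h3 h4]]]]] := small_cover 0 Rlt_0_1 kappa0_gt0.
exists (State (fun _ => 0) 1 V r); split; first by rewrite /=; lra.
split=> //; split; first by move=> j /=; case: (h2 j).
by split=> //; split=> // j /=; have := h2 j; lra.
Qed.

Lemma state_step m s : good_state m s -> exists s', good_state m.+1 s' /\ next_state m s s'.
Proof.
move=> [M0 [hU [rp [hpot [hbig hE]]]]].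
have n0 : (0 < n)%N by apply: leq_ltn_trans hd.
have eta0 : 0 < / INR m.+1 by apply/Rinv_0_lt_compat/lt_0_INR/ssrnat.ltP.
have [c' [M' [[M'0 M'2] [hsub [hhyp [hkill [hpot' [H [x [H1 [H2 [rx [hx happ]]]]]]]]]]]]] :=
  nested_cube_step (INR m) hd (w_ge m) (t_bnd m) (tw m)
    eta0 M0 hU rp hpot (nonconst_ratvec_neq0 m n0).
(* Half of the budget is taken by the inherited sets, the other half by the cover of [E m.+1]. *)
have k2 : 0 < kappa0 n d / 2 by have := kappa0_gt0; lra.
have [V [v [h1 [h2 [h3 h4]]]]] := small_cover m.+1 M'0 k2.
exists (State c' M' (interleave (st_U s) V) (interleave (st_r s) v)); split.
  split=> //; split.
    by move=> j /=; rewrite /interleave; case: ifP => _; [apply: h1 | apply: hU].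
  split; first by move=> j /=; rewrite /interleave; case: ifP => _; [case: (h2 j./2) | apply: rp].
  split.
    move=> N /=.
    have e1 := potential_expo (st_U s) c' N M'0 rp (t_mono m).
    have e2 := hpot' N; have e3 := h4 c' N.
    apply: Rle_trans (_ : potential n (st_U s) (st_r s) (t m.+1)
      c' M' N + potential n V v (t m.+1) c' M' N <= _); last lra.
    rewrite /potential.
    pose f j := if `[< st_r s j < M' /\ meets n (st_U s j) c' M' >] then Rpower (st_r s j / M')
      (t m.+1) else 0.
    pose g j := if `[< v j < M' /\ meets n (V j) c' M' >] then Rpower (v j / M') (t m.+1) else 0.
    apply: Rle_trans (sum_interleave N (f := f) (g := g) _ _); last 2 first.
    - by move=> j; rewrite /f; case: ifP => _; [apply/Rlt_le/Rpower_gt0 | lra].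
    - by move=> j; rewrite /g; case: ifP => _; [apply/Rlt_le/Rpower_gt0 | lra].
    by apply: Req_le; apply: eq_bigr => j _; rewrite /interleave /f /g; case: (odd j).
  split.
    move=> j /=; rewrite /interleave; case: ifP => _ hj; first by have := h2 j./2; lra.
    have [hr|hr] := Rlt_le_dec (st_r s j./2) (st_M s); first by apply: hkill; lra.
    by move=> [y [Uy cy]]; apply: (hbig _ hr); exists y; split=> //; apply: hsub.
  by move=> y /h3 [j hj]; exists j.*2.+1; rewrite /= interleave_odd.
split=> //; split=> //; split=> //; split.
  move=> y /happ [P [aP hP]]; exists H, x; do 4!split=> //; by exists P.
by move=> j; exists j.*2; rewrite /= !interleave_even.
Qed.

(** If the common point of the cubes were in [E m], it would lie in a set of the cover added at
    stage [m]. That set persists, and the cubes eventually shrink below its fixed radius, whereas no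
    set that large meets the cube. Both [t] and [w] depend on the stage: a finite exponent uses
    constant [w] and growing [t], the infinite one constant [t] and growing [w]. *)
Lemma limit_point_exists : exists y, VecN n y /\ QIndep n y /\ (forall m, approximant m y)
  /\ forall m, ~ E m y.
Proof.
have [s0 hs0] := initial_state.
have /choice [F hF] : forall ms : nat * state, exists s', good_state ms.1 ms.2 ->
    good_state ms.1.+1 s' /\ next_state ms.1 ms.2 s'.
  move=> [m s] /=; have [h|h] := pselect (good_state m s); last by exists s.
  by have [s' hs'] := state_step h; exists s'.
pose S := fix S m := if m is k.+1 then F (k, S k) else s0.
have gS m : good_state m (S m).
  by elim: m => [|m IH] //=; case: (hF (m, S m) IH).
have nS m : next_state m (S m) (S m.+1) by case: (hF (m, S m) (gS m)).
have M0 m : 0 < st_M (S m) by case: (gS m).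
have nest i m : (i < n)%N -> st_c (S m) i - st_M (S m) <= st_c (S m.+1) i - st_M (S m.+1) /\
    st_c (S m.+1) i + st_M (S m.+1) <= st_c (S m) i + st_M (S m).
  move=> hi; have [_ [hsub _]] := nS m.
  (* Shifting all coordinates of the centre by plus or minus the new radius gives two opposite
     corners, which turn the inclusion of cubes into one of intervals. *)
  pose z (e : R) k := if (k < n)%N then st_c (S m.+1) k + e else 0.
  have hz e : Rabs e <= st_M (S m.+1) -> Rabs (st_c (S m.+1) i + e - st_c (S m) i) <= st_M (S m).
    move=> he; have /hsub [_ /(_ i hi)] : cube n (st_c (S m.+1)) (st_M (S m.+1)) (z e).
      split; first by move=> k /ssrnat.leP hk; rewrite /z ltnNge hk.
      by move=> k hk; rewrite /z hk; have -> : st_c (S m.+1) k + e - st_c (S m.+1) k = e by ring.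
    by rewrite /z hi.
  have Mp := M0 m.+1.
  have a1 := hz (st_M (S m.+1)) (ltac:(rewrite Rabs_pos_eq; lra)).
  have a2 := hz (- st_M (S m.+1)) (ltac:(rewrite Rabs_Ropp Rabs_pos_eq; lra)).
  by split; [move: a2 | move: a1]; split_Rabs; lra.
have /choice [y hy] : forall i, exists x, if (i < n)%N then
    forall m, st_c (S m) i - st_M (S m) <= x <= st_c (S m) i + st_M (S m) else x = 0.
  move=> i; case hi: (i < n)%N; last by exists 0.
  apply: nested_intervals => m; [have := M0 m; lra | by case: (nest i m hi)
    | by case: (nest i m hi)].
have cy m : cube n (st_c (S m)) (st_M (S m)) y.
  split; first by move=> i /ssrnat.leP hi; have := hy i; rewrite ltnNge hi.
  by move=> i hi; have := hy i; rewrite hi => /(_ m) h; split_Rabs; lra.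
exists y; split; first by case: (cy 0%N).
split.
  by apply: QIndep_off_hyperplanes => m; have [_ [_ [h _]]] := nS m; apply: h.
split; first by move=> m; have [_ [_ [_ [h _]]]] := nS m; apply: h.
move=> m Em.
have [_ [_ [_ [_ [_ hE]]]]] := gS m; have [j hj] := hE y Em.
have keep k : exists j', st_U (S (m + k)%N) j' = st_U (S m) j /\ st_r (S (m + k)%N)
  j' = st_r (S m) j.
  elim: k => [|k [j' [e1 e2]]]; first by exists j; rewrite addn0.
  have [_ [_ [_ [_ h]]]] := nS (m + k)%N; have [j2 [e3 e4]] := h j'.
  by exists j2; rewrite addnS e3 e4.
have shrink k : st_M (S (m + k)%N) <= st_M (S m) * (/ 2) ^ k.
  elim: k => [|k IH]; first by rewrite addn0 /=; lra.
  have [h _] := nS (m + k)%N; rewrite addnS; have -> : (/ 2) ^ k.+1 = / 2 * (/ 2) ^ k by [].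
  by move: h IH; move: (st_M _) (st_M _) ((/ 2) ^ k) => u v p *; lra.
have rj : 0 < st_r (S m) j by have [_ [_ [h _]]] := gS m.
have Mm := M0 m.
have [k hk] := pow_lt_1_zero (/ 2) (ltac:(rewrite Rabs_pos_eq; lra)) (st_r (S m) j / st_M (S m))
  (Rdiv_lt_0_compat _ _ rj Mm).
have hk' := hk k (le_n k); rewrite Rabs_pos_eq in hk'; last by apply: pow_le; lra.
have [j' [e1 e2]] := keep k.
have [_ [_ [_ [_ [hbig _]]]]] := gS (m + k)%N.
apply: (hbig j').
  rewrite e2; apply: Rle_trans (shrink k) _.
  have -> : st_r (S m) j = st_M (S m) * (st_r (S m) j / st_M (S m)) by field; lra.
  by apply: Rmult_le_compat_l; lra.
by exists y; rewrite e1; split.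
Qed.
End LimitPoint.

(** * Dimensions *)

Lemma ER_le_trans a b c : ER_le a b -> ER_le b c -> ER_le a c.
Proof. by case: a b c => [a||] [b||] [c||] //=; apply: Rle_trans. Qed.

Lemma ER_le_refl a : ER_le a a.
Proof. by case: a => [a||] //=; apply: Rle_refl. Qed.

Lemma IsSupE_exists (A : R -> Prop) a0 : A a0 -> exists e, IsSupE A e.
Proof.
move=> A0; have [[b hb]|nb] := pselect (exists b, forall a, A a -> a <= b).
  have [z [h1 h2]] := completeness A (ex_intro _ b hb) (ex_intro _ a0 A0).
  exists (Fin z); split=> [a Aa|[r||] h] //=; first exact: h1.
    by apply: h2 => a /h.
  exact: (h a0 A0).
exists PInf; split=> [//|[r||] h] //=; first by apply: nb; exists r => a /h.
exact: (h a0 A0).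
Qed.

Lemma IsSupE_lt (A : R -> Prop) e x w : IsSupE A e -> ER_le (Fin x)
  e -> w < x -> exists a, w <= a /\ A a.
Proof.
move=> [_ he] xe wx; apply: contrapT => hn.
have /(ER_le_trans xe) /= : ER_le e (Fin w).
  by apply: he => a Aa /=; apply: Rnot_lt_le => h; apply: hn; exists a; split=> //; lra.
lra.
Qed.

Lemma IsSupE_ge (A : R -> Prop) e x : IsSupE A e -> (forall a, a < x -> A a) -> ER_le (Fin x) e.
Proof.
move=> [h1 _] hx; case: e h1 => [z||] h1 //=; last by apply: (h1 (x - 1)); apply: hx; lra.
apply: Rnot_lt_le => zx; have /= := h1 ((z + x) / 2) (hx _ (ltac:(lra) : (z + x) / 2 < x)).
lra.
Qed.

(** The infimum comes from completeness applied to the negated distances, which are bounded above by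
    0. *)
Lemma distAff_exists n d theta x P : AffOf n d x P ->
  exists delta, distAff n d theta x delta /\ delta <= euclid n theta P.
Proof.
move=> aP.
pose A := fun r => exists Q, AffOf n d x Q /\ r = - euclid n theta Q.
have [z [h1 h2]] : {z | is_lub A z}.
  apply: completeness; first by exists 0 => r [Q [_ ->]]; have := sqrt_pos (sumR n (fun i =>
    (theta i - Q i) ^ 2)); rewrite /euclid; lra.
  by exists (- euclid n theta P); exists P.
exists (- z); split; last by have := h1 _ (ex_intro _ P (conj aP erefl)); lra.
split=> [r [Q [aQ ->]]|m hm]; first by have := h1 _ (ex_intro _ Q (conj aQ erefl)); lra.
suff : z <= - m by lra.
by apply: h2 => r [Q [aQ ->]]; have := hm _ (ex_intro _ Q (conj aQ erefl)); lra.
Qed.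

Lemma INR_unbounded a : exists m, a <= INR m.
Proof.
exists (nfloor (Rabs a)).+1; rewrite S_INR; have := nfloorP (Rabs_pos a).
by have := Rle_abs a; lra.
Qed.

Lemma approximant_ExpSet n d w y omega m0 : (forall m, approximant n d w m y) ->
  (forall m, (m0 <= m)%N -> omega <= w m - / INR m.+1) -> ExpSet n d y omega.
Proof.
move=> happ hom H0; have [m1 hm1] := INR_unbounded H0.
have [H [x [h1 [h2 [rx [hx [P [aP hP]]]]]]]] := happ (maxn m0 m1).
have [del [hdel hle]] := distAff_exists y aP.
have hm := leq_INR (leq_maxr m0 m1).
exists H; split; first lra.
exists x; do 2!split=> //; exists del; split=> //.
apply: Rle_trans (_ : height n d x * euclid n y P <= _).
  by apply: Rmult_le_compat_l => //; apply: sqrt_pos.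
apply: Rle_trans hP _; apply: Rpower_expo_le => //.
by have := hom (maxn m0 m1) (leq_maxl _ _); lra.
Qed.

Definition dimW n d (x : R) : R := INR d + INR n.+1 / (1 + x).

Section Main.
Variables n d : nat.
Hypothesis hd : (d < n)%N.
Let wc := INR d.+1 / INR (n - d).

Lemma nd_pos : 0 < INR (n - d).
Proof. by apply/lt_0_INR/ssrnat.ltP; rewrite subn_gt0. Qed.

Lemma nd_sum : INR n.+1 = INR (n - d) + INR d.+1.
Proof. by rewrite -plus_INR; congr INR; lia. Qed.

Lemma dS_pos : 0 < INR d.+1.
Proof. by rewrite S_INR; have := pos_INR d; lra. Qed.

Lemma wc_pos : 0 < wc.
Proof. exact: Rdiv_lt_0_compat dS_pos nd_pos. Qed.

Lemma dimW_wc : dimW n d wc = INR n.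
Proof.
have h := nd_pos; have h2 := dS_pos; have h3 := nd_sum; have h4 := S_INR d; have h5 := S_INR n.
rewrite /dimW /wc; have -> : 1 + INR d.+1 / INR (n - d) = INR n.+1 / INR (n - d) by rewrite h3;
  field; lra.
have -> : INR n.+1 / (INR n.+1 / INR (n - d)) = INR (n - d) by field; lra.
lra.
Qed.

Lemma dimW_lt x y : 0 < x -> x < y -> dimW n d y < dimW n d x.
Proof.
move=> x0 xy; have h := pos_INR n; have h5 := S_INR n; apply: Rplus_lt_compat_l.
by apply: Rmult_lt_compat_l; [lra | apply: Rinv_lt_contravar; nra].
Qed.

Lemma dimW_gt x : 0 < x -> INR d < dimW n d x.
Proof.
move=> x0; have h := pos_INR n; have h5 := S_INR n.
suff : 0 < INR n.+1 / (1 + x) by rewrite /dimW; lra.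
by apply: Rdiv_lt_0_compat; lra.
Qed.

Lemma dimW_le_n x : wc <= x -> dimW n d x <= INR n.
Proof.
move=> hx; rewrite -dimW_wc; have [h|->] := Rle_lt_or_eq_dec _ _ hx; last lra.
exact/Rlt_le/dimW_lt/h/wc_pos.
Qed.

Lemma W_null x s : 0 < x -> dimW n d x < s -> HNull n s (W n d (Fin x)).
Proof.
move=> x0 hs; have h := pos_INR n; have h5 := S_INR n.
(* Capping [s] meets the hypothesis of [approx_null] that $s - d \le n+1$. *)
pose s1 := Rmin s (INR d + INR n.+1).
have hs1 : dimW n d x < s1.
  apply: Rmin_glb_lt => //; apply: Rplus_lt_compat_l.
  apply: (Rmult_lt_reg_r (1 + x)); first lra.
  by have -> : INR n.+1 / (1 + x) * (1 + x) = INR n.+1 by [field; lra]; nra.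
apply: (@HNull_le _ s1); first exact: Rmin_l.
have ht : s1 - INR d <= INR n.+1 by have := Rmin_r s (INR d + INR n.+1); rewrite -/s1; lra.
have hd1 := dimW_gt x0.
pose tau := s1 - INR d.
have tau0 : 0 < tau by rewrite /tau; lra.
(* The exponent whose expected dimension is exactly [s1]. Any [w] strictly between [w0] and [x]
   serves: below [x] it is surpassed within [ExpSet], above [w0] the cover is cheap. *)
pose w0 := INR n.+1 / tau - 1.
have w00 : 0 <= w0 by have := div_ge1 tau0 ht; rewrite /w0; lra.
have w0x : w0 < x.
  have : INR n.+1 / (1 + x) < tau by move: hs1; rewrite /dimW /tau; lra.
  move=> h1; apply: (Rmult_lt_reg_r tau) => //.
  have -> : w0 * tau = INR n.+1 - tau by rewrite /w0; field; lra.
  have : INR n.+1 / (1 + x) * (1 + x) < tau * (1 + x) by apply: Rmult_lt_compat_r; lra.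
  have -> : INR n.+1 / (1 + x) * (1 + x) = INR n.+1 by field; lra.
  lra.
pose w := (w0 + x) / 2.
apply: HNull_sub (_ : HNull n s1 (fun theta =>
  VecN n theta /\ exists omega, w <= omega /\ ExpSet n d theta omega)).
  move=> theta [vt [_ [e [he xe]]]]; split=> //.
  by apply: (IsSupE_lt he xe); rewrite /w; lra.
apply: approx_null => //; try (rewrite /w; lra).
have -> : INR n.+1 = (1 + w0) * (s1 - INR d) by rewrite /w0 -/tau; field; lra.
by apply: Rmult_lt_compat_r; rewrite /w; lra.
Qed.

(** The limit point has exponent at least [x] by its approximants, and at most [x] because it avoids
    every [W n d (Fin (x + 1/(k+1)))]. It therefore lies in the exact-exponent set, which it was
    also made to avoid. *)
Lemma Wstar_not_null_fin x s : wc <= x -> 0 < s -> s < dimW n d x -> ~ HNull n s (Wstar n d (Fin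
  x)).
Proof.
move=> hx s0 hs hnull.
have wc0 := wc_pos; have x0 : 0 < x by lra.
have h := pos_INR n; have h5 := S_INR n.
have ik k : 0 < / INR k.+1 by apply/Rinv_0_lt_compat/lt_0_INR/ssrnat.ltP.
have ikS k : / INR k.+2 < / INR k.+1.
  have h1 := pos_INR k.+1; have := ik k; have := S_INR k.+1; have := S_INR k;
    have := pos_INR k => *.
  by apply: Rinv_lt_contravar; nra.
pose xk k := x + / INR k.+1.
pose E k := if k is j.+1 then W n d (Fin (xk j)) else Wstar n d (Fin x).
(* These exponents do not decrease and stay below [dimW n d x]. Owing to the shift of index in [E],
   [t k.+1] exceeds [dimW n d (xk k)], so [E k.+1] is null at that exponent. *)
pose t k := Rmax s ((dimW n d (xk k) + dimW n d x) / 2).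
have xk0 k : x < xk k by rewrite /xk; have := ik k; lra.
have Dk k : dimW n d (xk k) < dimW n d x by apply: dimW_lt.
have DkS k : dimW n d (xk k) < dimW n d (xk k.+1).
  by apply: dimW_lt; [have := xk0 k.+1; lra | rewrite /xk; have := ikS k; lra].
have ts k : s <= t k by apply: Rmax_l.
have tD k : t k < dimW n d x by apply: Rmax_lub_lt => //; have := Dk k; lra.
have [y [vy [qy [ay ny]]]] := @limit_point_exists n d E t (fun=> x) hd
  (fun k => ltac:(apply: Rmax_lub; [apply: Rmax_l | apply: Rle_trans (Rmax_r _ _); have := DkS k;
    lra]))
  (fun k => ltac:(have := ts k; have := tD k; have := dimW_le_n hx; split; lra))
  (fun=> hx)
  (fun k => ltac:(apply: (Rmult_lt_reg_r (/ (1 + x))); [apply: Rinv_0_lt_compat;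
    lra | rewrite Rmult_assoc Rinv_r; [have := tD k; rewrite /dimW /Rdiv; lra | lra]]))
  (fun k => ltac:(case: k => [|k]; [exact: HNull_le (ts 0%N) hnull |
     apply: W_null; [have := xk0 k; lra | apply: Rlt_le_trans (Rmax_r _ _); have := DkS k;
       have := Dk k.+1; have := Dk k; lra]])).
have hexp a : a < x -> ExpSet n d y a.
  move=> ax; have [m0 hm0] := INR_unbounded (/ (x - a)).
  apply: (approximant_ExpSet (m0 := m0) ay) => m hm.
  have p0 : 0 < / (x - a) by apply: Rinv_0_lt_compat; lra.
  have hm' : / (x - a) <= INR m.+1 by have := leq_INR (leqW hm); lra.
  have : / INR m.+1 <= x - a by rewrite -[x - a]Rinv_inv; apply: Rinv_le_contravar.
  lra.
have [e he] := IsSupE_exists (hexp (x - 1) ltac:(lra)).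
have xe := IsSupE_ge he hexp.
have hW k : ~ ER_le (Fin (xk k)) e.
  by move=> hk; apply: (ny k.+1); split=> //; split=> //; exists e.
apply: (ny 0%N); split=> //; split=> //.
suff -> : Fin x = e by [].
case: e he xe hW => [z||] he xe hW //; last by case: (hW 0%N).
congr Fin; apply: Rle_antisym => //; apply: Rnot_lt_le => xz.
have [m hm] := INR_unbounded (/ (z - x)).
apply: (hW m) => /=; rewrite /xk.
have p0 : 0 < / (z - x) by apply: Rinv_0_lt_compat; lra.
have hm' : / (z - x) <= INR m.+1 by have := leq_INR (leqnSn m); lra.
have : / INR m.+1 <= z - x by rewrite -[z - x]Rinv_inv; apply: Rinv_le_contravar.
lra.
Qed.

(** For $s < d$ the condition $(s-d)(1+w) < n+1$ holds for every positive [w], so the exponent can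
    be raised at each stage without limit. *)
Lemma Wstar_not_null_inf s : 0 < s -> s < INR d -> ~ HNull n s (Wstar n d PInf).
Proof.
move=> s0 hs hnull.
have h := pos_INR n; have h5 := S_INR n; have wc0 := wc_pos.
have dn : INR d <= INR n by apply/leq_INR/ltnW.
have [y [vy [qy [ay ny]]]] := @limit_point_exists n d (fun=> Wstar n d PInf) (fun=> s) (fun m =>
  wc + INR m) hd
  (fun=> Rle_refl s) (fun=> ltac:(split; lra)) (fun m => ltac:(have := pos_INR m; rewrite -/wc;
    lra))
  (fun m => ltac:(have := pos_INR m; nra)) (fun=> hnull).
have hexp a : ExpSet n d y a.
  have [m0 hm0] := INR_unbounded (a + 1).
  apply: (approximant_ExpSet (m0 := m0) ay) => m hm.
  have h1 := leq_INR hm.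
  have : / INR m.+1 <= 1.
    rewrite -Rinv_1; apply: Rinv_le_contravar; first lra.
    by rewrite S_INR; have := pos_INR m; lra.
  lra.
apply: (ny 0%N); split=> //; split=> //; split=> [//|[z||] hz] //=.
  by have /= := hz (z + 1) (hexp _); lra.
exact: (hz 0 (hexp 0)).
Qed.

Lemma W_mono w w' theta : ER_le w w' -> W n d w' theta -> W n d w theta.
Proof. by move=> h [v [q [e [h1 h2]]]]; do 2!split=> //; exists e; split=> //;
  apply: ER_le_trans h h2. Qed.

Lemma Wstar_W w theta : Wstar n d w theta -> W n d w theta.
Proof. by move=> [v [q h]]; do 2!split=> //; exists w; split=> //; apply: ER_le_refl. Qed.

(** For infinite [w] the set is contained in [W n d (Fin x)] for every real [x]; the choice $x =
    (n+1)/\tau$ already has $(n+1)/(1+x) < \tau$. *)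
Lemma W_null_ER w s : ER_le (Fin wc) w -> INR d + Defs.frac n w < s -> HNull n s (W n d w).
Proof.
have wc0 := wc_pos; have h := pos_INR n; have h5 := S_INR n.
case: w => [x||] //= hx hs; first by apply: W_null => //; lra.
pose tau := s - INR d.
have t0 : 0 < tau by rewrite /tau; lra.
pose x := INR n.+1 / tau.
have x0 : 0 < x by apply: Rdiv_lt_0_compat; lra.
apply: HNull_sub (W_null x0 _); first by move=> theta; apply: W_mono.
suff : INR n.+1 / (1 + x) < tau by rewrite /dimW /tau; lra.
apply: (Rmult_lt_reg_r (1 + x)); first lra.
have -> : INR n.+1 / (1 + x) * (1 + x) = INR n.+1 by field; lra.
have -> : tau * (1 + x) = tau + INR n.+1 by rewrite /x; field; lra.
lra.
Qed.

Lemma Wstar_not_null w s : ER_le (Fin wc) w -> 0 < s -> HNull n s (Wstar n d w)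
  -> INR d + Defs.frac n w <= s.
Proof.
case: w => [x||] //= hx s0 hn; apply: Rnot_lt_le => hs.
  exact: (Wstar_not_null_fin hx s0 hs hn).
by apply: (Wstar_not_null_inf s0 _ hn); lra.
Qed.

Lemma hausdorff_dimensions w : ER_le (Fin wc) w ->
  HausDim n (Wstar n d w) (INR d + Defs.frac n w) /\ HausDim n (W n d w) (INR d + Defs.frac n w) /\
  (INR d + Defs.frac n w = INR n <-> w = Fin wc).
Proof.
move=> hw; have wc0 := wc_pos.
have D0 : 0 <= INR d + Defs.frac n w.
  have d0 := pos_INR d; case: w hw => [x||] // hx; rewrite /Defs.frac; last lra.
  have hx' : wc <= x by [].
  by have := dimW_gt (ltac:(lra) : 0 < x); rewrite /dimW; lra.
(* Both sets are treated at once: any [F] between [Wstar] and [W] takes the lower bound from the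
   former and the upper bound from the latter. *)
have dim (F : (nat -> R) -> Prop) : (forall y, Wstar n d w y -> F y)
  -> (forall y, F y -> W n d w y) ->
    HausDim n F (INR d + Defs.frac n w).
  move=> h1 h2; split=> [s [s0 hs]|m hm]; first by apply: Wstar_not_null => //; apply: HNull_sub hs.
  apply: Rnot_lt_le => hlt; pose s := (INR d + Defs.frac n w + m) / 2.
  have : m <= s; last by rewrite /s; lra.
  apply: hm; split; first by rewrite /s; lra.
  by apply: HNull_sub h2 _; apply: W_null_ER => //; rewrite /s; lra.
split; first by apply: dim => // y; apply: Wstar_W.
split; first by apply: dim => // y; apply: Wstar_W.
split=> [|->]; last exact: dimW_wc.
case: w hw {D0 dim} => [x||] // hx; rewrite /Defs.frac => hD.
  congr Fin; apply: Rle_antisym => //; apply: Rnot_lt_le => hlt.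
  by have := dimW_lt wc0 hlt; rewrite dimW_wc /dimW; lra.
by have : INR d < INR n by [apply/lt_INR/ssrnat.ltP]; lra.
Qed.
End Main.

Lemma lt_of_le_pred n d : (2 <= n)%coq_nat -> (d <= n - 1)%coq_nat -> (d < n)%N.
Proof. by lia. Qed.

End Proofs.

Theorem theorem3 (n d : nat) (w : ER) :
  (2 <= n)%nat -> (d <= n - 1)%nat ->
  ER_le (Fin (INR (S d) / INR (n - d))) w ->
  HausDim n (Wstar n d w) (INR d + frac n w) /\
  HausDim n (W n d w) (INR d + frac n w) /\
  (INR d + frac n w = INR n <-> w = Fin (INR (S d) / INR (n - d))).
Proof.
intros n2 dn hw; apply Proofs.hausdorff_dimensions; trivial.
apply Proofs.lt_of_le_pred; trivial.
Qed.
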